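(* Let $f$ be a bounded global pdf, on $\bigcup_N\mathcal W_{0:\mathfrak d-1}^N$, of a random persistence diagram, satisfying: (A1) there is $M\in\mathbb N$ with $f(Z)=0$ whenever $|Z|>M$; (A2)* the local density $f_N=f|_{\mathcal W_{0:\mathfrak d-1}^N}$ is bounded for each $N\in\{1,\dots,M\}$; (A3)* there exists $C>0$ such that $f(\xi_1,\dots,\xi_N)\le C\|(\xi_1,\dots,\xi_N)\|^{-2N-2}$ for each $N\in\{1,\dots,M\}$. Let $\hat f(Z)=\frac1n\sum_{i=1}^nK_\sigma(Z,\mathscr D_i)$ be the kernel density estimate with centers $\mathscr D_i$ sampled i.i.d. according to the global pdf $f$ and bandwidth $\sigma=\sigma_n>0$ with $\sigma_n=O(n^{-\alpha})$, where $0<\alpha<\alpha_{2M}$. Then for any origin diagram $\mathscr D_0$, the mean absolute bottleneck deviation estimate converges: as $n\to\infty$, $$\int_{\mathcal W_{0:\mathfrak d-1}}W_\infty(\mathscr D_0,Z)\,\hat f(Z)\,\delta Z\;\longrightarrow\;\int_{\mathcal W_{0:\mathfrak d-1}}W_\infty(\mathscr D_0,Z)\,f(Z)\,\delta Z$$ in probability.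
   Context: **Setting.** $W=\{(b,d)\in\mathbb R^2:d>b\ge0\}$; $\mathcal W_{0:\mathfrak d-1}=W\times\{0,\dots,\mathfrak d-1\}$ is the disjoint union of $\mathfrak d$ copies of $W$, with Lebesgue measure on each copy; $\|(\xi_1,\dots,\xi_N)\|$ is the norm of the vector of birth/death coordinates. A persistence diagram is a finite multiset of features $(b,d,k)\in\mathcal W_{0:\mathfrak d-1}$; $|Z|$ is its cardinality. A random persistence diagram $D$ has global pdf $f:\bigcup_N\mathcal W_{0:\mathfrak d-1}^N\to[0,\infty)$ if $\mathbb P[D\subset A]=\sum_{N\ge0}\int_{A^N}f(\xi_1,\dots,\xi_N)\,d\xi_1\cdots d\xi_N$ for all Borel $A$ (with $N=0$ term $f(\emptyset)=\mathbb P[D=\emptyset]$). **Set integrals.** For a global pdf $f$ (or $\hat f$), the integral $\int W_\infty(\mathscr D_0,Z)f(Z)\,\delta Z$, in which $f(Z)$ for a set $Z=\{\xi_1,\dots,\xi_N\}$ means $N!$ times the symmetrized $f$ and the set integral is $\int g(Z)\delta Z=\sum_N\frac1{N!}\int g(\{\xi_1,\dots,\xi_N\})d\xi_1\cdots d\xi_N$, equals $\sum_{N\ge0}\int_{\mathcal W_{0:\mathfrak d-1}^N}W_\infty(\mathscr D_0,\{\xi_1,\dots,\xi_N\})f(\xi_1,\dots,\xi_N)\,d\xi_1\cdots d\xi_N$, i.e. the expectation of $W_\infty(\mathscr D_0,D)$ for $D$ with global pdf $f$ (the mean absolute bottleneck deviation, MAD). **Bottleneck distance.** $W_\infty(D_1,D_2)=\min_\gamma\max_{x\in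 D_1}\|x-\gamma(x)\|_\infty$, where $\gamma$ ranges over bijections between $D_1$ and $D_2$ matching features of the same degree $k$, and the diagonal $\{b=d\}$ is included in both diagrams (in each degree) with infinite multiplicity. **Threshold.** $\alpha_{2M}=\frac1{2M}$, the exponent threshold of classical kernel density estimation in $\mathbb R^{2M}$. **Single-degree kernel.** Given a center $\mathscr D\subset W$ and $\sigma>0$, put $\mathscr D^u=\{(b_i,d_i)\in\mathscr D:d_i-b_i\ge\sigma\}$, $\mathscr D^\ell=\{(b_i,d_i)\in\mathscr D:d_i-b_i<\sigma\}$, $N_u=|\mathscr D^u|$, $N_\ell=|\mathscr D^\ell|$. For the features $(b_j,d_j)$, $j=1,\dots,N_u$, of $\mathscr D^u$, let $\varphi_j$ be the density of $N((b_j,d_j),\sigma^2I_2)$, $q^{(j)}=\int_{\{v>u\}}\varphi_j(u,v)\,du\,dv$, $p^{(j)}=\frac{\varphi_j}{\int_W\varphi_j}\mathbf 1_W$. Let $\nu$ be a probability mass function on $\{0,1,2,\dots\}$ (depending on $N_\ell$) with mean $N_\ell$ and $\nu(n)=0$ for $n>mN_\ell$, $m>0$ a fixed constant; $\nu(n)=0$ for $n<0$. Let $p^\ell$ be the probability density on $W$ proportional to $\mathbf 1_W(b,d)\frac1{N_\ell}\sum_{(b_i,d_i)\in\mathscr D^\ell}\frac1{\pi\sigma^2}\exp\big(-[(b-\frac{b_i+d_i}2)^2+(d-\frac{b_i+d_i}2)^2]/2\sigma^2\big)$ (not needed if $N_\ell=0$, when $\nu(0)=1$). Let $I(j,N_u)$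 be the increasing injections $\{1,\dots,j\}\to\{1,\dots,N_u\}$ and $\mathcal Q(\gamma)=\frac{\prod_{i=1}^{N_u}(1-q^{(i)})}{\prod_{k=1}^j(1-q^{(\gamma(k))})}\prod_{k=1}^jq^{(\gamma(k))}$ for $\gamma\in I(j,N_u)$. Then $K_\sigma((\xi_1,\dots,\xi_N),\mathscr D)=\sum_{j=0}^{N_u}\nu(N-j)\sum_{\gamma\in I(j,N_u)}\mathcal Q(\gamma)\prod_{k=1}^jp^{(\gamma(k))}(\xi_k)\prod_{k=j+1}^Np^\ell(\xi_k)$. **Multi-degree kernel.** For $\mathscr D=\bigcup_{k=0}^{\mathfrak d-1}\mathscr D_k\times\{k\}$ and $Z=\bigcup_kZ_k\times\{k\}$ with $|Z_k|=N_k$, $K_\sigma(Z,\mathscr D)=\frac{\prod_kN_k!}{(\sum_kN_k)!}\prod_{k=0}^{\mathfrak d-1}K_\sigma(Z_k,\mathscr D_k)$.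
   Formalization: The random persistence diagrams with global pdf f are additionally assumed to have almost surely no repeated feature, since P[D⊂A] does not see multiplicities and the claim fails for diagrams with every feature doubled. *)

(* Defs.v *)
From HB Require Import structures.
From mathcomp Require Import all_boot all_order all_algebra all_fingroup.
From mathcomp Require Import finmap multiset.
From mathcomp Require Import all_classical all_reals all_analysis.

Set Implicit Arguments.
Unset Strict Implicit.
Unset Printing Implicit Defensive.

Import Order.TTheory GRing.Theory Num.Theory.
Import numFieldNormedType.Exports.

Local Open Scope classical_set_scope.
Local Open Scope ring_scope.

(* A feature ((b, d), k) has birth b, death d and homological degree k; degrees
   are natural numbers, and [Wdeg] keeps those below dg, the number of degrees.
   The sigma-algebra on features is the product of Borel, Borel and discrete. *)
Definition feature (R : realType) : Type :=
  (measurableTypeR R * measurableTypeR R * nat)%type.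

Definition W (R : realType) : set (R * R) := [set p | 0 <= p.1 /\ p.1 < p.2].
Arguments W R : clear implicits.

Definition Wdeg (R : realType) (dg : nat) : set (feature R) :=
  [set x | W R x.1 /\ (x.2 < dg)%N].
Arguments Wdeg R dg : clear implicits.

Definition lebesgue2 (R : realType) :
    {measure set (measurableTypeR R * measurableTypeR R) -> \bar R} :=
  (@lebesgue_measure R \x @lebesgue_measure R)%E.
Arguments lebesgue2 R : clear implicits.

Definition diagram (R : realType) : Type := {mset (feature R)}%mset.
HB.instance Definition _ (R : realType) := Choice.on (diagram R).
HB.instance Definition _ (R : realType) :=
  isPointed.Build (diagram R) (@mset0 (feature R)).

Definition in_diagram (R : realType) (Z : diagram R) : set (feature R) :=
  [set x | x \in enum_mset Z].

(* Diagrams carry the sigma-algebra of point processes, generated by the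
   counts, with multiplicity, of features in Borel sets. *)
Definition count_events (R : realType) : set (set (diagram R)) :=
  [set E | exists (A : set (feature R)) (n : nat), measurable A /\
     E = [set Z | count (fun x => x \in A) (enum_mset Z) = n]].
Arguments count_events R : clear implicits.

Definition mdiagram (R : realType) := g_sigma_algebraType (count_events R).

(* The disjoint union of the spaces of N-tuples of features, N >= 0, is
   represented by lists: a function f on it is a function on [seq (feature R)],
   only its values on lists over [Wdeg] being relevant, and f_N is its
   restriction to lists of size N. *)
Definition seq_over (R : realType) (A : set (feature R)) :
    set (seq (feature R)) :=
  [set s | forall x, x \in s -> A x].

(* Integration over A `&` Wdeg for Lebesgue measure on each copy of W. *)
Definition int_feature (R : realType) (dg : nat) (A : set (feature R))
    (g : feature R -> \bar R) : \bar R :=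
  (\sum_(k < dg)
     \int[lebesgue2 R]_(p in [set p | W R p /\ A (p, nat_of_ord k)])
       g (p, nat_of_ord k))%E.

(* The integral over (A `&` Wdeg)^N with respect to dxi_1 ... dxi_N, as an
   iterated integral; it is only applied to nonnegative measurable integrands,
   so by Tonelli it is the integral for the product measure. *)
Fixpoint int_features (R : realType) (dg : nat) (A : set (feature R)) (N : nat)
    (g : seq (feature R) -> \bar R) {struct N} : \bar R :=
  if N is N'.+1 then
    int_feature dg A (fun x => int_features dg A N' (fun s => g (x :: s)))
  else g [::].

Definition set_integral (R : realType) (dg : nat) (g : diagram R -> \bar R) :
    \bar R :=
  (\sum_(0 <= N <oo) ((N`!%:R : R)^-1)%:E *
     int_features dg setT N (fun s => g (seq_mset s)))%E.

(* f({xi_1, ..., xi_N}) is N! times the symmetrization of f, that is, the sum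
   of f over all N! reorderings of (xi_1, ..., xi_N). *)
Definition on_diagram (R : realType) (f : seq (feature R) -> R)
    (Z : diagram R) : R :=
  \sum_(s : 'S_(size (enum_mset Z)))
    f [seq tnth (in_tuple (enum_mset Z)) (s i)
         | i <- enum 'I_(size (enum_mset Z))].

(* D has global pdf f.  The event D \subset A does not see multiplicities, so
   for this identity to prescribe the law of D the diagram D has to be (almost
   surely) a set {xi_1, ..., xi_N}, i.e. without repeated features. *)
Definition has_global_pdf (R : realType) (dg : nat) (dT : measure_display)
    (T : measurableType dT) (P : probability T R)
    (D : {RV P >-> mdiagram R}) (f : seq (feature R) -> R) : Prop :=
  [/\ forall w, in_diagram (D w) `<=` Wdeg R dg,
      {ae P, forall w, uniq (enum_mset (D w))},
      forall s, seq_over (Wdeg R dg) s -> 0 <= f s,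
      forall N, measurable_fun [set t : N.-tuple (feature R) |
        seq_over (Wdeg R dg) t] (fun t : N.-tuple (feature R) => f t)
    & forall A : set (feature R), measurable A ->
      P [set w | in_diagram (D w) `<=` A] =
      (\sum_(0 <= N <oo) int_features dg A N (fun s => (f s)%:E))%E].

Definition mutually_independent (R : realType) (dT : measure_display)
    (T : measurableType dT) (P : probability T R)
    (D : nat -> {RV P >-> mdiagram R}) : Prop :=
  forall (J : {fset nat}) (E : nat -> set (mdiagram R)),
    (forall i, measurable (E i)) ->
    P (\bigcap_(i in [set` J]) (D i @^-1` E i)) =
    (\prod_(i <- J) P (D i @^-1` E i))%E.

Definition cvg_in_probability (R : realType) (dT : measure_display)
    (T : measurableType dT) (P : probability T R)
    (X : nat -> T -> \bar R) (l : \bar R) : Prop :=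
  forall e : R, 0 < e ->
    P [set w | (e%:E <= `|X n w - l|)%E] @[n --> \oo] --> 0%E.

Definition supdist (R : realType) (p q : R * R) : R :=
  Num.max `|p.1 - q.1| `|p.2 - q.2|.

(* Z together with the diagonal of each degree, with infinite multiplicity:
   the pairs (x, i) with i = 0, 1, ... are the copies of the feature x. *)
Definition with_diagonal (R : realType) (dg : nat) (Z : diagram R) :
    set (feature R * nat) :=
  [set xi | (xi.2 < count_mem xi.1 (enum_mset Z))%N \/
            (xi.1.1.1 = xi.1.1.2 /\ (xi.1.2 < dg)%N)].

Definition matching (R : realType) (dg : nat) (Z1 Z2 : diagram R)
    (gam : feature R * nat -> feature R * nat) : Prop :=
  set_bij (with_diagonal dg Z1) (with_diagonal dg Z2) gam /\
  forall x, with_diagonal dg Z1 x -> (gam x).1.2 = x.1.2.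

Definition matching_cost (R : realType) (dg : nat) (Z1 : diagram R)
    (gam : feature R * nat -> feature R * nat) : \bar R :=
  ereal_sup [set (supdist x.1.1 (gam x).1.1)%:E | x in with_diagonal dg Z1].

(* The minimum over matchings, written as an infimum. *)
Definition bottleneck (R : realType) (dg : nat) (Z1 Z2 : diagram R) : \bar R :=
  ereal_inf [set matching_cost dg Z1 gam | gam in matching dg Z1 Z2].

(* The mean absolute bottleneck deviation from Z0. *)
Definition MAD (R : realType) (dg : nat) (Z0 : diagram R)
    (f : seq (feature R) -> R) : \bar R :=
  set_integral dg (fun Z => bottleneck dg Z0 Z * (on_diagram f Z)%:E)%E.

Definition gauss2 (R : realType) (sigma : R) (c p : R * R) : R :=
  expR (- ((p.1 - c.1) ^+ 2 + (p.2 - c.2) ^+ 2) / (2 * sigma ^+ 2)) /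
  (2 * pi * sigma ^+ 2).

Definition upper (R : realType) (sigma : R) (D : seq (R * R)) : seq (R * R) :=
  [seq c <- D | sigma <= c.2 - c.1].

Definition lower (R : realType) (sigma : R) (D : seq (R * R)) : seq (R * R) :=
  [seq c <- D | c.2 - c.1 < sigma].

Definition q_upper (R : realType) (sigma : R) (c : R * R) : R :=
  \int[lebesgue2 R]_(p in [set p | p.1 < p.2]) gauss2 sigma c p.

Definition p_upper (R : realType) (sigma : R) (c p : R * R) : R :=
  gauss2 sigma c p / (\int[lebesgue2 R]_(x in W R) gauss2 sigma c x) *
  \1_(W R) p.

(* The unnormalized density of the lower features; Dl is the list of centers. *)
Definition lower_mix (R : realType) (sigma : R) (Dl : seq (R * R))
    (p : R * R) : R :=
  (size Dl)%:R^-1 * \sum_(c <- Dl) (pi * sigma ^+ 2)^-1 *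
    expR (- ((p.1 - (c.1 + c.2) / 2) ^+ 2 + (p.2 - (c.1 + c.2) / 2) ^+ 2) /
          (2 * sigma ^+ 2)).

Definition p_lower (R : realType) (sigma : R) (Dl : seq (R * R))
    (p : R * R) : R :=
  lower_mix sigma Dl p /
  (\int[lebesgue2 R]_(x in W R) lower_mix sigma Dl x) * \1_(W R) p.

(* nu L is the law of the number of lower features when N_l = L. *)
Definition lower_count_law (R : realType) (m : R) (nu : nat -> nat -> R) :
    Prop :=
  forall L : nat,
    [/\ forall n, 0 <= nu L n,
        (\sum_(0 <= n <oo) (nu L n)%:E = 1)%E,
        (\sum_(0 <= n <oo) (n%:R * nu L n)%:E = (L%:R)%:E)%E
      & forall n, m * L%:R < n%:R -> nu L n = 0].

Definition increasing_inj (j N : nat) : {set {ffun 'I_j -> 'I_N}} :=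
  [set g : {ffun 'I_j -> 'I_N} |
    [forall a : 'I_j, forall b : 'I_j, (a < b)%N ==> (g a < g b)%N]].

Definition Qweight (R : realType) (sigma : R) (Du : seq (R * R)) (j : nat)
    (g : {ffun 'I_j -> 'I_(size Du)}) : R :=
  let q i := q_upper sigma (tnth (in_tuple Du) i) in
  (\prod_(i < size Du) (1 - q i)) / (\prod_(k < j) (1 - q (g k))) *
  \prod_(k < j) q (g k).

(* The single-degree kernel, with the centers listed in some order.  The
   condition j <= size xi accounts for nu(n) = 0 when n < 0. *)
Definition kernel1 (R : realType) (nu : nat -> nat -> R) (sigma : R)
    (xi D : seq (R * R)) : R :=
  let Du := upper sigma D in
  let Dl := lower sigma D in
  \sum_(j < (size Du).+1 | (j <= size xi)%N)
    nu (size Dl) (size xi - j)%N *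
    \sum_(g in increasing_inj j (size Du))
      Qweight sigma g *
      (\prod_(k < j)
         p_upper sigma (tnth (in_tuple Du) (g k)) (nth (0, 0) xi k)) *
      (\prod_(j <= k < size xi) p_lower sigma Dl (nth (0, 0) xi k)).

Definition degree_part (R : realType) (k : nat) (s : seq (feature R)) :
    seq (R * R) :=
  [seq x.1 | x <- s & x.2 == k].

Definition kernel (R : realType) (dg : nat) (nu : nat -> nat -> R) (sigma : R)
    (Z : seq (feature R)) (D : diagram R) : R :=
  (\prod_(k < dg) (size (degree_part k Z))`!%:R) /
  ((\sum_(k < dg) size (degree_part k Z))`!)%N%:R *
  \prod_(k < dg) kernel1 nu sigma (degree_part k Z)
                         (degree_part k (enum_mset D)).

Definition kde (R : realType) (dg : nat) (nu : nat -> nat -> R) (sigma : R)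
    (n : nat) (D : nat -> diagram R) (Z : seq (feature R)) : R :=
  n%:R^-1 * \sum_(i < n) kernel dg nu sigma Z (D i).

(* The Euclidean norm of the vector of birth and death coordinates. *)
Definition coord_norm (R : realType) (s : seq (feature R)) : R :=
  Num.sqrt (\sum_(x <- s) (x.1.1 ^+ 2 + x.1.2 ^+ 2)).

Definition alpha_threshold (R : realType) (M : nat) : R := (2 * M%:R)^-1.

(* Main.v *)
Require Import Defs.
From HB Require Import structures.
From mathcomp Require Import all_boot all_order all_algebra all_fingroup.
From mathcomp Require Import finmap multiset.
From mathcomp Require Import all_classical all_reals all_analysis.
From mathcomp Require Import measurable_realfun.
From mathcomp Require Import lra.
Import Order.TTheory GRing.Theory Num.Theory.
Import numFieldNormedType.Exports.
Local Open Scope classical_set_scope.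
Local Open Scope ring_scope.
Set Implicit Arguments.
Unset Strict Implicit.
Unset Printing Implicit Defensive.


(** A kernel density estimate is an average of kernels, so its mean absolute
    bottleneck deviation is an average over the sampled diagrams,
      MAD (kde) = (1 / n) * sum_i H_n (D_i),
    where H_n (Z) is the expected bottleneck distance from Z0 to a diagram drawn
    from the kernel centred at Z.  Such a draw is Z itself up to a perturbation
    of size O(sigma): each upper center is moved by a Gaussian of scale sigma,
    or dropped with a probability that is small unless the center is itself
    within O(sigma) of the diagonal; the lower centers, which lie within sigma
    of the diagonal, are replaced by |Z_l| points on average, all within
    O(sigma) of the diagonal.  Since the bottleneck distance changes by at most
    the sup distance when a feature moves, and by at most half its persistence
    when a feature is inserted or deleted,
      | H_n (Z) - W (Z0, Z) | <= C * sigma_n * |Z|      ([kernel_mad_near]).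
    By (A1), |D_i| <= M almost surely, so MAD (kde) is uniformly close to the
    empirical mean of the i.i.d. variables W (Z0, D_i).  Their expectation is
    MAD f, which (A3) makes finite ([expected_bottleneck_fin]), and the weak law
    of large numbers in L1 concludes ([weak_law_of_large_numbers]).  The error
    term C * sigma_n * M tends to 0.

    The kernel is never sampled.  Integrating a functional of diagrams against
    it is an iteration of elementary operators on functionals, one for each
    upper center and one for the lower centers of each degree
    ([totint_kern], [totint_multikern]); each of them is a Markov operator, which
    preserves the two stability bounds above and costs O(sigma).  The passage
    from the sum over increasing injections to this iteration is a recursion on
    the list of upper centers ([kernel1E]), and the multinomial factor of the
    multi-degree kernel is what turns an integral over lists of mixed degrees
    into nested integrals, one degree at a time ([totint_filter]).

    A global pdf is only known through the probabilities of the events that D is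
    contained in A.  These determine the law of a diagram without repeated
    features ([void_probabilities_determine]), and so all the expectations that
    the argument needs ([expectation_of_global_pdf]). *)

(** * Finite lists over a measurable space *)

Definition measure_seq_display : measure_display -> measure_display.
Proof. exact. Qed.

Section seq_measurable.
Context {d} {E : measurableType d}.

(** The disjoint-union sigma-algebra: a set of lists is measurable when its trace
    on the lists of each length n is measurable for the product sigma-algebra. *)
Definition seq_measurable : set (set (seq E)) :=
  [set A : set (seq E) | forall n, measurable [set t : n.-tuple E | A (tval t)]].

Let seq_measurable0 : seq_measurable set0.
Proof. by move=> n; exact: measurable0. Qed.

Let seq_measurableC A : seq_measurable A -> seq_measurable (~` A).
Proof. by move=> mA n; exact: measurableC (mA n). Qed.

Let seq_measurable_bigcup (F : (set (seq E))^nat) :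
  (forall i, seq_measurable (F i)) -> seq_measurable (\bigcup_i (F i)).
Proof.
move=> mF n; rewrite [X in measurable X](_ : _ =
  \bigcup_i [set t : n.-tuple E | F i (tval t)])//.
by apply: bigcupT_measurable => i; exact: mF.
Qed.

HB.instance Definition _ := isPointed.Build (seq E) [::].
HB.instance Definition _ := @isMeasurable.Build (measure_seq_display d)
  (seq E) seq_measurable seq_measurable0 seq_measurableC seq_measurable_bigcup.

End seq_measurable.

Section seq_measurable_theory.
Context {d} {E : measurableType d}.

Lemma seq_measurableP (A : set (seq E)) :
  measurable A <-> forall n, measurable [set t : n.-tuple E | A (tval t)].
Proof. by []. Qed.

Lemma measurable_tval n : measurable_fun [set: n.-tuple E] (@tval n E).
Proof. by move=> _ A mA; rewrite setTI; exact: mA. Qed.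

Lemma measurable_size_eq n : measurable [set s : seq E | size s = n].
Proof.
apply/seq_measurableP => k; have [<-|kn] := eqVneq k n.
  rewrite (_ : [set _ | _] = setT)//.
  by apply/seteqP; split => // t _ /=; rewrite size_tuple.
rewrite (_ : [set _ | _] = set0)//.
by apply/seteqP; split => // t /=; rewrite size_tuple; move/eqP: kn.
Qed.

Lemma measurable_in_tuple n (A : set (n.-tuple E)) : measurable A ->
  measurable [set s : seq E | exists2 t : n.-tuple E, A t & tval t = s].
Proof.
move=> mA; apply/seq_measurableP => k; have [kn|kn] := eqVneq k n.
  move: A mA; rewrite -kn => A mA.
  rewrite (_ : [set _ | _] = A)//; apply/seteqP; split => t /=.
    by move=> [u Au] /val_inj <-.
  by move=> At; exists t.
rewrite (_ : [set _ | _] = set0)//; apply/seteqP; split => // t /= [u _ ut].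
by move/eqP: kn; apply; rewrite -(size_tuple t) -ut size_tuple.
Qed.

Section product.
Context d1 d2 (Y : measurableType d1) (T : measurableType d2).

(** The lists of length n, n >= 0, cut the product into countably many measurable
    pieces; the default tuple is used outside of the piece. *)
Lemma measurable_fun_seqP (g : Y * seq E -> T) :
  (forall n, measurable_fun [set: Y * n.-tuple E]
    (fun p => g (p.1, tval p.2))) ->
  measurable_fun setT g.
Proof.
move=> mg _ B mB; rewrite setTI.
pose h n (p : Y * seq E) : Y * n.-tuple E :=
  (p.1, insubd [tuple point | i < n] p.2).
have mh n : measurable_fun setT (h n).
  apply/measurable_fun_pair => /=; first exact: measurable_fst.
  apply: (measurableT_comp (f := insubd [tuple point | i < n])) => //.
  move=> _ C mC; rewrite setTI.
  set t0 := [tuple point | i < n].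
  rewrite [X in measurable X](_ : _ =
     [set s : seq E | exists2 t : n.-tuple E, C t & tval t = s] `|`
     (if `[< C t0 >] then ~` [set s | size s = n] else set0)).
    apply: measurableU; first exact: (@measurable_in_tuple n).
    case: ifP => _ //; exact: measurableC (measurable_size_eq n).
  apply/seteqP; split => s /=.
    have [sn|sn] := eqVneq (size s) n.
      move=> Cs; left; exists (insubd t0 s) => //.
      by rewrite /= val_insubd sn eqxx.
    rewrite /insubd insubF ?(negbTE sn)//= => Ct0; right.
    by case: asboolP => // _ /=; apply/eqP.
  move=> [[t Ct <-]|].
    by rewrite /insubd valK.
  case: asboolP => // Ct0 /= /eqP sn.
  by rewrite /insubd insubF ?(negbTE sn).
rewrite [X in measurable X](_ : _ = \bigcup_n
   ((setT `*` [set s | size s = n]) `&`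
    (h n @^-1` ((fun p : Y * n.-tuple E => g (p.1, tval p.2)) @^-1` B)))).
  apply: bigcupT_measurable => n; apply: measurableI.
    by apply: measurableX => //; exact: (measurable_size_eq n).
  rewrite -[X in measurable X]setTI; apply: (mh n) => //.
  by rewrite -[X in measurable X]setTI; exact: (mg n).
apply/seteqP; split => [[y s] /= gB|[y s] /= [n _] [] [_ /= sn]].
  exists (size s) => //; split => //=.
  by rewrite val_insubd eqxx.
by rewrite /= val_insubd sn eqxx.
Qed.

Lemma measurable_fun_seq1P (g : seq E -> T) :
  (forall n, measurable_fun [set: n.-tuple E] (fun t => g (tval t))) ->
  measurable_fun setT g.
Proof.
move=> mg _ B mB; rewrite setTI; apply/seq_measurableP => n.
by have := mg n measurableT _ mB; rewrite setTI.
Qed.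

End product.

Lemma measurable_cons_seq :
  measurable_fun [set: E * seq E] (fun p => p.1 :: p.2).
Proof.
apply: measurable_fun_seqP => n.
apply: (measurableT_comp (f := @tval n.+1 E)
  (g := fun p : E * n.-tuple E => [the n.+1.-tuple E of p.1 :: p.2])).
  exact: measurable_tval.
by apply: measurable_cons; [exact: measurable_fst|exact: measurable_snd].
Qed.

Context d1 d2 (Y : measurableType d1) (T : measurableType d2).

Lemma measurable_fun_cons (x : Y -> E) (s : Y -> seq E) :
  measurable_fun setT x -> measurable_fun setT s ->
  measurable_fun setT (fun y => x y :: s y).
Proof.
move=> mx ms; apply: (measurableT_comp (g := fun y => (x y, s y))
  measurable_cons_seq).
exact/measurable_fun_pair.
Qed.

(* Y * n.+1.-tuple splits as (Y * E) * n.-tuple *)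
Lemma measurable_fun_tupleS n (g : Y * E * seq E -> T) :
  measurable_fun setT (fun p : Y * E * n.-tuple E => g (p.1, tval p.2)) ->
  measurable_fun setT (fun p : Y * n.+1.-tuple E =>
    g (p.1, thead p.2, behead (tval p.2))).
Proof.
move=> mg.
apply: (measurableT_comp (f := fun p : Y * E * n.-tuple E => g (p.1, tval p.2))
  (g := fun p : Y * n.+1.-tuple E => ((p.1, thead p.2),
       [tuple of behead p.2]))) => //.
apply/measurable_fun_pair => /=.
  apply/measurable_fun_pair => //=.
  exact: (measurableT_comp (measurable_tnth _) measurable_snd).
apply: (measurableT_comp (f := fun t : n.+1.-tuple E => [tuple of behead t])) => //.
exact: measurable_behead.
Qed.

Lemma measurable_fun_foldr (f : Y -> E -> T -> T) (b : Y -> T) :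
  measurable_fun setT (fun p : Y * E * T => f p.1.1 p.1.2 p.2) ->
  measurable_fun setT b ->
  measurable_fun setT (fun p : Y * seq E => foldr (f p.1) (b p.1) p.2).
Proof.
move=> mf mb; apply: measurable_fun_seqP.
elim => [|n IH].
  rewrite (_ : (fun _ => _) = b \o fst); first exact: measurableT_comp.
  by apply/funext => -[y t] /=; rewrite tuple0.
have := @measurable_fun_tupleS n (fun p => f p.1.1 p.1.2 (foldr (f p.1.1) (b p.1.1) p.2)).
rewrite (_ : (fun _ => _) = (fun p : Y * n.+1.-tuple E => foldr (f p.1) (b p.1) p.2)).
  apply => /=.
  apply: (measurableT_comp (g := fun p : Y * E * n.-tuple E =>
     ((p.1.1, p.1.2), foldr (f p.1.1) (b p.1.1) p.2)) mf).
  apply/measurable_fun_pair => /=.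
    rewrite (_ : (fun _ => _) = fst); first exact: measurable_fst.
    by apply/funext => -[[]].
  apply: (measurableT_comp (g := fun p : Y * E * n.-tuple E => (p.1.1, p.2)) IH).
  apply/measurable_fun_pair => //=.
  by apply: measurableT_comp.
by apply/funext => -[y t] /=; rewrite {3}(tuple_eta t).
Qed.

End seq_measurable_theory.

Lemma measurable_nat_pairs (A : set (nat * nat)) : measurable A.
Proof.
rewrite (_ : A = \bigcup_i \bigcup_j
    (if `[< A (i, j) >] then [set i] `*` [set j] else set0)).
  apply: bigcupT_measurable => i; apply: bigcupT_measurable => j.
  by case: ifP => // _; apply: measurableX.
apply/seteqP; split => [[i j] Aij|[i j] /= [i' _ [j' _]]].
  by exists i => //; exists j => //; case: asboolP.
by case: asboolP => // Aij /= [-> ->].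
Qed.

Section foldr_corollaries.
Context {d d2} {E : measurableType d} {T : measurableType d2}.

(** The source of measurability for all the list operations used below: filter,
    map, size, products and membership are folds. *)
Lemma measurable_foldr (f : E -> T -> T) (b : T) :
  measurable_fun setT (fun p : E * T => f p.1 p.2) ->
  measurable_fun setT (fun s : seq E => foldr f b s).
Proof.
move=> mf.
have H : measurable_fun setT (fun p : bool * seq E => foldr f b p.2).
  apply: (@measurable_fun_foldr _ _ _ _ bool T (fun _ => f) (fun _ => b)) => //.
  apply: (measurableT_comp (g := fun p : bool * E * T => (p.1.2, p.2)) mf).
  by apply/measurable_fun_pair => //=; apply: (measurableT_comp measurable_snd).
by apply: (measurableT_comp (g := fun s => (true, s)) H); exact/measurable_fun_pair.
Qed.

Lemma measurable_pred_of_set (A : set E) : measurable A ->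
  measurable_fun setT (fun x => x \in A).
Proof.
move=> mA; apply: (measurable_fun_bool true); rewrite setTI.
rewrite (_ : _ @^-1` _ = A) //.
by apply/seteqP; split => x /=; [move/set_mem|move/mem_set].
Qed.
End foldr_corollaries.

Lemma measurable_filter {d} {E : measurableType d} (b : pred E) :
  measurable_fun setT b -> measurable_fun setT (seq.filter b).
Proof.
move=> mb; rewrite (_ : seq.filter b =
  foldr (fun x s => if b x then x :: s else s) [::]); last first.
  by apply/funext; elim=> //= x s ->.
apply: measurable_foldr; apply: measurable_fun_ifT => //.
- exact: measurableT_comp.
- exact: measurable_cons_seq.
Qed.

Lemma measurable_map {d d'} {E : measurableType d} {E' : measurableType d'}
  (f : E -> E') : measurable_fun setT f -> measurable_fun setT (map f).
Proof.
move=> mf; rewrite (_ : map f = foldr (fun x s => f x :: s) [::]); last first.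
  by apply/funext; elim=> //= x s ->.
apply: measurable_foldr; apply: measurable_fun_cons => //.
exact: measurableT_comp.
Qed.

Lemma measurable_size {d} {E : measurableType d} :
  measurable_fun setT (@size E).
Proof.
move=> _ A mA; rewrite setTI.
rewrite (_ : _ @^-1` _ = \bigcup_(n in A) [set s | size s = n]).
  by apply: bigcup_measurable => n _; exact: measurable_size_eq.
by apply/seteqP; split => [s As|s [n An /= sn]]; [exists (size s)|rewrite /= sn].
Qed.

(** * Iterated integrals over finite lists *)

Ltac meas := rewrite /=; repeat first
 [ exact: measurable_fst | exact: measurable_snd | exact: measurable_cst
 | exact: measurable_id | assumption
 | apply: measurable_fun_cons | apply/measurable_fun_pair; rewrite /=
 | apply: (measurableT_comp measurable_fst) | apply: (measurableT_comp measurable_snd)].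

Section iterint.
Context {d} {E : measurableType d} {R : realType}.
Variable mu : {sigma_finite_measure set E -> \bar R}.
Local Open Scope ereal_scope.

(** The measure is iterated rather than put on a product of N copies, so that the
    shape agrees with the recursive integrals over features. *)
Fixpoint iterint (D : set E) (N : nat) (g : seq E -> \bar R) : \bar R :=
  if N is N'.+1 then
    \int[mu]_(x in D) iterint D N' (fun s => g (x :: s))
  else g [::].

Definition over (D : set E) : set (seq E) := [set s | forall x, x \in s -> D x].

Lemma over_nil D : over D [::]. Proof. by []. Qed.

Lemma over_cons D x s : over D (x :: s) <-> D x /\ over D s.
Proof.
split=> [H|[Dx Ds] y]; last by rewrite inE => /predU1P[->|/Ds].
by split=> [|y ys]; apply: H; rewrite inE ?eqxx ?ys ?orbT.
Qed.

Lemma iterintS D N g : iterint D N.+1 g =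
  \int[mu]_(x in D) iterint D N (fun s => g (x :: s)).
Proof. by []. Qed.

Lemma iterint_ge0 D N g : (forall s, 0 <= g s) -> 0 <= iterint D N g.
Proof.
elim: N g => //= N IH g g0; apply: integral_ge0 => x _; exact: IH.
Qed.

Lemma eq_iterint D N g h :
  (forall s, over D s -> size s = N -> g s = h s) -> iterint D N g = iterint D N h.
Proof.
elim: N g h => [|N IH] g h gh /=; first exact: gh.
apply: eq_integral => x; rewrite inE => Dx; apply: IH => s Ds sN.
by apply: gh; [apply/over_cons|rewrite /= sN].
Qed.

Context {d1} {Y : measurableType d1}.

Lemma measurable_param_int (D : set E) (g : Y -> E -> \bar R) : measurable D ->
  measurable_fun setT (fun p : Y * E => g p.1 p.2) -> (forall y x, 0 <= g y x) ->
  measurable_fun setT (fun y => \int[mu]_(x in D) g y x).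
Proof.
move=> mD mg g0.
rewrite (_ : (fun _ => _) = fubini_F mu
   ((fun p : Y * E => g p.1 p.2) \_ (setT `*` D))).
  apply: measurable_fun_fubini_tonelli_F.
    apply/(measurable_restrictT _ (measurableX measurableT mD)).
    exact: measurable_funTS.
  by move=> p; apply: erestrict_ge0.
apply/funext => y; rewrite integral_mkcond; apply: eq_integral => x _.
by rewrite /patch in_setX in_setT.
Qed.

Lemma tonelli_param (rho : {sigma_finite_measure set Y -> \bar R})
    (DY : set Y) (D : set E) (g : Y -> E -> \bar R) :
  measurable DY -> measurable D ->
  measurable_fun setT (fun p : Y * E => g p.1 p.2) -> (forall y x, 0 <= g y x) ->
  \int[rho]_(y in DY) \int[mu]_(x in D) g y x =
  \int[mu]_(x in D) \int[rho]_(y in DY) g y x.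
Proof.
move=> mDY mD mg g0.
pose h (p : Y * E) := ((fun p : Y * E => g p.1 p.2) \_ (DY `*` D)) p.
have h0 p : 0 <= h p by apply: erestrict_ge0.
have mh : measurable_fun setT h.
  apply/(measurable_restrictT _ (measurableX mDY mD)).
  exact: measurable_funTS.
have := fubini_tonelli (m1 := rho) (m2 := mu) h mh h0.
rewrite /h => H.
rewrite integral_mkcond [RHS]integral_mkcond.
rewrite [LHS](_ : _ = \int[rho]_y \int[mu]_x h (y, x)); last first.
  apply: eq_integral => y _; rewrite {1}/patch; case: ifPn => yD.
    rewrite integral_mkcond; apply: eq_integral => x _.
    rewrite /h /patch in_setX yD /=; by case: ifPn.
  apply: (@eq_trans _ _ (\int[mu]_(x in [set: E]) 0)); first by rewrite integral0.
  apply: eq_integral => x _.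
  by rewrite /h /patch in_setX (negbTE yD).
rewrite H; apply: eq_integral => x _; rewrite {2}/patch; case: ifPn => xD.
  rewrite [RHS]integral_mkcond; apply: eq_integral => y _.
  by rewrite /patch in_setX xD andbT /=; case: ifPn.
apply: (@eq_trans _ _ (\int[rho]_(y in [set: Y]) 0)); last by rewrite integral0.
apply: eq_integral => y _.
by rewrite /patch in_setX (negbTE xD) andbF.
Qed.
End iterint.

Section iterint_param.
Context {d} {E : measurableType d} {R : realType}.
Variable mu : {sigma_finite_measure set E -> \bar R}.
Local Open Scope ereal_scope.
Variable D : set E.
Hypothesis mD : measurable D.

Lemma measurable_iterint {d1} {Y : measurableType d1} N (g : Y -> seq E -> \bar R) :
  measurable_fun setT (fun p : Y * seq E => g p.1 p.2) -> (forall y x, 0 <= g y x) ->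
  measurable_fun setT (fun y => iterint mu D N (g y)).
Proof.
elim: N d1 Y g => [|N IH] d1 Y g mg g0 /=.
  by apply: (measurableT_comp (g := fun y : Y => (y, [::])) mg); meas.
apply: measurable_param_int => //; last by move=> *; exact: iterint_ge0.
apply: (IH _ _ (fun (p : Y * E) s => g p.1 (p.2 :: s))) => //.
by apply: (measurableT_comp (g := fun p : Y * E * seq E => (p.1.1, p.1.2 :: p.2)) mg); meas.
Qed.

Lemma iterint_exchange {d1} {Y : measurableType d1}
    (rho : {sigma_finite_measure set Y -> \bar R}) (DY : set Y) N (g : Y -> seq E -> \bar R) :
  measurable DY ->
  measurable_fun setT (fun p : Y * seq E => g p.1 p.2) -> (forall y x, 0 <= g y x) ->
  \int[rho]_(y in DY) iterint mu D N (g y) =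
  iterint mu D N (fun s => \int[rho]_(y in DY) g y s).
Proof.
move=> mDY; elim: N g => //= N IH g mg g0.
rewrite tonelli_param//.
- apply: eq_integral => x _; apply: IH => //.
  by apply: (measurableT_comp (g := fun p : Y * seq E => (p.1, x :: p.2)) mg); meas.
- apply: (@measurable_iterint _ _ N (fun (p : Y * E) s => g p.1 (p.2 :: s))) => //.
  by apply: (measurableT_comp (g := fun p : Y * E * seq E => (p.1.1, p.1.2 :: p.2)) mg); meas.
- by move=> *; exact: iterint_ge0.
Qed.

Lemma measurable_shift (g : seq E -> \bar R) : measurable_fun setT g ->
  measurable_fun setT (fun p : E * seq E => g (p.1 :: p.2)).
Proof. by move=> mg; apply: (measurableT_comp mg); meas. Qed.

Lemma measurable_shift1 (g : seq E -> \bar R) x : measurable_fun setT g ->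
  measurable_fun setT (fun s => g (x :: s)).
Proof. by move=> mg; apply: (measurableT_comp mg); meas. Qed.

Lemma measurable_iterint_cons N (g : seq E -> \bar R) :
  measurable_fun setT g -> (forall s, 0 <= g s) ->
  measurable_fun D (fun x => iterint mu D N (fun s => g (x :: s))).
Proof.
move=> mg g0; apply: measurable_funTS; apply: measurable_iterint => //.
exact: measurable_shift.
Qed.

Lemma iterintD N g h : measurable_fun setT g -> measurable_fun setT h ->
  (forall s, 0 <= g s) -> (forall s, 0 <= h s) ->
  iterint mu D N (fun s => g s + h s) = iterint mu D N g + iterint mu D N h.
Proof.
elim: N g h => //= N IH g h mg mh g0 h0.
rewrite -ge0_integralD//; try by move=> x _; exact: iterint_ge0.
- by apply: eq_integral => x _; apply: IH => //; exact: measurable_shift1.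
- exact: measurable_iterint_cons.
- exact: measurable_iterint_cons.
Qed.

Lemma iterintZ N k g : measurable_fun setT g -> (forall s, 0 <= g s) -> 0 <= k ->
  iterint mu D N (fun s => k * g s) = k * iterint mu D N g.
Proof.
elim: N g => //= N IH g mg g0 k0.
rewrite -ge0_integralZl//; try by move=> x _; exact: iterint_ge0.
- by apply: eq_integral => x _; apply: IH => //; exact: measurable_shift1.
- exact: measurable_iterint_cons.
Qed.

Lemma le_iterint N g h : measurable_fun setT g -> measurable_fun setT h ->
  (forall s, 0 <= g s) -> (forall s, 0 <= h s) ->
  (forall s, over D s -> size s = N -> g s <= h s) ->
  iterint mu D N g <= iterint mu D N h.
Proof.
elim: N g h => [|N IH] g h mg mh g0 h0 gh /=; first exact: gh.
apply: ge0_le_integral => //; try by move=> x _; exact: iterint_ge0.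
- exact: measurable_iterint_cons.
- exact: measurable_iterint_cons.
- move=> x Dx; apply: IH => //; try exact: measurable_shift1.
  by move=> s Ds sN; apply: gh; [apply/over_cons|rewrite /= sN].
Qed.

Lemma iterint_nneseries N (g : nat -> seq E -> \bar R) :
  (forall n, measurable_fun setT (g n)) ->
  (forall n s, 0 <= g n s) ->
  iterint mu D N (fun s => \sum_(n <oo) g n s) = \sum_(n <oo) iterint mu D N (g n).
Proof.
elim: N g => //= N IH g mg g0.
rewrite -integral_nneseries//; try by move=> *; exact: iterint_ge0.
- by apply: eq_integral => x _; apply: IH => // n; exact: measurable_shift1.
- by move=> n; exact: measurable_iterint_cons.
Qed.

Lemma iterint_sum N I (r : seq I) (g : I -> seq E -> \bar R) :
  (forall n, measurable_fun setT (g n)) ->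
  (forall n s, 0 <= g n s) ->
  iterint mu D N (fun s => \sum_(n <- r) g n s) =
  \sum_(n <- r) iterint mu D N (g n).
Proof.
move=> mg g0; elim: r => [|i r IH].
  rewrite big_nil (_ : (fun _ => _) = fun _ => 0 * 0).
    by rewrite iterintZ// mul0e.
  by apply/funext => s; rewrite big_nil mul0e.
rewrite big_cons -IH -iterintD//; last 2 first.
- exact: emeasurable_sum.
- by move=> s; exact: sume_ge0.
- by congr iterint; apply/funext => s; rewrite big_cons.
Qed.

Definition delete_at (i : nat) (s : seq E) := take i s ++ drop i.+1 s.

Lemma nth_delete_at i k (s : seq E) : k != i -> (i < size s)%N ->
  nth point (delete_at i s) (unbump i k) = nth point s k.
Proof.
move=> ki is_; rewrite /delete_at nth_cat size_take is_ /unbump.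
case: (ltngtP k i) ki => // ik _.
  by rewrite subn0 ik nth_take.
case: k ik => // k; rewrite ltnS => ik.
by rewrite subn1 /= ltnNge ik /= nth_drop addSn subnKC.
Qed.

(** By Tonelli, any coordinate can be integrated first. *)
Lemma iterint_front N i (G : E -> seq E -> \bar R) :
  measurable_fun setT (fun p : E * seq E => G p.1 p.2) ->
  (forall x s, 0 <= G x s) -> (i <= N)%N ->
  iterint mu D N.+1 (fun s => G (nth point s i) (delete_at i s)) =
  \int[mu]_(x in D) iterint mu D N (G x).
Proof.
elim: i N G => [|i IH] N G mG G0 iN.
  apply: eq_integral => x _ /=; congr iterint; apply/funext => s.
  by rewrite /delete_at /= drop0.
case: N iN => [iN|N iN]; first by exfalso; move: iN; rewrite ltn0.
have {}iN : (i <= N)%N := iN.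
transitivity (\int[mu]_(y in D) \int[mu]_(x in D)
    iterint mu D N (fun s => G x (y :: s))).
  apply: eq_integral => y _.
  rewrite -(IH N (fun x s => G x (y :: s)))//.
  by apply: (measurableT_comp (g := fun p : E * seq E => (p.1, y :: p.2)) mG); meas.
rewrite tonelli_param//; last by move=> *; exact: iterint_ge0.
apply: (@measurable_iterint _ _ N (fun (p : E * E) s => G p.2 (p.1 :: s))) => //.
by apply: (measurableT_comp (g := fun p : E * E * seq E => (p.1.2, p.1.1 :: p.2)) mG); meas.
Qed.

Lemma measurable_nth k : measurable_fun setT (fun s : seq E => nth point s k).
Proof.
apply: measurable_fun_seq1P => n; have [kn|nk] := ltnP k n.
  rewrite (_ : (fun _ => _) = (@tnth _ _ ^~ (Ordinal kn))).
    exact: measurable_tnth.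
  by apply/funext => t; rewrite (tnth_nth point).
rewrite (_ : (fun _ => _) = cst point); first exact: measurable_cst.
by apply/funext => t; rewrite nth_default// size_tuple.
Qed.

Lemma measurable_map_nth (sigma : seq nat) :
  measurable_fun setT (fun s : seq E => map (nth point s) sigma).
Proof.
elim: sigma => /= [|k sigma IH]; first exact: measurable_cst.
by apply: measurable_fun_cons => //; exact: measurable_nth.
Qed.

(** Iterated integrals of nonnegative functions do not depend on the order of
    the coordinates; the coordinate listed first is brought to the front, and
    the others follow by induction. *)
Lemma iterint_perm N (sigma : seq nat) (H : seq E -> \bar R) :
  measurable_fun setT H -> (forall s, 0 <= H s) -> perm_eq sigma (iota 0 N) ->
  iterint mu D N (fun s => H (map (nth point s) sigma)) = iterint mu D N H.
Proof.
elim: N sigma H => [|N IH] [|i sigma] H mH H0 //.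
  by move=> /perm_size.
move=> sigmaN.
have iN : (i <= N)%N.
  by have := perm_mem sigmaN i; rewrite mem_head mem_iota/= add0n ltnS => /esym.
have us : uniq (i :: sigma) by rewrite (perm_uniq sigmaN) iota_uniq.
have isigma : i \notin sigma by case/andP: us.
pose G x s := H (x :: map (nth point s) (map (unbump i) sigma)).
have mG : measurable_fun setT (fun p : E * seq E => G p.1 p.2).
  apply: (measurableT_comp mH); apply: measurable_fun_cons => //.
  exact: (measurableT_comp (measurable_map_nth _) measurable_snd).
transitivity (iterint mu D N.+1 (fun s => G (nth point s i) (delete_at i s))).
  apply: eq_iterint => s Ds sN; rewrite /G /=; congr (H (_ :: _)).
  rewrite -[RHS]map_comp; apply/eq_in_map => k ks /=.
  rewrite nth_delete_at ?sN//.
  by apply: contraNneq isigma => <-.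
rewrite iterint_front//; last by move=> *; exact: H0.
apply: eq_integral => x _; apply: (IH _ (fun s => H (x :: s))) => //.
  exact: measurable_shift1.
apply: uniq_perm; [|exact: iota_uniq|].
  rewrite map_inj_in_uniq; first by case/andP: us.
  move=> k l ks ls.
  have ki : k != i by apply: contraNneq isigma => <-.
  have li : l != i by apply: contraNneq isigma => <-.
  by move=> kl; rewrite -(unbumpK ki) -(unbumpK li) kl.
move=> k; rewrite mem_iota add0n /=; apply/mapP/idP => [[l ls ->]|kN].
  have li : l != i by apply: contraNneq isigma => <-.
  have : l \in i :: sigma by rewrite inE ls orbT.
  rewrite (perm_mem sigmaN) mem_iota/= add0n.
  rewrite /unbump; case: (ltngtP i l) li => // il _ lN.
    by rewrite subn1 -ltnS prednK// (leq_ltn_trans _ il).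
  by rewrite subn0 (leq_trans il).
exists (bump i k); last by rewrite bumpK.
have : bump i k \in i :: sigma.
  rewrite (perm_mem sigmaN) mem_iota/= add0n /bump -add1n; apply: leq_ltn_trans (_ : (1 + k < _)%N); first by rewrite leq_add2r leq_b1.
  by rewrite add1n ltnS.
by rewrite inE eq_sym (negbTE (neq_bump _ _)).
Qed.

End iterint_param.

Section iterint_split.
Context {d} {E : measurableType d} {R : realType}.
Variable mu : {sigma_finite_measure set E -> \bar R}.
Local Open Scope ereal_scope.
Variables (D A : set E).
Hypotheses (mD : measurable D) (mA : measurable A).
Let a : pred E := fun x => x \in A.
Let B := D `&` ~` A.
Let mDA : measurable (D `&` A). Proof. exact: measurableI. Qed.
Let mB : measurable B. Proof. by apply: measurableI => //; exact: measurableC. Qed.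

(** Each coordinate is in A or not, and by symmetry of the measure only the number
    of coordinates in A matters; the binomial coefficient comes from Pascal's
    rule as the first coordinate is integrated. *)
Lemma iterint_filter N (G : seq E -> seq E -> \bar R) :
  measurable_fun setT (fun p : seq E * seq E => G p.1 p.2) ->
  (forall s t, 0 <= G s t) ->
  iterint mu D N (fun s => G (seq.filter a s) (seq.filter (predC a) s)) =
  \sum_(i < N.+1) 'C(N, i)%:R%:E *
    iterint mu (D `&` A) i (fun s => iterint mu B (N - i) (G s)).
Proof.
pose J (G : seq E -> seq E -> \bar R) i j :=
  iterint mu (D `&` A) i (fun s => iterint mu B j (G s)).
have J0 G' i j : (forall s t, 0 <= G' s t) -> 0 <= J G' i j.
  by move=> G'0; do 2 apply: iterint_ge0 => *.
elim: N G => [|N IH] G mG G0.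
  by rewrite big_ord_recl big_ord0 /= adde0 bin0 mul1e.
pose GA x s t := G (x :: s) t; pose GB x s t := G s (x :: t).
have GA0 x s t : 0 <= GA x s t by exact: G0.
have GB0 x s t : 0 <= GB x s t by exact: G0.
have mGA x : measurable_fun setT (fun p : seq E * seq E => GA x p.1 p.2).
  by apply: (measurableT_comp (g := fun p : seq E * seq E => (x :: p.1, p.2)) mG); meas.
have mGB x : measurable_fun setT (fun p : seq E * seq E => GB x p.1 p.2).
  by apply: (measurableT_comp (g := fun p : seq E * seq E => (p.1, x :: p.2)) mG); meas.
have mGA' : measurable_fun setT (fun p : E * seq E * seq E => GA p.1.1 p.1.2 p.2).
  by apply: (measurableT_comp (g := fun p : E * seq E * seq E => (p.1.1 :: p.1.2, p.2)) mG); meas.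
have mGB' : measurable_fun setT (fun p : E * seq E * seq E => GB p.1.1 p.1.2 p.2).
  by apply: (measurableT_comp (g := fun p : E * seq E * seq E => (p.1.2, p.1.1 :: p.2)) mG); meas.
have mGAi j : measurable_fun setT (fun p : E * seq E => iterint mu B j (GA p.1 p.2)).
  by apply: (@measurable_iterint _ _ _ _ _ mB _ _ j (fun p : E * seq E => GA p.1 p.2)).
have mGBi j : measurable_fun setT (fun p : E * seq E => iterint mu B j (GB p.1 p.2)).
  by apply: (@measurable_iterint _ _ _ _ _ mB _ _ j (fun p : E * seq E => GB p.1 p.2)).
have mJA i j : measurable_fun setT (fun x => J (GA x) i j).
  apply: (@measurable_iterint _ _ _ _ _ mDA _ _ i (fun x s => iterint mu B j (GA x s))) => //.
  by move=> *; exact: iterint_ge0.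
have mJB i j : measurable_fun setT (fun x => J (GB x) i j).
  apply: (@measurable_iterint _ _ _ _ _ mDA _ _ i (fun x s => iterint mu B j (GB x s))) => //.
  by move=> *; exact: iterint_ge0.
have mN : measurable_fun setT (fun x => iterint mu D N
     (fun s => G (seq.filter a (x :: s)) (seq.filter (predC a) (x :: s)))).
  apply: measurable_iterint => //.
  have ma : measurable_fun setT a by exact: measurable_pred_of_set.
  have mac : measurable_fun setT (predC a) by exact: measurable_neg.
  apply: (measurableT_comp (g := fun p : E * seq E => (seq.filter a (p.1 :: p.2), seq.filter (predC a) (p.1 :: p.2))) mG).
  by apply/measurable_fun_pair; [apply: (measurableT_comp (measurable_filter ma))|apply: (measurableT_comp (measurable_filter mac))]; meas.
transitivity (\int[mu]_(x in D `&` A) (\sum_(i < N.+1) 'C(N, i)%:R%:E * J (GA x) i (N - i)%N) +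
   \int[mu]_(x in B) (\sum_(i < N.+1) 'C(N, i)%:R%:E * J (GB x) i (N - i)%N)).
  rewrite iterintS -[X in \int[mu]_(x in X) _](setUIDK D A) ge0_integral_setU//; last 3 first.
  - exact: measurable_funTS.
  - by move=> x _; apply: iterint_ge0 => *.
  - by rewrite /disj_set setDE setIACA setICr setI0.
  congr (_ + _).
    apply: eq_integral => x; rewrite inE => -[Dx Ax]; rewrite -IH//.
    by congr iterint; apply/funext => s /=; rewrite /a mem_set.
  apply: eq_integral => x; rewrite inE => -[Dx Ax]; rewrite -IH//.
  by congr iterint; apply/funext => s /=; rewrite /a memNset.
have CN0 i : 0 <= 'C(N, i)%:R%:E :> \bar R by rewrite lee_fin.
rewrite (_ : \int[mu]_(x in D `&` A) _ = \sum_(i < N.+1) 'C(N, i)%:R%:E * J G i.+1 (N - i)%N); last first.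
  rewrite ge0_integral_sum//; last 2 first.
  - by move=> i; apply: measurable_funTS; exact: measurable_funeM.
  - by move=> i x _; rewrite mule_ge0// J0.
  apply: eq_bigr => i _; rewrite ge0_integralZl//; last 2 first.
  - exact: measurable_funTS.
  - by move=> x _; exact: J0.
rewrite (_ : \int[mu]_(x in B) _ = \sum_(i < N.+1) 'C(N, i)%:R%:E * J G i (N.+1 - i)%N); last first.
  rewrite ge0_integral_sum//; last 2 first.
  - by move=> i; apply: measurable_funTS; exact: measurable_funeM.
  - by move=> i x _; rewrite mule_ge0// J0.
  apply: eq_bigr => i _; rewrite ge0_integralZl//; last 2 first.
  - exact: measurable_funTS.
  - by move=> x _; exact: J0.
  congr (_ * _); rewrite /J iterint_exchange//; last by move=> *; exact: iterint_ge0.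
  by congr iterint; apply/funext => s; rewrite subSn// -ltnS.
rewrite [RHS]big_ord_recl [in LHS]addeC [X in X + _]big_ord_recl /= -addeA; congr (_ + _).
  by rewrite !bin0 subn0.
rewrite [X in X + _](_ : _ = \sum_(i < N.+1) 'C(N, i.+1)%:R%:E * J G i.+1 (N - i)%N); last first.
  rewrite [RHS]big_ord_recr /= bin_small// mul0e adde0.
  by apply: eq_bigr => i _; rewrite /bump/= add1n subSS.
rewrite -big_split /=; apply: eq_bigr => i _.
rewrite /bump /= add1n subSS binS natrD EFinD ge0_muleDl//.
Qed.

End iterint_split.

Section totint.
Context {d} {E : measurableType d} {R : realType}.
Variable mu : {sigma_finite_measure set E -> \bar R}.
Local Open Scope ereal_scope.

Definition totint (D : set E) (g : seq E -> \bar R) : \bar R :=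
  \sum_(N <oo) iterint mu D N g.

Lemma totint_ge0 D g : (forall s, 0 <= g s) -> 0 <= totint D g.
Proof. by move=> g0; apply: nneseries_ge0 => *; exact: iterint_ge0. Qed.

Lemma eq_totint D g h : (forall s, over D s -> g s = h s) ->
  totint D g = totint D h.
Proof.
by move=> gh; apply: eq_eseriesr => N _; apply: eq_iterint => s Ds _; exact: gh.
Qed.

Variable (D : set E).
Hypothesis mD : measurable D.

Lemma le_totint g h : measurable_fun setT g -> measurable_fun setT h ->
  (forall s, 0 <= g s) -> (forall s, 0 <= h s) ->
  (forall s, over D s -> g s <= h s) -> totint D g <= totint D h.
Proof.
move=> mg mh g0 h0 gh; apply: lee_nneseries => N _.
  by move=> _; exact: iterint_ge0.
by apply: le_iterint => // s Ds _; exact: gh.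
Qed.

Lemma totintD g h : measurable_fun setT g -> measurable_fun setT h ->
  (forall s, 0 <= g s) -> (forall s, 0 <= h s) ->
  totint D (fun s => g s + h s) = totint D g + totint D h.
Proof.
move=> mg mh g0 h0; rewrite /totint -nneseriesD; last 2 first.
- by move=> *; exact: iterint_ge0.
- by move=> *; exact: iterint_ge0.
by apply: eq_eseriesr => N _; exact: iterintD.
Qed.

Lemma totintZ (k : R) g : measurable_fun setT g -> (forall s, 0 <= g s) ->
  (0 <= k)%R ->
  totint D (fun s => k%:E * g s) = k%:E * totint D g.
Proof.
move=> mg g0 k0; rewrite /totint -nneseriesZl//; last first.
  by move=> *; exact: iterint_ge0.
by apply: eq_eseriesr => N _; apply: iterintZ.
Qed.

Lemma totint_nneseries (g : nat -> seq E -> \bar R) :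
  (forall n, measurable_fun setT (g n)) -> (forall n s, 0 <= g n s) ->
  totint D (fun s => \sum_(n <oo) g n s) = \sum_(n <oo) totint D (g n).
Proof.
move=> mg g0; rewrite /totint [RHS]nneseries_interchange; last first.
  by move=> *; exact: iterint_ge0.
by apply: eq_eseriesr => N _; exact: iterint_nneseries.
Qed.

(** A list is empty or has a head; this drives the induction on the upper
    centers. *)
Lemma totint_recl g : measurable_fun setT g -> (forall s, 0 <= g s) ->
  totint D g = g [::] + \int[mu]_(x in D) totint D (fun s => g (x :: s)).
Proof.
move=> mg g0; rewrite /totint nneseries_recl//; last first.
  by move=> *; exact: iterint_ge0.
congr (_ + _); rewrite -nneseries_addn; last first.
  by move=> *; exact: iterint_ge0.
rewrite integral_nneseries//.
- by apply: eq_eseriesr => N _; rewrite addn1.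
- by move=> n; exact: measurable_iterint_cons.
- by move=> *; exact: iterint_ge0.
Qed.

End totint.

Section totint_split.
Context {d} {E : measurableType d} {R : realType}.
Variable mu : {sigma_finite_measure set E -> \bar R}.
Local Open Scope ereal_scope.

Lemma nneseries_antidiagonal (a : nat -> nat -> \bar R) :
  (forall i j, 0 <= a i j) ->
  \sum_(N <oo) \sum_(i < N.+1) a i (N - i)%N = \sum_(j <oo) \sum_(i <oo) a i j.
Proof.
move=> a0.
have c0 i N : 0 <= (if (i <= N)%N then a i (N - i)%N else 0) by case: ifP.
transitivity (\sum_(N <oo) \sum_(i <oo) (if (i <= N)%N then a i (N - i)%N else 0)).
  apply: eq_eseriesr => N _; rewrite (nneseries_split _ N.+1); last by [].
  rewrite [X in _ + X]eseries0 ?adde0; last first.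
    by move=> i; rewrite add0n => Ni _; rewrite leqNgt Ni.
  by rewrite add0n big_mkord; apply: eq_bigr => i _; rewrite -ltnS ltn_ord.
rewrite nneseries_interchange// [RHS]nneseries_interchange//.
apply: eq_eseriesr => i _; rewrite (nneseries_split _ i)//.
rewrite big1_seq ?add0e; last first.
  by move=> j; rewrite mem_index_iota add0n => /andP[_ /andP[_ ji]]; rewrite leqNgt ji.
rewrite add0n -nneseries_addn//; apply: eq_eseriesr => j _.
by rewrite leq_addl addnK.
Qed.

Variables (A B D : set E).
Hypotheses (mA : measurable A) (mB : measurable B) (mD : measurable D).

Lemma iterint_swap i j (H : seq E -> seq E -> \bar R) :
  measurable_fun setT (fun p : seq E * seq E => H p.1 p.2) ->
  (forall s t, 0 <= H s t) ->
  iterint mu A i (fun s => iterint mu B j (H s)) =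
  iterint mu B j (fun t => iterint mu A i (H ^~ t)).
Proof.
elim: i H => //= i IH H mH H0.
rewrite -iterint_exchange//; last by move=> *; exact: iterint_ge0.
- apply: eq_integral => x _; rewrite IH//.
  by apply: (measurableT_comp (g := fun p : seq E * seq E => (x :: p.1, p.2)) mH); meas.
- apply: (@measurable_iterint _ _ _ _ _ mA _ _ i
    (fun (p : E * seq E) s => H (p.1 :: s) p.2)) => //.
  by apply: (measurableT_comp (g := fun p : E * seq E * seq E => (p.1.1 :: p.2, p.1.2)) mH); meas.
Qed.

Lemma measurable_natfun {d'} {Y : measurableType d'} (h : Y -> nat) (f : nat -> \bar R) :
  measurable_fun setT h -> measurable_fun setT (fun y => f (h y)).
Proof. by move=> mh; apply: measurableT_comp. Qed.

End totint_split.

Section totint_filter.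
Context {d} {E : measurableType d} {R : realType}.
Variable mu : {sigma_finite_measure set E -> \bar R}.
Local Open Scope ereal_scope.
Variables (D A : set E).
Hypotheses (mD : measurable D) (mA : measurable A).

(** The inverse binomial coefficient cancels the number of interleavings of the
    two sublists.  Applied with A the features of one degree, this is where the
    factorials of the multi-degree kernel are consumed. *)
Lemma totint_filter (H : seq E -> seq E -> \bar R) :
  measurable_fun setT (fun p : seq E * seq E => H p.1 p.2) ->
  (forall s t, 0 <= H s t) ->
  totint mu D (fun s =>
    ('C(size s, size [seq x <- s | x \in A])%:R^-1)%:E *
    H [seq x <- s | x \in A] [seq x <- s | x \notin A]) =
  totint mu (D `&` ~` A) (fun t => totint mu (D `&` A) (fun s => H s t)).
Proof.
move=> mH H0; set B := D `&` ~` A.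
have mB : measurable B by apply: measurableI => //; exact: measurableC.
have mDA : measurable (D `&` A) by exact: measurableI.
pose w (p : seq E * seq E) : \bar R := ('C(size p.1 + size p.2, size p.1)%:R^-1)%:E.
have w0 p : 0 <= w p by rewrite lee_fin invr_ge0.
have mw : measurable_fun setT w.
  apply: (measurableT_comp (g := fun p : seq E * seq E => (size p.1, size p.2))
    (f := fun q : nat * nat => ('C(q.1 + q.2, q.1)%:R^-1)%:E : \bar R)).
    by move=> _ Y mY; exact: measurable_nat_pairs.
  by apply/measurable_fun_pair; apply: (measurableT_comp measurable_size); meas.
have -> : totint mu B (fun t => totint mu (D `&` A) (fun s => H s t)) =
    \sum_(j <oo) \sum_(i <oo)
      iterint mu (D `&` A) i (fun s => iterint mu B j (H s)).
  apply: eq_eseriesr => j _; rewrite iterint_nneseries//.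
  - by apply: eq_eseriesr => i _; exact/esym/iterint_swap.
  - move=> i; apply: (@measurable_iterint _ _ _ _ _ mDA _ _ i (fun t s => H s t)) => //.
    by apply: (measurableT_comp (g := fun p : seq E * seq E => (p.2, p.1)) mH); meas.
  - by move=> *; exact: iterint_ge0.
rewrite -nneseries_antidiagonal; last by move=> *; do 2 apply: iterint_ge0 => *.
apply: eq_eseriesr => N _.
pose G s t := w (s, t) * H s t.
have mG : measurable_fun setT (fun p : seq E * seq E => G p.1 p.2).
  apply: emeasurable_funM => //=.
have G0 s t : 0 <= G s t by exact: mule_ge0.
transitivity (iterint mu D N (fun s => G [seq x <- s | x \in A] [seq x <- s | x \notin A])).
  apply: eq_iterint => s _ _; rewrite /G /w /=; congr (_ %:E * _).
  by rewrite !size_filter -(count_predC (fun x => x \in A) s).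
rewrite (iterint_filter mu mD mA)//; apply: eq_bigr => i _.
rewrite -/B -iterintZ//; last 2 first.
- exact: measurable_iterint.
- by move=> *; exact: iterint_ge0.
apply: eq_iterint => s Ds si; rewrite -iterintZ//; last first.
  by apply: (measurableT_comp (g := fun t : seq E => (s, t)) mG); meas.
apply: eq_iterint => t _ tN; rewrite /G /w /= si tN subnKC; last by rewrite -ltnS.
rewrite muleA -EFinM divff ?mul1e// pnatr_eq0 -lt0n bin_gt0.
by rewrite -ltnS.
Qed.

End totint_filter.

Lemma measurable_over {d} {E : measurableType d} (D : set E) : measurable D ->
  measurable (over D).
Proof.
move=> mD.
have mf : measurable_fun setT (fun s : seq E => foldr (fun x b => (x \in D) && b) true s).
  apply: measurable_foldr; apply: measurable_and => //.
  by apply: (measurableT_comp (measurable_pred_of_set mD)).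
rewrite (_ : over D = (fun s : seq E => foldr (fun x b => (x \in D) && b) true s) @^-1` [set true]).
  by rewrite -[X in measurable X]setTI; exact: mf.
apply/seteqP; split; elim=> //= x s IH.
  by move=> /over_cons[Dx /IH ->]; rewrite mem_set.
by move=> /andP[/set_mem Dx /IH]; move=> ?; apply/over_cons.
Qed.

Lemma measurable_asbool_over {d} {E : measurableType d} (D : set E) : measurable D ->
  measurable_fun setT (fun s => `[< over D s >]).
Proof.
move=> /measurable_over mD; rewrite (_ : (fun _ => _) = (fun s => s \in over D)).
  exact: measurable_pred_of_set.
by apply/funext => s; apply/asboolP/idP => [/mem_set|/set_mem].
Qed.

(** * Stability of the bottleneck distance *)

Lemma set_bij_cancel {T U : Type} (A : set T) (B : set U) (f : T -> U) (g : U -> T) :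
  (forall x, A x -> B (f x)) -> (forall y, B y -> A (g y)) ->
  (forall x, A x -> g (f x) = x) -> (forall y, B y -> f (g y) = y) ->
  set_bij A B f.
Proof.
move=> fAB gBA gf fg; split.
- by move=> x Ax; exact: fAB.
- by move=> x y /set_mem Ax /set_mem Ay fxy; rewrite -(gf x Ax) -(gf y Ay) fxy.
- by move=> y By; exists (g y); [exact: gBA|exact: fg].
Qed.

Section bottleneck_moves.
Context {R : realType} (dg : nat).
Implicit Types (x : feature R) (s : seq (feature R)) (Z : diagram R).
Local Open Scope ereal_scope.

Lemma with_diagonalE s (xi : feature R * nat) :
  with_diagonal dg (seq_mset s) xi <->
  (xi.2 < count_mem xi.1 s)%N \/ (xi.1.1.1 = xi.1.1.2 /\ (xi.1.2 < dg)%N).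
Proof. by rewrite /with_diagonal /= (seq.permP (perm_eq_seq_mset s)). Qed.

Definition within (t : R) Z1 Z2 := exists2 gam, matching dg Z1 Z2 gam &
  forall xi, with_diagonal dg Z1 xi -> (supdist xi.1.1 (gam xi).1.1 <= t)%R.

(** Composing a matching with one that moves points by at most t costs at most t. *)
Lemma bottleneck_within Z0 Z Z' (t : R) : within t Z Z' ->
  bottleneck dg Z0 Z' <= bottleneck dg Z0 Z + t%:E.
Proof.
move=> [g [gbij gdeg] gt].
rewrite -leeBlDr//; apply: le_ereal_inf_tmp => _ [gam [gambij gamdeg] <-].
have gamfun xi : with_diagonal dg Z0 xi -> with_diagonal dg Z (gam xi).
  by case: gambij => + _ _; exact.
rewrite leeBlDr//; apply: (@le_trans _ _ (matching_cost dg Z0 (g \o gam))).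
  apply: ereal_inf_lbound; exists (g \o gam) => //; split.
    exact: set_bij_comp gambij gbij.
  by move=> xi Zxi /=; rewrite gdeg ?gamdeg//; exact: gamfun.
apply: ge_ereal_sup => _ [xi Zxi <-].
apply: (@le_trans _ _ ((supdist xi.1.1 (gam xi).1.1)%:E + t%:E)).
  rewrite -EFinD lee_fin /=.
  have := gt _ (gamfun _ Zxi).
  rewrite /supdist !ge_max => /andP[H1 H2]; apply/andP; split.
    apply: (le_trans (ler_distD (gam xi).1.1.1 _ _)).
    by apply: lerD => //; rewrite le_max lexx.
  apply: (le_trans (ler_distD (gam xi).1.1.2 _ _)).
  by apply: lerD => //; rewrite le_max lexx orbT.
by apply: leeD => //; apply: ereal_sup_ubound; exists xi.
Qed.

Lemma bottleneck_ge0 Z1 Z2 : (0 < dg)%N -> 0 <= bottleneck dg Z1 Z2.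
Proof.
move=> dg0; apply: le_ereal_inf_tmp => _ [gam _ <-].
pose xi : feature R * nat := (((0%R, 0%R), 0%N), 0%N).
apply: (@le_trans _ _ (supdist xi.1.1 (gam xi).1.1)%:E).
  by rewrite lee_fin /supdist le_max normr_ge0.
by apply: ereal_sup_ubound; exists xi => //; right.
Qed.

Lemma bottleneck_refl Z : bottleneck dg Z Z <= 0.
Proof.
apply: (@le_trans _ _ (matching_cost dg Z id)).
  apply: ereal_inf_lbound; exists id => //; split => //.
  exact: (@set_bij_cancel _ _ _ _ id id).
apply: ge_ereal_sup => _ [xi _ <-] /=.
by rewrite lee_fin /supdist !subrr normr0 maxxx.
Qed.

Lemma matching_inverse Z1 Z2 f g :
  (forall xi, with_diagonal dg Z1 xi -> with_diagonal dg Z2 (f xi)) ->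
  (forall xi, with_diagonal dg Z2 xi -> with_diagonal dg Z1 (g xi)) ->
  (forall xi, with_diagonal dg Z1 xi -> g (f xi) = xi) ->
  (forall xi, with_diagonal dg Z2 xi -> f (g xi) = xi) ->
  (forall xi, with_diagonal dg Z1 xi -> (f xi).1.2 = xi.1.2) ->
  matching dg Z1 Z2 f /\ matching dg Z2 Z1 g.
Proof.
move=> fAB gBA gf fg fdeg; split; split => //.
- exact: set_bij_cancel gf fg.
- exact: set_bij_cancel fg gf.
- by move=> y Zy; rewrite -fdeg ?fg//; exact: gBA.
Qed.

Lemma supdistC (p q : R * R) : supdist p q = supdist q p.
Proof. by rewrite /supdist (distrC p.1) (distrC p.2). Qed.

Lemma supdist_ge0 (p q : R * R) : (0 <= supdist p q)%R.
Proof. by rewrite /supdist le_max normr_ge0. Qed.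

(** The extra copy of x, numbered by its multiplicity in s, is sent to the extra
    copy of x', and everything else stays in place. *)
Lemma within_move x x' s : Wdeg R dg x -> Wdeg R dg x' -> x.2 = x'.2 ->
  within (supdist x.1 x'.1) (seq_mset (x :: s)) (seq_mset (x' :: s)).
Proof.
move=> [[x0 xd] xk] [[x'0 x'd] x'k] xx'; have [->|xNx'] := eqVneq x x'.
  exists id; first by split => //; exact: (@set_bij_cancel _ _ _ _ id id).
  by move=> xi _; rewrite /supdist !subrr normr0 maxxx.
pose n := count_mem x s; pose n' := count_mem x' s.
pose f (xi : feature R * nat) := if xi == (x, n) then (x', n') else xi.
pose g (xi : feature R * nat) := if xi == (x', n') then (x, n) else xi.
have aux y y' m m' : y != y' -> m = count_mem y s -> m' = count_mem y' s ->
    (y.1.1 < y.1.2)%R -> (y'.1.1 < y'.1.2)%R ->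
    forall xi, with_diagonal dg (seq_mset (y :: s)) xi ->
    with_diagonal dg (seq_mset (y' :: s)) (if xi == (y, m) then (y', m') else xi) /\
    xi != (y', m').
  move=> yy' -> -> yd y'd xi /with_diagonalE H; split; last first.
    apply/eqP => xiE; rewrite xiE /= in H; case: H => [|[E _]].
      by rewrite (negbTE yy') add0n ltnn.
    by rewrite E ltxx in y'd.
  apply/with_diagonalE; case: eqVneq => [_|xiy]; first by left; rewrite /= eqxx add1n.
  case: H => [H|]; [left|by right].
  move: H => /=; case: (eqVneq y xi.1) => [yxi|_].
    rewrite add1n ltnS leq_eqVlt => /orP[/eqP xi2|].
      by case/eqP: xiy; rewrite yxi -xi2; case: (xi).
    by move=> /leq_trans; apply; exact: leq_addl.
  by rewrite add0n => /leq_trans; apply; exact: leq_addl.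
have x'Nx : x' != x by rewrite eq_sym.
have [] := @matching_inverse (seq_mset (x :: s)) (seq_mset (x' :: s)) f g.
- by move=> xi /(aux _ _ n n' xNx' erefl erefl xd x'd)[].
- by move=> xi /(aux _ _ n' n x'Nx erefl erefl x'd xd)[].
- move=> xi /(aux _ _ n n' xNx' erefl erefl xd x'd)[_ xin]; rewrite /f.
  by case: eqVneq => [->|_]; rewrite /g ?eqxx// (negbTE xin).
- move=> xi /(aux _ _ n' n x'Nx erefl erefl x'd xd)[_ xin]; rewrite /g.
  by case: eqVneq => [->|_]; rewrite /f ?eqxx// (negbTE xin).
- by move=> xi _; rewrite /f; case: eqVneq => [->|].
move=> mf _; exists f => // xi _; rewrite /f; case: eqVneq => [->//|_].
by rewrite /supdist !subrr normr0 maxxx supdist_ge0.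
Qed.

(** The sup distance from a feature to the diagonal. *)
Definition half_pers x : R := ((x.1.2 - x.1.1) / 2)%R.

(** The deleted feature is matched with its nearest diagonal point.  The copies
    of this point already present are shifted by one to make room, which the
    infinite multiplicity of the diagonal allows. *)
Lemma within_delete x s : Wdeg R dg x ->
  within (half_pers x) (seq_mset (x :: s)) (seq_mset s) /\
  within (half_pers x) (seq_mset s) (seq_mset (x :: s)).
Proof.
move=> [[x0 xd] xk].
pose n := count_mem x s; pose m : R := ((x.1.1 + x.1.2) / 2)%R.
pose dl : feature R := ((m, m), x.2).
have xdl : x != dl.
  by apply/eqP => xE; move: xd; rewrite xE /= ltxx.
pose f (xi : feature R * nat) := if xi == (x, n) then (dl, 0%N) else
  if xi.1 == dl then (dl, xi.2.+1) else xi.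
pose g (xi : feature R * nat) := if xi == (dl, 0%N) then (x, n) else
  if xi.1 == dl then (dl, xi.2.-1) else xi.
have Wdl k Z : with_diagonal dg Z (dl, k) by right.
have fN0 xi : with_diagonal dg (seq_mset (x :: s)) xi -> xi != (x, n) ->
    xi.1 != dl -> with_diagonal dg (seq_mset s) xi.
  move=> /with_diagonalE H xix xid; apply/with_diagonalE.
  case: H => [H|]; [left|by right].
  move: H => /=; case: (eqVneq x xi.1) => [xxi|_].
    rewrite add1n ltnS leq_eqVlt => /orP[/eqP xi2|//].
    by case/eqP: xix; rewrite xxi /n xxi -xi2; case: (xi).
  by rewrite add0n.
have gf xi : with_diagonal dg (seq_mset (x :: s)) xi -> g (f xi) = xi.
  move=> Hxi; rewrite /f; case: (eqVneq xi (x, n)) => [->|xin].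
    by rewrite /g eqxx.
  case: (eqVneq xi.1 dl) => [xid|xid]; rewrite /g.
    rewrite ifF /=; last by apply/eqP => -[].
    by rewrite eqxx -xid; case: (xi).
  rewrite ifF ?(negbTE xid)//; apply/eqP => xiE.
  by rewrite xiE eqxx in xid.
have xnN : ~ with_diagonal dg (seq_mset s) (x, n).
  move=> /with_diagonalE /= [|[E _]]; first by rewrite ltnn.
  by rewrite E ltxx in xd.
have fg xi : with_diagonal dg (seq_mset s) xi -> f (g xi) = xi.
  move=> Hxi; rewrite /g; case: (eqVneq xi (dl, 0%N)) => [->|xin].
    by rewrite /f eqxx.
  have xixn : xi <> (x, n) by move=> E; apply: xnN; rewrite -E.
  case: (eqVneq xi.1 dl) => [xid|xid]; rewrite /f.
    rewrite ifF /=; last by apply/eqP => -[/eqP]; rewrite eq_sym (negbTE xdl).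
    rewrite eqxx; case: xi xid xin {Hxi xixn} => a [|k] /= ->; first by rewrite eqxx.
    by [].
  by rewrite ifF ?(negbTE xid)//; apply/eqP.
have [] := @matching_inverse (seq_mset (x :: s)) (seq_mset s) f g.
- move=> xi Hxi; rewrite /f; case: eqVneq => [_|xin]; first exact: Wdl.
  case: eqVneq => [_|xid]; first exact: Wdl.
  exact: fN0.
- move=> xi Hxi; rewrite /g; case: eqVneq => [_|xin].
    by apply/with_diagonalE; left => /=; rewrite eqxx add1n.
  case: eqVneq => [_|xid]; first exact: Wdl.
  move/with_diagonalE: Hxi => Hxi; apply/with_diagonalE.
  case: Hxi => [H|]; [left|by right].
  by move: H => /leq_trans; apply; exact: leq_addl.
- exact: gf.
- exact: fg.
- move=> xi _; rewrite /f; case: eqVneq => [->//|_].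
  by case: eqVneq => [->|].
have xm : `|x.1.1 - m|%R = half_pers x.
  rewrite ler0_norm /m /half_pers; first by lra.
  by rewrite subr_le0 ler_pdivlMr//; lra.
have xm' : `|x.1.2 - m|%R = half_pers x.
  rewrite ger0_norm /m /half_pers; first by lra.
  by rewrite subr_ge0 ler_pdivrMr//; lra.
have p0 : (0 <= half_pers x)%R by rewrite /half_pers divr_ge0// subr_ge0 ltW.
have cf xi : (supdist xi.1.1 (f xi).1.1 <= half_pers x)%R.
  rewrite /f; case: eqVneq => [->/=|_]; first by rewrite /supdist /= xm xm' maxxx.
  case: eqVneq => [->|_]; by rewrite /supdist !subrr normr0 maxxx.
move=> mf mg; split; first by exists f.
exists g => // xi Hxi; rewrite supdistC -{2}(fg xi Hxi); exact: cf.
Qed.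

End bottleneck_moves.

Lemma measurable_W (R : realType) :
  measurable (W R : set (measurableTypeR R * measurableTypeR R)).
Proof.
rewrite (_ : W R = [set p : measurableTypeR R * measurableTypeR R | (0 <= p.1)%R] `&` [set p | (p.1 < p.2)%R])//.
apply: measurableI.
  rewrite (_ : [set _ | _] = fst @^-1` `[0%R, +oo[%classic).
    rewrite -[X in measurable X]setTI; apply: measurable_fst => //.
  by apply/seteqP; split => p /=; rewrite in_itv /= andbT.
rewrite (_ : [set _ | _] = (fun p : measurableTypeR R * measurableTypeR R => p.1 < p.2)%R @^-1` [set true]).
  rewrite -[X in measurable X]setTI; apply: (measurable_fun_ltr (measurable_fst) (measurable_snd)) => //.
by apply/seteqP; split => p.
Qed.

Lemma measurable_Wdeg (R : realType) dg : measurable (Wdeg R dg).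
Proof.
rewrite (_ : Wdeg R dg = W R `*` [set k | (k < dg)%N])//.
by apply: measurableX => //; exact: measurable_W.
Qed.

Lemma measurable_behead_seq {d} {E : measurableType d} :
  measurable_fun [set: seq E] behead.
Proof.
apply: measurable_fun_seq1P => -[|n].
  rewrite (_ : (fun _ => _) = cst [::]); first exact: measurable_cst.
  by apply/funext => t /=; rewrite tuple0.
apply: (measurableT_comp (f := @tval n E) (g := fun t : n.+1.-tuple E => [tuple of behead t])).
  exact: measurable_tval.
exact: measurable_behead.
Qed.

Definition symmetric_fun {U : Type} {E : eqType} (F : seq E -> U) :=
  forall s t, perm_eq s t -> F s = F t.

Section lipschitz_class.
Context {R : realType} (dg : nat).
Implicit Types (x y : feature R) (s r : seq (feature R)).
Local Open Scope ereal_scope.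

(** The two stability properties of the bottleneck distance that the estimates
    rely on, as one-sided bounds because the values are extended reals. *)
Definition lip_bounds (F : seq (feature R) -> \bar R) := [/\
  forall x x' s, Wdeg R dg x -> Wdeg R dg x' -> x.2 = x'.2 ->
    over (Wdeg R dg) s -> F (x' :: s) <= F (x :: s) + (supdist x.1 x'.1)%:E,
  forall x s, Wdeg R dg x -> over (Wdeg R dg) s -> F s <= F (x :: s) + (half_pers x)%:E &
  forall x s, Wdeg R dg x -> over (Wdeg R dg) s -> F (x :: s) <= F s + (half_pers x)%:E].

(** Moving a feature is only possible within its degree. *)
Definition fdist x y : \bar R := if x.2 == y.2 then (supdist x.1 y.1)%:E else +oo.

Fixpoint sdist (r s : seq (feature R)) : \bar R :=
  match r, s with
  | [::], [::] => 0
  | y :: r', x :: s' => fdist x y + sdist r' s'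
  | _, _ => +oo
  end.

Lemma fdistC x y : fdist x y = fdist y x.
Proof. by rewrite /fdist eq_sym supdistC. Qed.

Lemma fdist_ge0 x y : 0 <= fdist x y.
Proof. by rewrite /fdist; case: ifP => // _; rewrite lee_fin supdist_ge0. Qed.

Lemma sdist_ge0 r s : 0 <= sdist r s.
Proof.
by elim: r s => [|y r IH] [|x s] //=; apply: adde_ge0 => //; exact: fdist_ge0.
Qed.

Lemma sdistC r s : sdist r s = sdist s r.
Proof. by elim: r s => [|y r IH] [|x s] //=; rewrite fdistC IH. Qed.

Lemma measurable_supdist {d} {Y : measurableType d} (p q : Y -> R * R) :
  measurable_fun setT p -> measurable_fun setT q ->
  measurable_fun setT (fun z => supdist (p z) (q z)).
Proof.
move=> mp mq; apply: measurable_maxr; apply: measurableT_comp => //;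
  apply: measurable_funB; exact: measurableT_comp.
Qed.

Lemma measurable_sdist r : measurable_fun setT (sdist r).
Proof.
have mn : measurable_fun setT (fun s : seq (feature R) => size s == 0%N).
  apply: (measurableT_comp (f := fun n => n == 0%N) (g := @size (feature R))) => //.
  exact: measurable_size.
elim: r => [|y r IH].
  rewrite (_ : sdist _ = fun s => if size s == 0%N then 0 else +oo).
    exact: measurable_fun_ifT.
  by apply/funext => -[].
rewrite (_ : sdist _ = fun s => if size s == 0%N then +oo else
  fdist (nth point s 0) y + sdist r (behead s)); last by apply/funext => -[].
apply: measurable_fun_ifT => //; apply: emeasurable_funD; last first.
  by apply: (measurableT_comp IH); exact: measurable_behead_seq.
apply: (measurableT_comp (f := fun x => fdist x y) (g := fun s => nth point s 0)).
  apply: measurable_fun_ifT => //.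
    apply: (measurableT_comp (f := fun n => n == y.2) (g := snd)) => //.
  by apply/measurable_EFinP; exact: measurable_supdist.
exact: measurable_nth.
Qed.

Lemma lip_bounds_sdist F r s : (forall s, 0 <= F s) ->
  lip_bounds F -> symmetric_fun F ->
  over (Wdeg R dg) r -> over (Wdeg R dg) s -> F s <= F r + sdist r s.
Proof.
move=> F0 [Fm _ _] Fsym Wr Ws.
have Fy u : F u + +oo = +oo.
  by rewrite addey// gt_eqF// (lt_le_trans _ (F0 u)) ?ltNyr.
suff : forall t, over (Wdeg R dg) t -> F (s ++ t) <= F (r ++ t) + sdist r s.
  by move=> /(_ [::]); rewrite !cats0; apply; exact: over_nil.
elim: r s Wr Ws => [|y r IH] [|x s] /=.
- by move=> _ _ t _; rewrite adde0.
- by move=> _ _ t _; rewrite Fy leey.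
- by move=> _ _ t _; rewrite Fy leey.
move=> /over_cons[Wy Wr] /over_cons[Wx Ws] t Wt.
have Wst : over (Wdeg R dg) (s ++ t).
  by move=> z; rewrite mem_cat => /orP[/Ws|/Wt].
rewrite /fdist; case: (eqVneq y.2 x.2) => [yx|_]; last first.
  rewrite [X in _ + X](_ : _ = +oo) ?Fy ?leey// addye//.
  by rewrite gt_eqF// (lt_le_trans _ (sdist_ge0 _ _)) ?ltNyr.
apply: (le_trans (Fm _ _ _ Wy Wx yx Wst)).
rewrite supdistC [leRHS]addeCA [leLHS]addeC; apply: leeD2l.
rewrite (Fsym (y :: s ++ t) (s ++ (y :: t))); last first.
  by rewrite -cat1s perm_catCA.
rewrite (Fsym (y :: r ++ t) (r ++ (y :: t))); last first.
  by rewrite -cat1s perm_catCA.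
by apply: IH => //; apply/over_cons.
Qed.

(** Lists with rational coordinates, a countable family of test points. *)
Definition dec_feature (c : rat * rat * nat) : feature R :=
  ((ratr c.1.1, ratr c.1.2), c.2).

Definition dec_seq (n : nat) : seq (feature R) :=
  map dec_feature (odflt [::] (choice.unpickle n)).

Lemma dec_seq_dense s (e : R) : (0 < e)%R -> over (Wdeg R dg) s ->
  exists2 n, over (Wdeg R dg) (dec_seq n) &
    sdist (dec_seq n) s <= ((size s)%:R * e)%:E.
Proof.
move=> e0.
suff H : over (Wdeg R dg) s -> exists2 c : seq (rat * rat * nat),
    over (Wdeg R dg) (map dec_feature c) &
    sdist (map dec_feature c) s <= ((size s)%:R * e)%:E.
  by move=> /H[c cW cs]; exists (choice.pickle c); rewrite /dec_seq choice.pickleK.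
elim: s => [_|x s IH /over_cons[[[x0 xd] xk] /IH [c cW cs]]].
  by exists [::]; rewrite //= mul0r.
have /rat_in_itvoo[q1] : (x.1.1 < Num.min (x.1.1 + e) x.1.2)%R.
  by rewrite lt_min xd ltrDl e0.
rewrite in_itv /= lt_min => /andP[q1x /andP[q1e q1d]].
have /rat_in_itvoo[q2] : (x.1.2 < x.1.2 + e)%R by rewrite ltrDl.
rewrite in_itv /= => /andP[q2x q2e].
exists ((q1, q2, x.2) :: c).
  apply/over_cons; split => //; split => //; split => /=; lra.
rewrite [sdist _ _]/= /fdist /= eqxx -natr1 mulrDl mul1r addrC EFinD leeD//.
rewrite lee_fin /supdist /= ge_max; apply/andP; split; rewrite ler_norml; apply/andP; split; lra.
Qed.

(** A functional with the stability bounds is the countable infimum of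
    F r + sdist r s over rational lists r, hence measurable.  The bottleneck
    distance being an infimum over uncountably many matchings, its measurability
    is obtained in this way. *)
Lemma measurable_lip F : (forall s, 0 <= F s) ->
  lip_bounds F -> symmetric_fun F ->
  measurable_fun setT (fun s => if `[< over (Wdeg R dg) s >] then F s else 0).
Proof.
move=> F0 Flip Fsym.
pose g n s : \bar R := if `[< over (Wdeg R dg) (dec_seq n) >]
  then F (dec_seq n) + sdist (dec_seq n) s else +oo.
have gE s : over (Wdeg R dg) s -> F s = einfs (g ^~ s) 0%N.
  move=> Ws; apply/eqP; rewrite eq_le; apply/andP; split.
    apply: le_ereal_inf_tmp => _ [n _ <-]; rewrite /g.
    case: asboolP => [Wn|_]; last by rewrite leey.
    exact: lip_bounds_sdist.
  apply/lee_addgt0Pr => e e0.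
  pose e' : R := (e / (2 * (size s).+1%:R))%R.
  have e'0 : (0 < e')%R by rewrite divr_gt0// mulr_gt0.
  have [n Wn nd] := dec_seq_dense e'0 Ws.
  apply: (@le_trans _ _ (g n s)).
    by apply: ereal_inf_lbound; exists n.
  rewrite /g asboolT//.
  have := lip_bounds_sdist F0 Flip Fsym Ws Wn.
  rewrite sdistC => /(leeD2r (sdist (dec_seq n) s)) /le_trans; apply.
  rewrite -addeA leeD2l//; apply: (le_trans (leeD nd nd)).
  rewrite -EFinD lee_fin.
  have : (e' * (2 * (size s).+1%:R) = e)%R by rewrite /e' divfK.
  by rewrite -natr1; lra.
have mW : measurable_fun setT (fun s : seq (feature R) => `[< over (Wdeg R dg) s >]).
  apply: measurable_asbool_over; exact: measurable_Wdeg.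
rewrite (_ : (fun _ => _) = fun s => if `[< over (Wdeg R dg) s >] then einfs (g ^~ s) 0%N else 0).
  apply: measurable_fun_ifT => //.
  apply: measurable_fun_einfs => n; rewrite /g; case: asboolP => _ //.
  by apply: emeasurable_funD => //; exact: measurable_sdist.
by apply/funext => s; case: asboolP => // /gE.
Qed.

End lipschitz_class.

Section bottleneck_from.
Context {R : realType} (dg : nat) (dg_gt0 : (0 < dg)%N) (Z0 : diagram R).
Local Open Scope ereal_scope.

Definition bot (s : seq (feature R)) : \bar R := bottleneck dg Z0 (seq_mset s).

Lemma bot_ge0 s : 0 <= bot s.
Proof. exact: bottleneck_ge0. Qed.

Lemma bot_sym : symmetric_fun bot.
Proof. by move=> s t /eq_seq_msetP; rewrite /bot => ->. Qed.

Lemma bot_lip : lip_bounds dg bot.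
Proof.
split.
- by move=> x x' s Wx Wx' xx' _; apply: bottleneck_within; exact: within_move.
- move=> x s Wx _; apply: bottleneck_within.
  by have [] := within_delete (dg := dg) s Wx.
- move=> x s Wx _; apply: bottleneck_within.
  by have [] := within_delete (dg := dg) s Wx.
Qed.

(** All the features of both diagrams are matched with the diagonal, one at a
    time. *)
Lemma bot_le s : in_diagram Z0 `<=` Wdeg R dg -> over (Wdeg R dg) s ->
  bot s <= (\sum_(x <- enum_mset Z0) half_pers x + \sum_(x <- s) half_pers x)%:E.
Proof.
move=> WZ0 Ws; have [_ del ins] := bot_lip.
have H0 : bot [::] <= (\sum_(x <- enum_mset Z0) half_pers x)%:E.
  have : bot (enum_mset Z0) <= 0 by rewrite /bot seq_mset_id; exact: bottleneck_refl.
  have : over (Wdeg R dg) (enum_mset Z0) by move=> x; exact: WZ0.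
  suff H t : over (Wdeg R dg) t -> bot [::] <= bot t + (\sum_(x <- t) half_pers x)%:E.
    by move=> /H /le_trans + Z00; apply; rewrite -[leRHS]add0e leeD2r.
  elim: t => [_|x t IH /over_cons[Wx Wt]]; first by rewrite big_nil adde0.
  apply: (le_trans (IH Wt)); rewrite big_cons EFinD addeA; apply: leeD2r.
  exact: del.
elim: s Ws => [_|x s IH /over_cons[Wx Ws]]; first by rewrite big_nil addr0.
apply: (le_trans (ins _ _ Wx Ws)); rewrite big_cons [(_ + (_ + _))%R]addrCA addrC EFinD.
by apply: leeD2r; exact: IH.
Qed.

(** Cut off outside of Wdeg, where the stability bounds give no control and
    measurability could fail. *)
Definition bot0 s : \bar R := if `[< over (Wdeg R dg) s >] then bot s else 0.

Lemma bot0E s : over (Wdeg R dg) s -> bot0 s = bot s.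
Proof. by rewrite /bot0; case: asboolP. Qed.

Lemma bot0_ge0 s : 0 <= bot0 s.
Proof. by rewrite /bot0; case: ifP => // _; exact: bot_ge0. Qed.

Lemma measurable_bot0 : measurable_fun setT bot0.
Proof. by apply: measurable_lip; [exact: bot_ge0|exact: bot_lip|exact: bot_sym]. Qed.

Lemma bot0_sym : symmetric_fun bot0.
Proof.
move=> s t st; rewrite /bot0 (bot_sym st).
rewrite (_ : `[< over (Wdeg R dg) s >] = `[< over (Wdeg R dg) t >])//.
by apply/asbool_equiv_eq; split => H x; [rewrite -(perm_mem st)|rewrite (perm_mem st)]; exact: H.
Qed.

Lemma bot0_lip : lip_bounds dg bot0.
Proof.
have [mv del ins] := bot_lip.
have W1 x s : Wdeg R dg x -> over (Wdeg R dg) s -> bot0 (x :: s) = bot (x :: s).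
  by move=> *; apply/bot0E/over_cons.
split.
- by move=> x x' s Wx Wx' xx' Ws; rewrite !W1//; exact: mv.
- by move=> x s Wx Ws; rewrite W1// bot0E//; exact: del.
- by move=> x s Wx Ws; rewrite W1// bot0E//; exact: ins.
Qed.

End bottleneck_from.

(** * Measurable symmetric functions of a diagram *)

Section diagram_measurability.
Context {R : realType}.
Notation E := (feature R).

Lemma measurable_count_event (A : set E) n : measurable A ->
  measurable [set Z : mdiagram R | count (fun x => x \in A) (enum_mset Z) = n].
Proof. by move=> mA; apply: sub_sigma_algebra; exists A, n. Qed.

(** A list of elements of the finite type C is determined up to order by its
    counts, and the counts generate the sigma-algebra of diagrams; there are
    countably many such lists. *)
Lemma measurable_type_event (C : finType) (tau : E -> C) (Y : set (seq C)) :
  (forall c, measurable (tau @^-1` [set c])) ->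
  (forall u v, perm_eq u v -> Y u -> Y v) ->
  measurable [set Z : mdiagram R | Y (map tau (enum_mset Z))].
Proof.
move=> mtau Ysym.
pose V (u : seq C) := \bigcap_(c in [set: C])
  [set Z : mdiagram R | count (fun x => x \in tau @^-1` [set c]) (enum_mset Z) =
                        count_mem c u].
have VE u Z : V u Z <-> perm_eq (map tau (enum_mset Z)) u.
  have cE c : count (fun x => x \in tau @^-1` [set c]) (enum_mset Z) =
              count_mem c (map tau (enum_mset Z)).
    rewrite count_map; apply: eq_count => x /=.
    by apply/idP/eqP => [/set_mem|xc]; [|apply/mem_set].
  split=> [H|/seq.permP H c _ /=]; last by rewrite cE H.
  by apply/allP => c _ /=; apply/eqP; rewrite -cE; exact: H.
rewrite [X in measurable X](_ : _ = \bigcup_n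
  (if `[< Y (odflt [::] (choice.unpickle n)) >] then
     V (odflt [::] (choice.unpickle n)) else set0)).
  apply: bigcupT_measurable => n; case: asboolP => // _.
  apply: fin_bigcap_measurable => // c _.
  exact: measurable_count_event.
apply/seteqP; split => [Z YZ|Z [n _]].
  exists (choice.pickle (map tau (enum_mset Z))); first by [].
  rewrite choice.pickleK [odflt _ _]/=; case: asboolP => // _.
  by apply/VE; exact: perm_refl.
by case: asboolP => // Yu /VE /=; rewrite perm_sym => /Ysym; exact.
Qed.

Section tuple_count.
Variable N : nat.
Local Open Scope ereal_scope.

Definition permuted (s : 'S_N) (z : seq E) : N.-tuple E :=
  [tuple nth point z (s i) | i < N].

Definition perm_count (A : set (N.-tuple E)) (z : seq E) : \bar R :=
  if size z == N then \sum_(s : 'S_N) (\1_A (permuted s z))%:E else 0.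

(** A product of Borel sets only sees the pattern of memberships of each feature,
    which takes finitely many values. *)
Lemma perm_count_rect (F : 'I_N -> set E) : (forall i, measurable (F i)) ->
  measurable_fun setT (fun Z : mdiagram R =>
    perm_count [set t | forall i, F i (tnth t i)] (enum_mset Z)).
Proof.
move=> mF.
pose tau (x : E) : {ffun 'I_N -> bool} := [ffun i => x \in F i].
pose g (u : seq {ffun 'I_N -> bool}) : \bar R := if size u == N then
  \sum_(s : 'S_N) ([forall i, nth [ffun => false] u (s i) i] : nat)%:R%:E else 0.
have mtau c : measurable (tau @^-1` [set c]).
  rewrite (_ : _ @^-1` _ = \bigcap_(i in [set: 'I_N]) (if c i then F i else ~` F i)).
    by apply: fin_bigcap_measurable => // i _; case: ifP => // _; exact: measurableC.
  apply/seteqP; split => x /=.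
    move=> <- i _; rewrite ffunE; case: ifPn; by [move/set_mem|move/negP => H Fx; apply: H; exact/mem_set].
  move=> H; apply/ffunP => i; rewrite ffunE; have := H i I.
  by case: (c i) => /= ?; [exact: mem_set|exact: memNset].
have gsym u v : perm_eq u v -> g u = g v.
  move=> uv; rewrite /g (perm_size uv); case: eqP => // vN.
  have uN : size u = N by rewrite (perm_size uv).
  have /tuple_permP[p /= pE] : perm_eq (@Tuple N _ u (introT eqP uN)) (@Tuple N _ v (introT eqP vN)) by [].
  rewrite [RHS](reindex_inj (mulIg p)) /=.
  apply: eq_bigr => s _; congr ((nat_of_bool _)%:R%:E).
  apply: eq_forallb => i; rewrite permM pE.
  by rewrite (nth_map (s i)) ?size_enum_ord// nth_ord_enum (tnth_nth [ffun => false]).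
move=> _ Y mY; rewrite setTI.
rewrite [X in measurable X](_ : _ = [set Z : mdiagram R | (g @^-1` Y) (map tau (enum_mset Z))]).
  by apply: measurable_type_event => // u v uv /=; rewrite (gsym _ _ uv).
apply/funext => Z /=; congr Y; rewrite /g /perm_count size_map.
case: eqP => // ZN; apply: eq_bigr => s _; congr _%:E.
rewrite indicE; congr (nat_of_bool _)%:R.
apply/idP/forallP => [/set_mem /= H i|H].
  rewrite (nth_map point) ?ZN// ffunE; apply/mem_set.
  by have := H i; rewrite tnth_mktuple.
apply/mem_set => i /=; rewrite tnth_mktuple.
by have := H i; rewrite (nth_map point) ?ZN// ffunE => /set_mem.
Qed.

Definition rectangles : set (set (N.-tuple E)) :=
  [set A | exists2 F : 'I_N -> set E, (forall i, measurable (F i)) &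
     A = [set t | forall i, F i (tnth t i)]].

Lemma measurable_rectangles : @measurable _ (N.-tuple E) = <<s rectangles >>.
Proof.
apply/seteqP; split.
  apply: smallest_sub; first exact: smallest_sigma_algebra.
  apply: (big_ind (fun X : set (set (N.-tuple E)) => X `<=` <<s rectangles >>)) => //.
    by move=> X Y XS YS; rewrite subUset.
  move=> i _ _ [A mA <-]; apply: sub_gen_smallest.
  exists (fun j => if j == i then A else setT); first by move=> j; case: ifP.
  rewrite setTI; apply/seteqP; split => t /=.
    by move=> At j; case: eqP => // ->.
  by move=> /(_ i); rewrite eqxx.
apply: smallest_sub; first exact: sigma_algebra_measurable.
move=> _ [F mF ->].
rewrite (_ : [set _ | _] = \bigcap_(i in [set: 'I_N]) ((fun t => tnth t i) @^-1` F i)).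
  apply: fin_bigcap_measurable => // i _.
  by rewrite -[X in measurable X]setTI; apply: measurable_tnth.
by apply/seteqP; split => t /= H i; [move=> _; exact: H|exact: (H i I)].
Qed.

(** Dynkin's theorem, from products of Borel sets to all measurable sets of
    tuples. *)
Lemma measurable_perm_count (A : set (N.-tuple E)) : measurable A ->
  measurable_fun setT (fun Z : mdiagram R => perm_count A (enum_mset Z)).
Proof.
move=> mA; have : <<s rectangles >> A by rewrite -measurable_rectangles.
have rectT : perm_count setT = perm_count [set t : N.-tuple E | forall i, setT (tnth t i)].
  by congr perm_count; apply/seteqP; split.
have mT : measurable_fun setT (fun Z : mdiagram R => perm_count setT (enum_mset Z)).
  by rewrite rectT; apply: (perm_count_rect (F := fun=> setT)).
apply: (@dynkin_induction _ _ rectangles (fun A =>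
  measurable_fun setT (fun Z : mdiagram R => perm_count A (enum_mset Z)))) => //.
- exact: measurable_rectangles.
- move=> _ _ [F mF ->] [G mG ->]; exists (fun i => F i `&` G i).
    by move=> i; exact: measurableI.
  apply/seteqP; split => t /=.
    by move=> [Ft Gt] i; split.
  by move=> H; split => i; case: (H i).
- by move=> _ [F mF ->]; exact: perm_count_rect.
- move=> B mB IH.
  rewrite (_ : (fun _ => _) = fun Z : mdiagram R =>
      perm_count setT (enum_mset Z) - perm_count B (enum_mset Z)).
    exact: emeasurable_funB.
  apply/funext => Z; rewrite /perm_count; case: ifP => _; last by rewrite sube0.
  rewrite !sumEFin -EFinB -sumrB; congr _%:E; apply: eq_bigr => s _.
  by rewrite !indicE in_setT in_setC; case: (_ \in B); rewrite /= ?subrr ?subr0.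
- move=> F mF tF IH.
  rewrite (_ : (fun _ => _) = fun Z : mdiagram R =>
      \sum_(k <oo) perm_count (F k) (enum_mset Z)).
    apply: ge0_emeasurable_sum => //.
    move=> k Z _ _; rewrite /perm_count; case: ifP => // _.
    by apply: sume_ge0 => s _; rewrite lee_fin.
  apply/funext => Z; rewrite /perm_count; case: ifP => _; last first.
    by rewrite eseries0.
  rewrite nneseries_sum; last by move=> *; rewrite lee_fin.
  apply: eq_bigr => s _.
  exact: indic_bigcup.
Qed.

End tuple_count.

(** When B is invariant under reordering, membership of one ordering is membership
    of all, and is read off from the number of orderings in B. *)
Lemma measurable_symmetric_event (B : set (seq E)) : measurable B ->
  (forall s t, perm_eq s t -> B s -> B t) ->
  measurable [set Z : mdiagram R | B (enum_mset Z)].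
Proof.
move=> mB Bsym.
pose BN N := [set t : N.-tuple E | B (tval t)].
rewrite [X in measurable X](_ : _ = \bigcup_N
  ((fun Z : mdiagram R => perm_count (BN N) (enum_mset Z)) @^-1` [set~ 0%E])).
  apply: bigcupT_measurable => N; rewrite -[X in measurable X]setTI.
  have mBN : measurable (BN N) by exact: mB.
  by apply: (measurable_perm_count mBN) => //; exact: measurableC.
have pB N (s : 'S_N) (z : seq E) : size z = N -> B (tval (permuted s z)) <-> B z.
  move=> zN; have zE : perm_eq (permuted s z) z.
    have /tuple_permP H : exists p : 'S_N, tval (permuted s z) =
        [tuple tnth (@Tuple N _ z (introT eqP zN)) (p i) | i < N].
      by exists s; apply: eq_map => i; rewrite (tnth_nth point).
    exact: H.
  by split; apply: Bsym; rewrite // perm_sym.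
apply/seteqP; split => [Z /= BZ|Z [N _] /=].
  exists (size (enum_mset Z)) => //=; rewrite /perm_count eqxx => /eqP.
  rewrite seq_psume_eq0; last by move=> *; rewrite lee_fin.
  move=> /allP /(_ 1%g); rewrite mem_index_enum => /(_ isT) /eqP.
  rewrite indicE mem_set; last exact/pB.
  by move=> [] /eqP; rewrite oner_eq0.
rewrite /perm_count; case: eqP => // ZN H; apply: contrapT => BZ; apply: H.
apply: big1 => s _; rewrite indicE memNset//=.
by move=> /(pB _ _ _ ZN).
Qed.

(** The enumeration of a diagram chooses an order arbitrarily, so only symmetric
    functions of it can be expected to be measurable. *)
Lemma measurable_on_diagrams {d} {T : measurableType d} (H : seq E -> T) :
  measurable_fun setT H -> symmetric_fun H ->
  measurable_fun setT (fun Z : mdiagram R => H (enum_mset Z)).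
Proof.
move=> mH Hsym _ Y mY; rewrite setTI.
apply: (@measurable_symmetric_event (H @^-1` Y)).
  by rewrite -[X in measurable X]setTI; exact: mH.
by move=> s t st; rewrite /= (Hsym _ _ st).
Qed.

Lemma measurable_seq_mset :
  measurable_fun setT (fun s : seq E => seq_mset s : mdiagram R).
Proof.
apply: (@measurability _ _ _ (mdiagram R) _ _ (count_events R)) => //.
move=> _ [_ [A [n [mA ->]]] <-]; rewrite setTI.
rewrite (_ : _ @^-1` _ = (fun s : seq E => size (seq.filter (fun x => x \in A) s)) @^-1` [set n]).
  rewrite -[X in measurable X]setTI.
  apply: (measurableT_comp measurable_size) => //.
  by apply: measurable_filter; exact: measurable_pred_of_set.
apply/seteqP; split => s /=; rewrite size_filter (seq.permP (perm_eq_seq_mset s)); exact.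
Qed.

Lemma measurable_feature_eq :
  measurable_fun setT (fun p : E * E => p.1 == p.2).
Proof.
rewrite (_ : (fun _ => _) = fun p : E * E =>
  (p.1.1.1 == p.2.1.1 :> R) && (p.1.1.2 == p.2.1.2 :> R) && (p.1.2 == p.2.2)).
  apply: measurable_and; first apply: measurable_and.
  - by apply: measurable_fun_eqr; do ?apply: measurableT_comp.
  - by apply: measurable_fun_eqr; do ?apply: measurableT_comp.
  - apply: (measurableT_comp (f := fun q : nat * nat => q.1 == q.2)
      (g := fun p : E * E => (p.1.2, p.2.2))).
      by move=> _ Y mY; exact: measurable_nat_pairs.
    by apply/measurable_fun_pair; apply: measurableT_comp.
by apply/funext => -[[[a b] k] [[a' b'] k']].
Qed.

Lemma measurable_mem_seq :
  measurable_fun setT (fun p : E * seq E => p.1 \in p.2).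
Proof.
rewrite (_ : (fun _ => _) = fun p : E * seq E => foldr (fun y b => (p.1 == y) || b) false p.2).
  apply: (@measurable_fun_foldr _ _ _ _ E bool (fun x y b => (x == y) || b) (fun=> false)) => //.
  apply: measurable_or => //.
  apply: (measurableT_comp (g := fun p : E * E * bool => (p.1.1, p.1.2)) measurable_feature_eq).
  by meas.
by apply/funext => -[x s] /=; elim: s => //= y s <-.
Qed.

Lemma measurable_uniq : measurable_fun setT (fun s : seq E => uniq s).
Proof.
rewrite (_ : (fun _ => _) = fun s => (foldr (fun x (p : seq E * bool) => (x :: p.1, (x \notin p.1) && p.2)) ([::], true) s).2).
  apply: (measurableT_comp measurable_snd).
  apply: measurable_foldr; apply/measurable_fun_pair => /=.
    by meas.
  apply: measurable_and; last by meas.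
  apply: measurable_neg.
  apply: (measurableT_comp (g := fun p : E * (seq E * bool) => (p.1, p.2.1)) measurable_mem_seq).
  by meas.
apply/funext => s; rewrite (_ : foldr _ _ s = (s, uniq s))//.
by elim: s => //= x s ->.
Qed.

End diagram_measurability.

(** * Set integrals as integrals over lists *)

Section product_sigma_finite.
Context d1 d2 (T1 : measurableType d1) (T2 : measurableType d2) (R : realType).
Variable m1 : {sigma_finite_measure set T1 -> \bar R}.
Variable m2 : {sigma_finite_measure set T2 -> \bar R}.

Definition product_sf : set (T1 * T2) -> \bar R := (m1 \x m2)%E.

HB.instance Definition _ := Measure.copy product_sf (m1 \x m2)%E.

Let product_sf_sigma_finite : sigma_finite setT product_sf.
Proof.
have /sigma_finiteP[F [TF ndF Foo]] := sigma_finiteT m1.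
have /sigma_finiteP[G [TG ndG Goo]] := sigma_finiteT m2.
exists (fun n => F n `*` G n).
  rewrite -setXTT TF TG predeqE => -[x y]; split.
    move=> [/= [n _ Fnx] [k _ Gky]]; exists (maxn n k) => //; split.
    - by move: x Fnx; exact/subsetPset/ndF/leq_maxl.
    - by move: y Gky; exact/subsetPset/ndG/leq_maxr.
  by move=> [n _ []/= ? ?]; split; exists n.
move=> k; have [mF Fk] := Foo k; have [mG Gk] := Goo k; split.
  exact: measurableX.
by rewrite /product_sf product_measure1E// lte_mul_pinfty// ge0_fin_numE.
Qed.

HB.instance Definition _ := Measure_isSigmaFinite.Build _ _ _ product_sf
  product_sf_sigma_finite.

End product_sigma_finite.

Section feature_measure.
Context {R : realType}.
Notation E := (feature R).
Local Open Scope ereal_scope.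

Definition plane_measure :
    {sigma_finite_measure set (measurableTypeR R * measurableTypeR R)%type -> \bar R} :=
  product_sf (@lebesgue_measure R) (@lebesgue_measure R).

Definition counting_sf : set nat -> \bar R := @counting nat R.
HB.instance Definition _ := Measure.copy counting_sf (@counting nat R).
HB.instance Definition _ := Measure_isSigmaFinite.Build _ _ _ counting_sf
  (sigma_finite_counting R).

(** Lebesgue measure on each of the copies of the plane indexed by degrees. *)
Definition fmu : {sigma_finite_measure set E -> \bar R} :=
  product_sf plane_measure counting_sf.

Lemma eseries_fin (f : nat -> \bar R) n : (forall k, 0 <= f k) ->
  (forall k, (n <= k)%N -> f k = 0) -> \sum_(k <oo) f k = \sum_(k < n) f k.
Proof.
move=> f0 fn; rewrite (nneseries_split _ n)// add0n big_mkord.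
by rewrite [X in _ + X]eseries0 ?adde0// => k nk _; exact: fn.
Qed.

Lemma integral_fmu (g : E -> \bar R) : measurable_fun setT g -> (forall x, 0 <= g x) ->
  \int[fmu]_x g x = \sum_(k <oo) \int[lebesgue2 R]_p g (p, k).
Proof.
move=> mg g0; rewrite [LHS](fubini_tonelli2 g)// ge0_integral_count//.
by move=> k; apply: integral_ge0.
Qed.

Lemma int_featureE dg (A : set E) (g : E -> \bar R) : measurable A ->
  measurable_fun setT g -> (forall x, 0 <= g x) ->
  int_feature dg A g = \int[fmu]_(x in Wdeg R dg `&` A) g x.
Proof.
move=> mA mg g0.
have mWA : measurable (Wdeg R dg `&` A).
  by apply: measurableI => //; exact: measurable_Wdeg.
rewrite integral_mkcond integral_fmu; last 2 first.
- by apply/(measurable_restrictT g mWA); exact: measurable_funTS.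
- by move=> x; exact: erestrict_ge0.
rewrite (@eseries_fin _ dg); last 2 first.
- by move=> k; apply: integral_ge0 => p _; exact: erestrict_ge0.
- move=> k dgk; apply: integral0_eq => p _; rewrite patchE ifF//.
  by apply/negbTE/negP => /set_mem [[_ /=]]; rewrite ltnNge dgk.
apply: eq_bigr => k _; rewrite integral_mkcond; apply: eq_integral => p _.
rewrite !patchE; congr (if _ then _ else _).
apply/idP/idP => /set_mem; first by move=> [Wp Ap]; apply/mem_set; do 2?split => //=.
by move=> [[Wp _] Ap]; apply/mem_set; split.
Qed.

End feature_measure.

Section iterint_restrict.
Context {d} {E : measurableType d} {R : realType}.
Variable mu : {sigma_finite_measure set E -> \bar R}.
Local Open Scope ereal_scope.

Lemma iterint0 D N : iterint mu D N (fun=> 0) = 0.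
Proof.
by elim: N => //= N IH; apply: integral0_eq => x _; exact: IH.
Qed.

Lemma iterint_restrict (D A : set E) N (g : seq E -> \bar R) :
  iterint mu (D `&` A) N g =
  iterint mu D N (fun s => if `[< over A s >] then g s else 0).
Proof.
elim: N g => [|N IH] g /=; first by rewrite asboolT.
rewrite integral_mkcondr; apply: eq_integral => x _; rewrite patchE.
case: ifPn => [/set_mem Ax|/negP xA].
  rewrite IH; congr iterint; apply/funext => s.
  by congr (if _ then _ else _); apply/asbool_equiv_eq; rewrite over_cons; tauto.
rewrite -[LHS](iterint0 D N); congr iterint; apply/funext => s.
by rewrite asboolF// => /over_cons[Ax _]; apply: xA; exact/mem_set.
Qed.

End iterint_restrict.

Section int_features.
Context {R : realType} (dg : nat).
Notation E := (feature R).
Local Open Scope ereal_scope.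

Lemma int_featuresE N (A : set E) (g : seq E -> \bar R) : measurable A ->
  measurable_fun setT g -> (forall x, 0 <= g x) ->
  int_features dg A N g = iterint fmu (Wdeg R dg `&` A) N g.
Proof.
move=> mA; elim: N g => //= N IH g mg g0.
rewrite (_ : (fun x => int_features _ _ _ _) =
    fun x => iterint fmu (Wdeg R dg `&` A) N (fun s => g (x :: s))).
  rewrite int_featureE//; last by move=> *; exact: iterint_ge0.
  apply: measurable_iterint => //; last exact: measurable_shift.
  by apply: measurableI => //; exact: measurable_Wdeg.
by apply/funext => x; apply: IH => //; exact: measurable_shift1.
Qed.

Lemma eq_int_features N (A : set E) (g h : seq E -> \bar R) :
  (forall s, over (Wdeg R dg `&` A) s -> size s = N -> g s = h s) ->
  int_features dg A N g = int_features dg A N h.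
Proof.
elim: N g h => [|N IH] g h gh /=; first exact: gh.
apply: eq_bigr => k _; apply: eq_integral => p /set_mem [Wp Ap].
apply: IH => s Ws sN; apply: gh; last by rewrite /= sN.
by apply/over_cons; split => //; split => //; split => /=.
Qed.
End int_features.

Section symmetrization.
Context {R : realType} (dg : nat).
Notation E := (feature R).
Local Open Scope ereal_scope.

Definition reordered N (p : 'S_N) (z : seq E) : seq E :=
  [seq nth point z k | k <- [seq nat_of_ord (p i) | i <- enum 'I_N]].

Lemma perm_positions N (p : 'S_N) :
  perm_eq [seq nat_of_ord (p i) | i <- enum 'I_N] (iota 0 N).
Proof.
apply: uniq_perm; rewrite ?iota_uniq//.
  by rewrite map_inj_uniq ?enum_uniq// => i j /val_inj /perm_inj.
move=> k; rewrite mem_iota add0n /=; apply/mapP/idP => [[i _ ->]//|kN].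
by exists (p^-1 (Ordinal kN))%g; rewrite ?mem_enum// permKV.
Qed.

Lemma perm_reordered N (p : 'S_N) z : size z = N -> perm_eq (reordered p z) z.
Proof.
move=> zN; rewrite -[X in perm_eq _ X](mkseq_nth point) /mkseq zN.
by apply: perm_map; exact: perm_positions.
Qed.

Lemma sum_reordered_perm N (g : seq E -> R) (z z' : seq E) : perm_eq z z' ->
  size z' = N ->
  (\sum_(p : 'S_N) g (reordered p z) = \sum_(p : 'S_N) g (reordered p z'))%R.
Proof.
move=> zz' z'N; have zN : size z = N by rewrite (perm_size zz').
have /tuple_permP[q /= qE] : perm_eq (@Tuple N _ z (introT eqP zN))
  (@Tuple N _ z' (introT eqP z'N)) by [].
rewrite [RHS](reindex_inj (mulIg q)) /=.
apply: eq_bigr => p _; congr g; rewrite /reordered -!map_comp.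
apply: eq_map => i /=; rewrite permM qE.
by rewrite (nth_map (p i)) ?size_enum_ord// nth_ord_enum (tnth_nth point).
Qed.

(** The enumeration of the multiset of s is some reordering of s, and the sum over
    all the reorderings does not see which one. *)
Lemma on_diagramE N (g : seq E -> R) (s : seq E) : size s = N ->
  on_diagram g (seq_mset s) = (\sum_(p : 'S_N) g (reordered p s))%R.
Proof.
move=> sN; set z := enum_mset (seq_mset s).
have zs : perm_eq z s by exact: perm_eq_seq_mset.
have zN : size z = N by rewrite (perm_size zs).
rewrite -(sum_reordered_perm g zs)// /on_diagram -/z -zN.
apply: eq_bigr => p _; congr g; rewrite /reordered -map_comp.
by apply: eq_map => i; rewrite (tnth_nth point).
Qed.

(** A density is only constrained over Wdeg, so it is extended by 0. *)
Definition on_W (g : seq E -> R) (s : seq E) : \bar R :=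
  if `[< over (Wdeg R dg) s >] then (g s)%:E else 0.

Lemma on_W_ge0 g s : (forall s, over (Wdeg R dg) s -> (0 <= g s)%R) -> 0 <= on_W g s.
Proof. by move=> g0; rewrite /on_W; case: asboolP => // /g0; rewrite lee_fin. Qed.

(** The integral of each of the N! reordered densities against a symmetric F is
    the same, so that the factor 1 / N! of the set integral disappears. *)
Lemma set_integral_symmetrized (F : diagram R -> \bar R) (F0 : seq E -> \bar R)
    (g : seq E -> R) :
  (forall s, 0 <= F0 s) -> measurable_fun setT F0 -> symmetric_fun F0 ->
  (forall s, over (Wdeg R dg) s -> F (seq_mset s) = F0 s) ->
  (forall s, over (Wdeg R dg) s -> (0 <= g s)%R) ->
  measurable_fun setT (on_W g) ->
  set_integral dg (fun Z => F Z * (on_diagram g Z)%:E) =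
  totint fmu (Wdeg R dg) (fun s => F0 s * on_W g s).
Proof.
move=> F00 mF0 F0sym FF0 g0 mg.
have gW0 s : 0 <= on_W g s by exact: on_W_ge0.
have mW := @measurable_Wdeg R dg.
have mord N (p : 'S_N) : measurable_fun setT (reordered p).
  exact: measurable_map_nth.
rewrite /set_integral /totint; apply: eq_eseriesr => N _.
transitivity ((N`!%:R^-1)%:E *
    int_features dg setT N (fun s => \sum_(p : 'S_N) F0 s * on_W g (reordered p s))).
  congr (_ * _); apply: eq_int_features => s Ws sN.
  have {}Ws : over (Wdeg R dg) s by move=> x /Ws[].
  rewrite FF0// (on_diagramE _ sN) -sumEFin ge0_sume_distrr; last first.
    move=> p _; rewrite lee_fin; apply: g0 => x; rewrite (perm_mem (perm_reordered p sN)); exact: Ws.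
  apply: eq_bigr => p _; congr (_ * _); rewrite /on_W asboolT//.
  by move=> x; rewrite (perm_mem (perm_reordered p sN)); exact: Ws.
rewrite int_featuresE//; last 2 first.
- apply: emeasurable_sum => p; apply: emeasurable_funM => //.
  exact: measurableT_comp.
- by move=> s; apply: sume_ge0 => p _; exact: mule_ge0.
rewrite setIT iterint_sum//; last 2 first.
- by move=> p; apply: emeasurable_funM => //; exact: measurableT_comp.
- by move=> *; exact: mule_ge0.
rewrite (eq_bigr (fun=> iterint fmu (Wdeg R dg) N (fun s => F0 s * on_W g s))); last first.
  move=> p _.
  rewrite -[RHS](iterint_perm fmu mW _ _ (perm_positions p)); last 2 first.
  - exact: emeasurable_funM.
  - by move=> *; exact: mule_ge0.
  apply: eq_iterint => s Ws sN; congr (_ * _); apply/esym/F0sym.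
  exact: perm_reordered.
set I := iterint _ _ _ _.
rewrite (eq_bigr (fun=> 1%:E * I)); last by move=> *; rewrite mul1e.
rewrite -ge0_sume_distrl; last by move=> *; rewrite lee_fin.
rewrite sumEFin sumr_const card_Sn.
rewrite muleA -EFinM mulVf ?mul1e// pnatr_eq0 -lt0n; exact: fact_gt0.
Qed.

Lemma MADE (Z0 : diagram R) (g : seq E -> R) : (0 < dg)%N ->
  (forall s, over (Wdeg R dg) s -> (0 <= g s)%R) ->
  measurable_fun setT (on_W g) ->
  MAD dg Z0 g = totint fmu (Wdeg R dg) (fun s => bot0 dg Z0 s * on_W g s).
Proof.
move=> dg0 g0 mg; rewrite /MAD (set_integral_symmetrized (F0 := bot0 dg Z0))//.
- exact: bot0_ge0.
- exact: measurable_bot0.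
- exact: bot0_sym.
- by move=> s Ws; rewrite bot0E.
Qed.

End symmetrization.

(** * Void probabilities determine simple diagrams *)

Section void_events.
Context {R : realType}.
Notation E := (feature R).

Definition void (A : set E) : set (diagram R) := [set Z | in_diagram Z `<=` A].
Definition void_events : set (set (diagram R)) :=
  [set V | exists2 A : set E, measurable A & V = void A].
Definition vdiagram := g_sigma_algebraType void_events.
Definition simple : set (diagram R) := [set Z | uniq (enum_mset Z)].

(** A countable family of Borel sets that separates features: rational cuts of
    the coordinates, and the degrees. *)
Definition separating (j : nat) : set E :=
  match choice.unpickle j : option (rat + rat + nat) with
  | Some (inl (inl q)) => [set x | x.1.1 < ratr q]
  | Some (inl (inr q)) => [set x | x.1.2 < ratr q]
  | Some (inr k) => [set x | x.2 = k]
  | None => set0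
  end.

Lemma measurable_separating j : measurable (separating j).
Proof.
rewrite /separating; case: (choice.unpickle j) => [[[q|q]|k]|] //.
- rewrite (_ : [set _ | _] = (fun x : E => x.1.1 < (ratr q : R)) @^-1` [set true]); last by apply/seteqP; split.
  rewrite -[X in measurable X]setTI; apply: (measurable_fun_ltr (f := fun x : E => x.1.1) (g := cst (ratr q))) => //.
  exact: measurableT_comp.
- rewrite (_ : [set _ | _] = (fun x : E => x.1.2 < (ratr q : R)) @^-1` [set true]); last by apply/seteqP; split.
  rewrite -[X in measurable X]setTI; apply: (measurable_fun_ltr (f := fun x : E => x.1.2) (g := cst (ratr q))) => //.
  exact: measurableT_comp.
- rewrite (_ : [set _ | _] = snd @^-1` [set k])//.
  by rewrite -[X in measurable X]setTI; apply: measurable_snd.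
Qed.

(** The cells of these signatures form finer and finer finite partitions, which
    eventually separate the features of any given diagram. *)
Definition signature (k : nat) (x : E) : seq bool :=
  [seq x \in separating j | j <- iota 0 k].

Lemma measurable_signature k t : measurable (signature k @^-1` [set t]).
Proof.
rewrite (_ : _ @^-1` _ = if size t == k then
    \bigcap_(j in `I_k) (if nth false t j then separating j else ~` separating j)
  else set0).
  case: ifP => // _; apply: fin_bigcap_measurable; first exact: finite_II.
  move=> j _; case: ifP => _; last apply: measurableC; exact: measurable_separating.
apply/seteqP; split => x /=.
  move=> <-; rewrite size_map size_iota eqxx => j /= jk.
  rewrite (nth_map 0%N) ?size_iota// nth_iota//.
  by case: ifPn => [/set_mem|/negP H Hx]; [|apply: H; exact/mem_set].
case: eqP => // tk H; apply: (@eq_from_nth _ false).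
  by rewrite size_map size_iota tk.
move=> j; rewrite size_map size_iota => jk.
rewrite (nth_map 0%N) ?size_iota// nth_iota//.
rewrite add0n; have := H j jk; by case: (nth false t j) => /= ?; [exact: mem_set|exact: memNset].
Qed.

Lemma separatingP (x y : E) : x != y ->
  exists j, (x \in separating j) != (y \in separating j).
Proof.
have sepr (a b : R) : a != b -> exists q : rat, (a < ratr q) != (b < ratr q).
  wlog ab : a b / a < b => [H|_].
    case: (ltgtP a b) => // ab _; first by apply: (H a b ab); rewrite lt_eqF.
    by have [|q] := H b a ab; [rewrite lt_eqF|exists q; rewrite eq_sym].
  have /rat_in_itvoo[q] := ab; rewrite in_itv /= => /andP[aq qb].
  by exists q; rewrite aq ltNge (ltW qb).
have memE (P : E -> bool) z : (z \in [set w | P w]) = P z.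
  by apply/idP/idP => [/set_mem|/mem_set].
case: x y => [[a b] k] [[a' b'] k'] xy.
have [aa'|/sepr[q aq]] := eqVneq (a : R) a'; last first.
  by exists (choice.pickle (inl (inl q) : rat + rat + nat)); rewrite /separating choice.pickleK !memE.
have [bb'|/sepr[q bq]] := eqVneq (b : R) b'; last first.
  by exists (choice.pickle (inl (inr q) : rat + rat + nat)); rewrite /separating choice.pickleK !memE.
exists (choice.pickle (inr k : rat + rat + nat)); rewrite /separating choice.pickleK.
have kk' : k' <> k by move=> kk'; move: xy; rewrite aa' bb' kk' eqxx.
by rewrite mem_set// memNset.
Qed.

Lemma signature_inj (s : seq E) : exists k, {in s &, injective (signature k)}.
Proof.
have mono k k' x y : (k <= k')%N -> signature k x != signature k y ->
    signature k' x != signature k' y.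
  move=> kk'; apply: contra_neq; rewrite /signature -(subnKC kk') iotaD !map_cat.
  move=> /eqP; rewrite eqseq_cat ?size_map// => /andP[/eqP ? _] //.
have sep x y : x != y -> exists k, signature k x != signature k y.
  move=> /separatingP[j xyj]; exists j.+1.
  apply: contra_neq xyj => /(congr1 (fun t => nth false t j)).
  by rewrite !(nth_map 0%N) ?size_iota// nth_iota.
suff [k kP] : exists k, forall x y, x \in s -> y \in s -> x != y ->
    signature k x != signature k y.
  exists k => x y xs ys; apply: contraPeq => /(kP x y xs ys) /eqP; exact.
have sep1 x (t : seq E) : exists k, forall y, y \in t -> x != y ->
    signature k x != signature k y.
  elim: t => [|y t [k kP]]; first by exists 0%N.
  have [xy|/sep[k' k'P]] := eqVneq x y.
    by exists k => z; rewrite inE => /predU1P[->|/kP//]; rewrite xy eqxx.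
  exists (maxn k k') => z; rewrite inE => /predU1P[-> _|zt xz].
    by apply: mono k'P; rewrite leq_maxr.
  by apply: mono (kP _ zt xz); rewrite leq_maxl.
elim: s => [|x s [k kP]]; first by exists 0%N.
have [k' k'P] := sep1 x s; exists (maxn k k') => y z.
have m1 : (k <= maxn k k')%N by rewrite leq_maxl.
have m2 : (k' <= maxn k k')%N by rewrite leq_maxr.
rewrite !inE => /predU1P[->|ys] /predU1P[->|zs].
- by rewrite eqxx.
- by move=> xz; apply: (mono _ _ _ _ m2); exact: k'P.
- by rewrite eq_sym => xy; rewrite eq_sym; apply: (mono _ _ _ _ m2); exact: k'P.
- by move=> yz; apply: (mono _ _ _ _ m1); exact: kP.
Qed.

(** For a diagram without repetitions, having at least m features in A: for some
    resolution k, at least m cells are hit inside A.  This is expressed through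
    void events only. *)
Definition hits (A : set E) m : set (diagram R) :=
  [set Z | exists k, exists c : seq (seq bool), [/\ uniq c, size c = m &
     forall t, t \in c -> ~ void (~` (A `&` signature k @^-1` [set t])) Z]].

Lemma measurable_hits A m : measurable A -> measurable (hits A m : set vdiagram).
Proof.
move=> mA; pose dec n : seq (seq bool) := odflt [::] (choice.unpickle n).
rewrite (_ : hits A m = \bigcup_k \bigcup_n
  (if uniq (dec n) && (size (dec n) == m) then
    \bigcap_(t in [set` dec n]) ~` void (~` (A `&` signature k @^-1` [set t]))
  else set0)).
  apply: (@bigcupT_measurable _ vdiagram) => k.
  apply: (@bigcupT_measurable _ vdiagram) => n.
  case: ifP => // _; apply: (@fin_bigcap_measurable _ vdiagram) => //.
  move=> t _; apply: (@measurableC _ vdiagram); apply: sub_sigma_algebra.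
  exists (~` (A `&` signature k @^-1` [set t])) => //.
  by apply: measurableC; apply: measurableI => //; exact: measurable_signature.
apply/seteqP; split => [Z [k [c [uc cm H]]]|Z [k _ [n _]]].
  exists k => //; exists (choice.pickle c) => //.
  have -> : dec (choice.pickle c) = c by rewrite /dec choice.pickleK.
  by rewrite uc cm eqxx [true && true]/= => t /= /H.
case: ifP => // /andP[uc /eqP cm] H; exists k, (dec n); split => // t tc.
Qed.

Lemma hitsP A m Z : simple Z -> hits A m Z <->
  (m <= count (fun x => x \in A) (enum_mset Z))%N.
Proof.
move=> uZ; rewrite -size_filter; set s := seq.filter _ _.
split=> [[k [c [uc <- H]]]|ms].
  rewrite -(size_map (signature k)); apply: uniq_leq_size => // t /H.
  move=> /existsNP[x] /not_implyP[Zx] /contrapT[Ax /= xt].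
  by apply/mapP; exists x => //; rewrite mem_filter mem_set.
have us : uniq s by exact: filter_uniq.
have [k kinj] := signature_inj s.
exists k, (take m (map (signature k) s)); split.
- by apply: take_uniq; rewrite map_inj_in_uniq.
- by rewrite size_takel// size_map.
move=> t /mem_take /mapP[x xs tx] H; move: (xs); rewrite mem_filter => /andP[/set_mem Ax Zx].
by apply: (H x).
Qed.

(** On diagrams without repetitions, counts are expressed by void events through
    hits, so both families generate the same trace. *)
Lemma trace_simple (X : set (diagram R)) : measurable (X : set (mdiagram R)) ->
  exists2 X' : set (diagram R), measurable (X' : set vdiagram) &
    X `&` simple = X' `&` simple.
Proof.
pose C := [set X : set (diagram R) | exists2 X' : set (diagram R),
  measurable (X' : set vdiagram) & X `&` simple = X' `&` simple].
suff : <<s count_events R >> `<=` C by move=> H /H.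
apply: smallest_sub.
  split.
  - by exists set0 => //; exact: measurable0.
  - move=> Y [Y' mY' YE]; exists (~` Y'); first exact: (@measurableC _ vdiagram).
    rewrite setTD; apply/seteqP; split => Z [HZ sZ]; split => // YZ; apply: HZ.
      by have [] : (Y `&` simple) Z by rewrite YE.
    by have [] : (Y' `&` simple) Z by rewrite -YE.
  - move=> F FC.
    have /choice[F' F'P] : forall i, exists X' : set (diagram R),
        measurable (X' : set vdiagram) /\ F i `&` simple = X' `&` simple.
      by move=> i; have [X' ? ?] := FC i; exists X'.
    exists (\bigcup_i F' i).
      by apply: (@bigcupT_measurable _ vdiagram) => i; case: (F'P i).
    by rewrite !setI_bigcupl; apply: eq_bigcupr => i _; case: (F'P i).
move=> _ [A [n [mA ->]]]; exists (hits A n `\` hits A n.+1).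
  by apply: (@measurableD _ vdiagram); exact: measurable_hits.
apply/seteqP; split => Z [HZ sZ]; split => //.
  by split; rewrite ?(hitsP _ _ sZ) HZ// ltnn.
case: HZ; rewrite !(hitsP _ _ sZ) => nc /negP; rewrite -leqNgt => cn /=.
by apply/eqP; rewrite eqn_leq cn nc.
Qed.

Local Open Scope ereal_scope.

Lemma measurable_void A : measurable A -> measurable (void A : set (mdiagram R)).
Proof.
move=> mA; rewrite (_ : void A = [set Z : mdiagram R | count (fun x => x \in ~` A) (enum_mset Z) = 0%N]).
  by apply: measurable_count_event; exact: measurableC.
apply/seteqP; split => Z /=.
  move=> ZA; apply/eqP; rewrite eqn0Ngt -has_count; apply/hasPn => x xZ.
  by apply/negP => /set_mem; apply; exact: ZA.
move=> /eqP; rewrite eqn0Ngt -has_count => /hasPn H x xZ.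
by apply: contrapT => Ax; have := H x xZ; rewrite mem_set.
Qed.

Lemma measurable_vdiagram (X : set (diagram R)) :
  measurable (X : set vdiagram) -> measurable (X : set (mdiagram R)).
Proof.
suff : <<s void_events >> `<=` @measurable _ (mdiagram R) by move=> H /H.
apply: smallest_sub; first exact: (@sigma_algebra_measurable _ (mdiagram R)).
by move=> _ [A mA ->]; exact: measurable_void.
Qed.

Lemma measurable_simple : measurable (simple : set (mdiagram R)).
Proof.
apply: (@measurable_symmetric_event _ [set s : seq E | uniq s]).
  rewrite -[X in measurable X]setTI; exact: measurable_uniq.
by move=> s t /perm_uniq /= ->.
Qed.

(** The void events form a pi-system, since being contained in A and in B is being
    contained in their intersection; on simple diagrams they generate all the
    events. *)
Lemma void_probabilities_determine (m1 m2 : {measure set (mdiagram R) -> \bar R}) :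
  m1 setT < +oo ->
  (forall A, measurable A -> m1 (void A) = m2 (void A)) ->
  m1 (~` simple) = 0 -> m2 (~` simple) = 0 ->
  forall X : set (mdiagram R), measurable X -> m1 X = m2 X.
Proof.
move=> m1oo m12 m1s m2s X mX.
have ms := measurable_simple.
have onsimple (m : {measure set (mdiagram R) -> \bar R}) Y : m (~` simple) = 0 ->
    measurable Y -> m Y = m (Y `&` simple).
  move=> m0 mY; rewrite -{1}(setIT Y) -(setUv simple) setIUr measureU//.
  - rewrite [X in _ + X](_ : _ = 0) ?adde0//.
    apply: (subset_measure0 _ _ _ m0) => //.
    + by apply: measurableI => //; exact: measurableC.
    + exact: measurableC.
  - exact: measurableI.
  - by apply: measurableI => //; exact: measurableC.
  - by rewrite setIACA setICr setI0.
have [X' mX' XX'] := trace_simple mX.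
rewrite (onsimple m1)// (onsimple m2)// XX' -(onsimple m1)//; last exact: measurable_vdiagram.
rewrite -(onsimple m2)//; last exact: measurable_vdiagram.
apply: (@g_sigma_algebra_measure_unique _ _ (mdiagram R) void_events _ (fun=> setT)) => //.
- by move=> _ [A mA ->]; exact: measurable_void.
- by move=> _; exists setT => //; apply/seteqP; split.
- by apply/seteqP; split => // Z _; exists 0%N.
- move=> _ _ [A mA ->] [B mB ->]; exists (A `&` B); first exact: measurableI.
  apply/seteqP; split => Z.
    by move=> [ZA ZB] x Zx; split; [exact: ZA|exact: ZB].
  by move=> ZAB; split => x /ZAB[].
- by move=> _ [A mA ->]; exact: m12.
Qed.

End void_events.

(** * Law and expectations of a diagram with a global pdf *)

Lemma set_seq_cons (T : eqType) (x : T) (s : seq T) :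
  [set` x :: s] = [set x] `|` [set` s].
Proof.
by apply/seteqP; split => y /=; rewrite inE => /predU1P.
Qed.

Lemma measurable_bool_indicator {d} {T : measurableType d} {R : realType} (b : T -> bool) :
  measurable_fun setT b ->
  measurable_fun setT (fun x => (b x)%:R%:E : \bar R).
Proof.
move=> mb; rewrite (_ : (fun _ => _) = fun x => if b x then 1%E else 0%E).
  exact: measurable_fun_ifT.
by apply/funext => x; case: (b x).
Qed.

Section simple_almost_everywhere.
Context {R : realType}.
Notation E := (feature R).
Local Open Scope ereal_scope.

Lemma fmu_set1 (x : E) : fmu [set x] = 0.
Proof.
have -> : [set x] = [set x.1] `*` [set x.2].
  by apply/seteqP; split => [y ->//|[p k] [/= -> ->]]; case: x.
rewrite [LHS]product_measure1E//; last first.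
  have -> : [set x.1] = [set x.1.1] `*` [set x.1.2].
    by apply/seteqP; split => [y ->//|[p k] [/= -> ->]]; case: (x.1).
  exact: measurableX.
have -> : [set x.1] = [set x.1.1] `*` [set x.1.2].
  by apply/seteqP; split => [y ->//|[p k] [/= -> ->]]; case: (x.1).
rewrite [X in X * _](_ : _ = 0) ?mul0e//.
transitivity (lebesgue_measure ([set x.1.1] : set R) * lebesgue_measure ([set x.1.2] : set R)).
  exact: product_measure1E.
by rewrite lebesgue_measure_set1 mul0e.
Qed.

Lemma measurable_set1_feature (x : E) : measurable [set x].
Proof.
have -> : [set x] = ([set x.1.1] `*` [set x.1.2]) `*` [set x.2].
  by apply/seteqP; split => [y ->//|[[a b] k] [[/= -> ->] ->]]; case: x => -[].
by apply: measurableX => //; apply: measurableX.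
Qed.

Lemma measurable_set_seq (s : seq E) : measurable [set` s].
Proof.
elim: s => [|y s IH]; first by rewrite classical_sets.set_nil.
by rewrite set_seq_cons; apply: measurableU => //; exact: measurable_set1_feature.
Qed.

Lemma fmu_set_seq (s : seq E) : fmu [set` s] = 0.
Proof.
elim: s => [|y s IH]; first by rewrite classical_sets.set_nil measure0.
apply/eqP; rewrite -measure_le0 set_seq_cons.
apply: (le_trans (measureU2 _ _ _)); [exact: measurable_set1_feature|exact: measurable_set_seq|].
rewrite [X in X + _](_ : _ = 0); last exact: fmu_set1.
by rewrite add0e [leLHS]IH.
Qed.

(** Two coordinates coincide with measure zero, as points are null. *)
Lemma iterint_not_uniq (D : set E) N : measurable D ->
  iterint fmu D N (fun s => (~~ uniq s)%:R%:E) = 0.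
Proof.
move=> mD.
have mu_ : measurable_fun setT (fun s : seq E => (~~ uniq s)%:R%:E : \bar R).
  by apply: measurable_bool_indicator; apply: measurable_neg; exact: measurable_uniq.
have mm : measurable_fun setT (fun p : E * seq E => (p.1 \in p.2)%:R%:E : \bar R).
  by apply: measurable_bool_indicator; exact: measurable_mem_seq.
elim: N => [//|N IH] /=.
apply/eqP; rewrite eq_le; apply/andP; split; last first.
  by apply: integral_ge0 => x _; exact: iterint_ge0.
apply: (@le_trans _ _ (\int[fmu]_(x in D) iterint fmu D N (fun s => (x \in s)%:R%:E))); last first.
  rewrite iterint_exchange// (_ : (fun s => _) = fun=> 0) ?iterint0//.
  apply/funext => s; rewrite (eq_integral (fun x => (\1_[set` s] x)%:E)); last first.
    by move=> x _; rewrite indicE; congr (nat_of_bool _)%:R%:E; apply/idP/idP => [xs|/set_mem//]; exact/mem_set.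
  rewrite integral_indic//; last exact: measurable_set_seq.
  apply: (subset_measure0 _ _ _ (fmu_set_seq s)) => //.
  - by apply: measurableI => //; exact: measurable_set_seq.
  - exact: measurable_set_seq.
apply: ge0_le_integral => //.
- by move=> x _; exact: iterint_ge0.
- by apply: measurable_funTS; apply: measurable_iterint => //; exact: (measurable_shift mu_).
- by apply: measurable_funTS; apply: measurable_iterint.
move=> x _; rewrite -[leRHS]adde0 -IH -iterintD//; last first.
  by apply: (measurableT_comp (g := fun s : seq E => (x, s)) mm); meas.
apply: le_iterint => //.
- exact: (measurable_shift1 x mu_).
- apply: emeasurable_funD => //.
  by apply: (measurableT_comp (g := fun s : seq E => (x, s)) mm); meas.
- by move=> s; rewrite -EFinD lee_fin.
- move=> s _ _; rewrite -EFinD lee_fin negb_and negbK.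
  by case: (_ \in _); case: (uniq _); rewrite /= ?addr0 ?add0r// lerDl.
Qed.

End simple_almost_everywhere.

Section pdf_law.
Context {R : realType} (dg : nat).
Notation E := (feature R).
Local Open Scope ereal_scope.
Variable h : seq E -> \bar R.
Hypotheses (h0 : forall s, 0 <= h s) (mh : measurable_fun setT h)
  (hfin : forall s, h s \is a fin_num).
Let mW : measurable (Wdeg R dg) := @measurable_Wdeg R dg.

(** The law that the pdf prescribes, once the void probabilities are known to
    determine it. *)
Definition pdf_law (X : set (mdiagram R)) : \bar R :=
  totint fmu (Wdeg R dg) (fun s => h s * (\1_X (seq_mset s : mdiagram R))%:E).

Let mind (X : set (mdiagram R)) : measurable X ->
  measurable_fun setT (fun s : seq E => (\1_X (seq_mset s : mdiagram R))%:E : \bar R).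
Proof.
move=> mX; apply/measurable_EFinP.
have mX' : measurable_fun setT (\1_X : mdiagram R -> R) by exact: measurable_indic.
exact: (measurableT_comp mX' (@measurable_seq_mset R)).
Qed.

Lemma pdf_law0 : pdf_law set0 = 0.
Proof.
rewrite /pdf_law (_ : (fun _ => _) = fun=> 0).
  by apply: eseries0 => N _ _; exact: iterint0.
by apply/funext => s; rewrite indic0 mule0.
Qed.

Lemma pdf_law_ge0 X : 0 <= pdf_law X.
Proof. by apply: totint_ge0 => s; rewrite mule_ge0// lee_fin. Qed.

Lemma pdf_law_sigma_additive : semi_sigma_additive pdf_law.
Proof.
move=> F mF tF mUF.
rewrite (_ : pdf_law (\bigcup_n F n) = \sum_(n <oo) pdf_law (F n)).
  by apply: is_cvg_nneseries => n _ _; exact: pdf_law_ge0.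
rewrite /pdf_law -totint_nneseries//; last 2 first.
- by move=> n; apply: emeasurable_funM => //; exact: mind.
- by move=> n s; rewrite mule_ge0// lee_fin.
apply: eq_totint => s _; rewrite indic_bigcup// -(fineK (hfin s)) nneseriesZl//.
Qed.

Definition pdf_measure : {measure set (mdiagram R) -> \bar R} :=
  HB.pack pdf_law (isMeasure.Build _ _ _ pdf_law pdf_law0 pdf_law_ge0
    pdf_law_sigma_additive).

Lemma pdf_law_void A : measurable A ->
  pdf_law (void A) = \sum_(N <oo) iterint fmu (Wdeg R dg `&` A) N h.
Proof.
move=> mA; apply: eq_eseriesr => N _; rewrite (iterint_restrict fmu (Wdeg R dg) A).
apply: eq_iterint => s _ _; rewrite indicE.
have seqE : void A (seq_mset s) <-> over A s.
  by split => H x xs; apply: H; move: xs; rewrite /in_diagram /= (perm_mem (perm_eq_seq_mset s)).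
case: asboolP => [/seqE Hs|Hs]; first by rewrite mem_set// mule1.
by rewrite memNset ?mule0// => /seqE.
Qed.

Lemma pdf_law_simple : pdf_law (~` simple) = 0.
Proof.
apply: eseries0 => N _ _; apply/eqP; rewrite eq_le; apply/andP; split; last first.
  by apply: iterint_ge0 => s; rewrite mule_ge0// lee_fin.
have mu_ : measurable_fun setT (fun s : seq E => (~~ uniq s)%:R%:E : \bar R).
  by apply: measurable_bool_indicator; apply: measurable_neg; exact: measurable_uniq.
rewrite [leRHS](_ : _ = iterint fmu (Wdeg R dg) N (fun s => +oo * (~~ uniq s)%:R%:E)).
  apply: le_iterint => //.
  - apply: emeasurable_funM => //; apply: mind; apply: measurableC.
    exact: measurable_simple.
  - exact: measurable_funeM.
  - by move=> s; rewrite mule_ge0// lee_fin.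
  - move=> s _ _; rewrite indicE.
    have -> : ((seq_mset s : mdiagram R) \in ~` simple) = ~~ uniq s.
      rewrite in_setC; congr negb; rewrite -(perm_uniq (perm_eq_seq_mset s)).
      by apply/idP/idP => [/set_mem|/mem_set].
    by case: (uniq s); rewrite /= ?mule0// !mule1 leey.
rewrite iterintZ//.
by rewrite iterint_not_uniq// mule0.
Qed.

(** A nonnegative number is approximated from below, within e, by counting the
    multiples of e that it exceeds; this writes any expectation as a countable
    sum of probabilities up to e. *)
Lemma level_sum (x e : R) : (0 <= x)%R -> (0 < e)%R ->
  \sum_(k <oo) e%:E * ((k.+1%:R * e <= x)%R)%:R%:E <= x%:E /\
  x%:E <= \sum_(k <oo) e%:E * ((k.+1%:R * e <= x)%R)%:R%:E + e%:E.
Proof.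
move=> x0 e0; set n := Num.truncn (x / e).
have xe0 : (0 <= x / e)%R by rewrite divr_ge0// ltW.
have kn k : (k.+1%:R * e <= x)%R = (k < n)%N.
  by rewrite -ler_pdivlMr// /n truncn_gt_nat.
rewrite (@eseries_fin _ _ n); last 2 first.
- by move=> k; rewrite mule_ge0// lee_fin// ltW.
- by move=> k nk; rewrite kn ltnNge nk mule0.
rewrite (eq_bigr (fun=> e%:E)); last by move=> k _; rewrite kn ltn_ord mule1.
rewrite sumEFin sumr_const card_ord -EFinD !lee_fin.
have /andP[H1 H2] := truncn_itv xe0.
rewrite -mulr_natl; split.
  by rewrite -ler_pdivlMr.
by rewrite -[X in (_ + X)%R]mul1r -mulrDl natr1 -ler_pdivrMr// ltW.
Qed.

End pdf_law.

Section law_of_global_pdf.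
Context {R : realType} (dg : nat).
Notation E := (feature R).
Context {dT : measure_display} {T : measurableType dT} (P : probability T R).
Variables (D : {RV P >-> mdiagram R}) (f : seq E -> R).
Hypothesis f_pdf : has_global_pdf dg D f.
Local Open Scope ereal_scope.

Let h := on_W dg f.

Lemma pdf_ge0 s : 0 <= h s.
Proof. by case: f_pdf => _ _ f0 _ _; apply: on_W_ge0. Qed.

Lemma pdf_fin s : h s \is a fin_num.
Proof. by rewrite /h /on_W; case: ifP. Qed.

Lemma measurable_pdf : measurable_fun setT h.
Proof.
case: f_pdf => _ _ _ mf _; apply: measurable_fun_seq1P => N.
have mWN : measurable [set t : N.-tuple E | over (Wdeg R dg) (tval t)].
  by apply: (measurable_over (@measurable_Wdeg R dg)).
have /(measurable_restrictT _ mWN) : measurable_fun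
    [set t : N.-tuple E | over (Wdeg R dg) (tval t)] (fun t => (f (tval t))%:E).
  by apply/measurable_EFinP; exact: mf.
apply: eq_measurable_fun => t _; rewrite /h /on_W patchE.
by case: asboolP => [Wt|Wt]; [rewrite mem_set|rewrite memNset].
Qed.

(** Both laws give the same void probabilities and do not charge the diagrams with
    repeated features. *)
Lemma law_of_global_pdf (X : set (mdiagram R)) : measurable X ->
  P (D @^-1` X) = pdf_law dg h X.
Proof.
move=> mX; case: f_pdf => WD uD f0 mf vD.
have hint N (A : set E) : measurable A ->
    int_features dg A N (fun s => (f s)%:E) = iterint fmu (Wdeg R dg `&` A) N h.
  move=> mA; rewrite -int_featuresE//; [|exact: measurable_pdf|exact: pdf_ge0].
  apply: eq_int_features => s Ws _; rewrite /h /on_W asboolT//.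
  by move=> x /Ws[].
pose m1 : {measure set (mdiagram R) -> \bar R} := distribution P D.
pose m2 := pdf_measure dg pdf_ge0 measurable_pdf pdf_fin.
apply: (void_probabilities_determine (m1 := m1) (m2 := m2)) => //.
- by rewrite [m1 _]probability_setT ltry.
- move=> A mA; rewrite /m1 /m2 /= pdf_law_void//.
  rewrite -(eq_eseriesr (fun N _ => hint N A mA)) -vD//.
- case: uD => U [mU U0 HU].
  apply: (subset_measure0 _ _ _ U0) => //.
  rewrite -[X in measurable X]setTI; apply: measurable_funPT => //.
  by apply: measurableC; exact: (@measurable_simple R).
- by apply: pdf_law_simple; [exact: pdf_ge0|exact: measurable_pdf].
Qed.

(** From probabilities to expectations through level sets; the error e is
    uniform and both sides have total mass one. *)
Lemma expectation_of_global_pdf (Phi : mdiagram R -> \bar R) :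
  measurable_fun setT Phi -> (forall Z, 0 <= Phi Z) -> (forall Z, Phi Z < +oo) ->
  \int[P]_w Phi (D w) =
  totint fmu (Wdeg R dg) (fun s => h s * Phi (seq_mset s : mdiagram R)).
Proof.
move=> mPhi Phi0 Phioo.
have Phif Z : (fine (Phi Z))%:E = Phi Z by rewrite fineK// ge0_fin_numE.
pose lev (e : R) k := [set Z : mdiagram R | (k.+1%:R * e <= fine (Phi Z))%R].
have mlev e k : measurable (lev e k).
  rewrite (_ : lev e k = Phi @^-1` [set x | (k.+1%:R * e)%:E <= x]).
    rewrite -[X in measurable X]setTI; apply: mPhi => //.
    by rewrite -set_itvcy; exact: emeasurable_itv.
  by apply/seteqP; split => Z; rewrite /lev /= -lee_fin Phif.
pose S e Z : \bar R := \sum_(k <oo) e%:E * (\1_(lev e k) Z)%:E.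
have ind e k Z : \1_(lev e k) Z = ((k.+1%:R * e <= fine (Phi Z))%R)%:R :> R.
  by rewrite indicE; congr (nat_of_bool _)%:R; apply/idP/idP => [/set_mem|/mem_set].
have Sb e Z : (0 < e)%R -> S e Z <= Phi Z /\ Phi Z <= S e Z + e%:E.
  move=> e0; have := level_sum (fine_ge0 (Phi0 Z)) e0; rewrite Phif.
  suff -> : S e Z = \sum_(k <oo) e%:E * ((k.+1%:R * e <= fine (Phi Z))%R)%:R%:E by [].
  by apply: eq_eseriesr => k _; rewrite ind.
have S0 e Z : (0 < e)%R -> 0 <= S e Z.
  by move=> e0; apply: nneseries_ge0 => k _ _; rewrite mule_ge0// lee_fin// ltW.
have m1 e k : measurable_fun setT (fun Z : mdiagram R => (\1_(lev e k) Z)%:E : \bar R).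
  by apply/measurable_EFinP; exact: measurable_indic.
have mI e k : measurable_fun setT (fun Z : mdiagram R => e%:E * (\1_(lev e k) Z)%:E).
  by apply: measurable_funeM; apply/measurable_EFinP; exact: measurable_indic.
have mS e : (0 < e)%R -> measurable_fun setT (S e).
  move=> e0; apply: ge0_emeasurable_sum => // k Z _ _.
  by rewrite mule_ge0// lee_fin// ltW.
have mD : measurable_fun setT D by exact: measurable_funPT.
have mW := @measurable_Wdeg R dg.
have msm := @measurable_seq_mset R.
have mh := measurable_pdf.
have key e : (0 < e)%R -> \int[P]_w S e (D w) =
    totint fmu (Wdeg R dg) (fun s => h s * S e (seq_mset s : mdiagram R)).
  move=> e0; rewrite /S integral_nneseries//; last 2 first.
  - by move=> k; apply: (measurableT_comp (mI e k) mD).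
  - by move=> k w _; rewrite mule_ge0// lee_fin// ltW.
  transitivity (\sum_(k <oo) totint fmu (Wdeg R dg)
      (fun s => e%:E * (h s * (\1_(lev e k) (seq_mset s : mdiagram R))%:E))).
    apply: eq_eseriesr => k _; rewrite ge0_integralZl//; last 2 first.
    - exact: (measurableT_comp (m1 e k) mD).
    - by rewrite lee_fin ltW.
    rewrite totintZ//; last 3 first.
    - by apply: emeasurable_funM => //; exact: (measurableT_comp (m1 e k) msm).
    - by move=> s; rewrite mule_ge0// ?pdf_ge0// lee_fin.
    - exact: ltW.
    congr (_ * _).
    transitivity (P (D @^-1` lev e k)); last exact: law_of_global_pdf.
    rewrite -[X in P X]setIT -integral_indic//.
    by rewrite -[X in measurable X]setTI; exact: mD.
  rewrite -totint_nneseries//; last 2 first.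
  - move=> k; apply: measurable_funeM; apply: emeasurable_funM => //.
    exact: (measurableT_comp (m1 e k) msm).
  - by move=> k s; apply: mule_ge0; [by rewrite lee_fin ltW|apply: mule_ge0; [exact: pdf_ge0|by rewrite lee_fin]].
  apply: eq_totint => s _; rewrite -(fineK (pdf_fin s)) -nneseriesZl; last first.
    by move=> k _; rewrite mule_ge0// lee_fin// ltW.
  by apply: eq_eseriesr => k _; rewrite muleCA.
have mhPhi : measurable_fun setT (fun s => h s * Phi (seq_mset s : mdiagram R)).
  by apply: emeasurable_funM => //; apply: (measurableT_comp mPhi msm).
have mhS e : (0 < e)%R -> measurable_fun setT (fun s => h s * S e (seq_mset s : mdiagram R)).
  by move=> e0; apply: emeasurable_funM => //; apply: (measurableT_comp (mS e e0) msm).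
have hS0 e s : (0 < e)%R -> 0 <= h s * S e (seq_mset s : mdiagram R).
  by move=> e0; rewrite mule_ge0 ?pdf_ge0// S0.
have tot1 : totint fmu (Wdeg R dg) h = 1.
  have := law_of_global_pdf measurableT; rewrite preimage_setT probability_setT => ->.
  by apply: eq_totint => s _; rewrite indicT mule1.
apply/eqP; rewrite eq_le; apply/andP; split; apply/lee_addgt0Pr => e e0.
  apply: (@le_trans _ _ (\int[P]_w (S e (D w) + e%:E))).
    apply: ge0_le_integral => //.
    - exact: (measurableT_comp mPhi mD).
    - by apply: emeasurable_funD => //; apply: (measurableT_comp (mS e e0) mD).
    - by move=> w _; case: (Sb e (D w) e0).
  rewrite ge0_integralD//; last 3 first.
  - by move=> w _; exact: S0.
  - exact: (measurableT_comp (mS e e0) mD).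
  - by move=> w _; rewrite lee_fin ltW.
  rewrite [X in _ + X]integral_cst// [X in _ * X]probability_setT mule1 key//; apply: leeD2r.
  apply: le_totint => //.
  - exact: mhS.
  - by move=> s; exact: hS0.
  - by move=> s; rewrite mule_ge0// pdf_ge0.
  - by move=> s _; apply: lee_wpmul2l; [exact: pdf_ge0|case: (Sb e (seq_mset s) e0)].
apply: (@le_trans _ _ (totint fmu (Wdeg R dg)
    (fun s => h s * S e (seq_mset s : mdiagram R) + e%:E * h s))).
  apply: le_totint => //.
  - by apply: emeasurable_funD; [exact: mhS|exact: measurable_funeM].
  - by move=> s; rewrite mule_ge0// pdf_ge0.
  - by move=> s; apply: adde_ge0; [exact: hS0|apply: mule_ge0; [by rewrite lee_fin ltW|exact: pdf_ge0]].
  - move=> s _; rewrite [X in _ + X]muleC -ge0_muleDr; last 2 first.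
    + exact: S0.
    + by rewrite lee_fin ltW.
    by apply: lee_wpmul2l; [exact: pdf_ge0|case: (Sb e (seq_mset s) e0)].
rewrite totintD//; last 4 first.
- exact: mhS.
- exact: measurable_funeM.
- by move=> s; exact: hS0.
- by move=> s; apply: mule_ge0; [by rewrite lee_fin ltW|exact: pdf_ge0].
rewrite totintZ//; last 2 first.
- exact: pdf_ge0.
- exact: ltW.
rewrite tot1 mule1 -key//; apply: leeD2r.
apply: ge0_le_integral => //.
- by move=> w _; exact: S0.
- exact: (measurableT_comp (mS e e0) mD).
- exact: (measurableT_comp mPhi mD).
- by move=> w _; case: (Sb e (D w) e0).
Qed.

End law_of_global_pdf.

(** * A recursion for the single-degree kernel *)

Section increasing_injections.
Context {R : realType} {X : Type} (x0 : X).

(** The increasing injections encode the choice of the j upper centers that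
    produce the first j points. *)
Definition injsum n (q : 'I_n -> R) (p : 'I_n -> X -> R) (j : nat) (xi : seq X) : R :=
  \sum_(g in increasing_inj j n)
    ((\prod_(i < n) (1 - q i)) / (\prod_(k < j) (1 - q (g k))) *
     \prod_(k < j) q (g k)) *
    \prod_(k < j) p (g k) (nth x0 xi k).

Lemma increasing_injP j n (g : {ffun 'I_j -> 'I_n}) :
  reflect (forall a b : 'I_j, (a < b)%N -> (g a < g b)%N) (g \in increasing_inj j n).
Proof.
rewrite inE; apply: (iffP forallP) => [H a b|H a].
  by have /forallP/(_ b)/implyP := H a.
by apply/forallP => b; apply/implyP; exact: H.
Qed.

Lemma injsum0 n (q : 'I_n -> R) p xi : injsum q p 0 xi = \prod_(i < n) (1 - q i).
Proof.
pose g0 : {ffun 'I_0 -> 'I_n} := ffun0 (card_ord 0).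
rewrite /injsum (big_pred1 g0).
  by rewrite !big_ord0 divr1 !mulr1.
move=> g; rewrite [LHS](_ : _ = true); last by apply/increasing_injP => -[].
by apply/esym/eqP/ffunP => -[].
Qed.

Lemma injsum_gt n (q : 'I_n -> R) p j xi : (n < j)%N -> injsum q p j xi = 0.
Proof.
move=> nj; apply: big1 => g /increasing_injP ginc; exfalso.
have ginj : injective g.
  move=> a b gab; apply/val_inj; case: (ltngtP a b) => // /ginc.
    by rewrite gab ltnn.
  by rewrite gab ltnn.
by have := leq_card g ginj; rewrite !card_ord leqNgt nj.
Qed.

Definition incr_skip j n (g : {ffun 'I_j -> 'I_n}) : {ffun 'I_j -> 'I_n.+1} :=
  [ffun k => lift ord0 (g k)].

Definition incr_cons j n (g : {ffun 'I_j -> 'I_n}) : {ffun 'I_j.+1 -> 'I_n.+1} :=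
  [ffun k => if unlift ord0 k is Some k' then lift ord0 (g k') else ord0].

Lemma incr_skip_inj j n : injective (@incr_skip j n).
Proof.
move=> g g' /ffunP gg'; apply/ffunP => k; have := gg' k.
by rewrite !ffunE => /lift_inj.
Qed.

Lemma incr_cons_inj j n : injective (@incr_cons j n).
Proof.
move=> g g' /ffunP gg'; apply/ffunP => k; have := gg' (lift ord0 k).
by rewrite !ffunE liftK => /lift_inj.
Qed.

(** An increasing injection of a nonempty set either starts with the first center,
    or avoids it.  The quotient of products loses the factor 1 - q of a selected
    center, which is why this factor has to be nonzero. *)
Lemma injsumS n (q : 'I_n.+1 -> R) (p : 'I_n.+1 -> X -> R) j x xi :
  (forall i, 1 - q i != 0) ->
  injsum q p j.+1 (x :: xi) =
  q ord0 * p ord0 x * injsum (q \o lift ord0) (p \o lift ord0) j xi +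
  (1 - q ord0) * injsum (q \o lift ord0) (p \o lift ord0) j.+1 (x :: xi).
Proof.
move=> q1; rewrite /injsum (bigID (fun g : {ffun 'I_j.+1 -> 'I_n.+1} => g ord0 == ord0)) /=.
congr (_ + _).
  rewrite (eq_bigl (mem (imset (@incr_cons j n) (mem (increasing_inj j n))))); last first.
    move=> g; apply/andP/imsetP => [[/increasing_injP ginc /eqP g0]|[h /increasing_injP hinc ->]].
      have gpos (k : 'I_j) : exists i, g (lift ord0 k) = lift ord0 i.
        have : ord0 != g (lift ord0 k).
          have := ginc ord0 (lift ord0 k) isT; rewrite g0.
          by apply: contraTneq => <-; rewrite ltnn.
        by move=> /unlift_some[i -> _]; exists i.
      have [h hE] := fin_all_exists gpos.
      exists [ffun k => h k].
        apply/increasing_injP => a b ab; rewrite !ffunE.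
        have := ginc (lift ord0 a) (lift ord0 b); rewrite !hE /= /bump /= !add1n !ltnS.
        exact.
      apply/ffunP => k; rewrite ffunE; case: unliftP => [k' ->|->//].
      by rewrite ffunE hE.
    split; last by rewrite ffunE unlift_none.
    apply/increasing_injP => a b; rewrite !ffunE.
    case: unliftP => [a' ->|->]; case: unliftP => [b' ->|->] //=.
    rewrite /bump /= !add1n !ltnS; exact: hinc.
  rewrite big_imset /=; last by move=> ? ? _ _; exact: incr_cons_inj.
  rewrite mulr_sumr; apply: eq_bigr => g _.
  have cE k : incr_cons g (lift ord0 k) = lift ord0 (g k) by rewrite ffunE liftK.
  have c0 : incr_cons g ord0 = ord0 by rewrite ffunE unlift_none.
  rewrite !big_ord_recl /= !c0.
  rewrite [X in _ / (_ * X)](eq_bigr (fun i => 1 - q (lift ord0 (g i)))); last by move=> k _; rewrite cE.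
  rewrite [X in _ * (_ * X) * _](eq_bigr (fun i => q (lift ord0 (g i)))); last by move=> k _; rewrite cE.
  rewrite [X in _ * (_ * X) = _](eq_bigr (fun i => p (lift ord0 (g i)) (nth x0 xi i))); last first.
    by move=> i _; rewrite cE.
  set A := \prod_(i < n) _; set B := \prod_(k < j) (1 - _).
  set C := \prod_(k < j) q _; set F := \prod_(i < j) p _ _.
  have -> : (1 - q ord0) * A / ((1 - q ord0) * B) = A / B.
    by rewrite invfM mulrACA divff// mul1r.
  lra.
rewrite (eq_bigl (mem (imset (@incr_skip j.+1 n) (mem (increasing_inj j.+1 n))))); last first.
  move=> g; apply/andP/imsetP => [[/increasing_injP ginc g0]|[h /increasing_injP hinc ->]].
    have gpos (k : 'I_j.+1) : exists i, g k = lift ord0 i.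
      have : ord0 != g k.
        have [->|k0] := eqVneq k ord0; first by rewrite eq_sym.
        have := ginc ord0 k; rewrite lt0n => /(_ k0).
        by apply: contraTneq => <-; rewrite ltn0.
      by move=> /unlift_some[i -> _]; exists i.
    have [h hE] := fin_all_exists gpos.
    exists [ffun k => h k].
      apply/increasing_injP => a b ab; rewrite !ffunE.
      have := ginc a b ab; rewrite !hE /= /bump /= !add1n !ltnS; exact.
    by apply/ffunP => k; rewrite !ffunE hE.
  split; last by rewrite ffunE eq_sym neq_lift.
  by apply/increasing_injP => a b ab; rewrite !ffunE /= /bump /= !add1n !ltnS; exact: hinc.
rewrite big_imset /=; last by move=> ? ? _ _; exact: incr_skip_inj.
rewrite mulr_sumr; apply: eq_bigr => g _.
have cE k : incr_skip g k = lift ord0 (g k) by rewrite ffunE.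
rewrite [X in X / _]big_ord_recl.
rewrite (eq_bigr (fun k => 1 - q (lift ord0 (g k)))); last by move=> k _; rewrite cE.
rewrite [X in _ * X * _](eq_bigr (fun k => q (lift ord0 (g k)))); last by move=> k _; rewrite cE.
rewrite [X in _ * X](eq_bigr (fun k => p (lift ord0 (g k)) (nth x0 (x :: xi) k))); last by move=> k _; rewrite cE.
by rewrite /= !mulrA.
Qed.

Definition ksum n (q : 'I_n -> R) (p : 'I_n -> X -> R) (b : seq X -> R) (xi : seq X) : R :=
  \sum_(j < n.+1 | (j <= size xi)%N) b (drop j xi) * injsum q p j xi.

Lemma ksum0 (q : 'I_0 -> R) p b xi : ksum q p b xi = b xi.
Proof.
rewrite /ksum (big_pred1 ord0) ?drop0 ?injsum0 ?big_ord0 ?mulr1//.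
by move=> i; rewrite ord1 /= eqxx leq0n.
Qed.

Lemma ksumS n (q : 'I_n.+1 -> R) (p : 'I_n.+1 -> X -> R) b xi :
  (forall i, 1 - q i != 0) ->
  ksum q p b xi =
  (1 - q ord0) * ksum (q \o lift ord0) (p \o lift ord0) b xi +
  (if xi is x :: xi' then
     q ord0 * p ord0 x * ksum (q \o lift ord0) (p \o lift ord0) b xi' else 0).
Proof.
move=> q1; rewrite /ksum [LHS]big_mkcond [LHS]big_ord_recl leq0n injsum0 drop0.
rewrite [X in b xi * X]big_ord_recl.
have -> : b xi * ((1 - q ord0) * \prod_(i < n) (1 - q (lift ord0 i))) =
    (1 - q ord0) * (b xi * injsum (q \o lift ord0) (p \o lift ord0) 0 xi).
  by rewrite injsum0 /=; lra.
case: xi => [|x xi].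
  rewrite big1 ?addr0; last by move=> i _.
  rewrite [in RHS]big_mkcond big_ord_recl /= big1 ?addr0//.
rewrite [X in _ = (1 - q ord0) * X + _]big_mkcond.
rewrite [X in _ = (1 - q ord0) * X + _]big_ord_recl leq0n drop0.
rewrite mulrDr -addrA; congr (_ + _).
rewrite (eq_bigr (fun i : 'I_n.+1 =>
  (1 - q ord0) * (if (i < size (x :: xi))%N then b (drop i xi) *
     injsum (q \o lift ord0) (p \o lift ord0) i.+1 (x :: xi) else 0) +
  q ord0 * p ord0 x * (if (i <= size xi)%N then b (drop i xi) *
     injsum (q \o lift ord0) (p \o lift ord0) i xi else 0))); last first.
  move=> i _; rewrite lift0 /= ltnS; case: ifP => _; last by rewrite !mulr0 addr0.
  by rewrite injsumS//; lra.
rewrite big_split /= -!mulr_sumr -[X in _ + _ * X]big_mkcond; congr (_ * _ + _).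
rewrite big_ord_recr /= injsum_gt// mulr0 if_same addr0.
by apply: eq_bigr => i _.
Qed.

End increasing_injections.

Lemma prod_drop {R : realType} {X : Type} (x0 : X) (F : X -> R) j (xi : seq X) :
  \prod_(j <= k < size xi) F (nth x0 xi k) = \prod_(x <- drop j xi) F x.
Proof.
rewrite (big_nth x0) size_drop -{1}(add0n j) big_addn.
by apply: eq_bigr => i _; rewrite nth_drop addnC.
Qed.

(** Going through the upper centers in order, each is dropped, with weight
    1 - q c, or produces the next point, with weight q c and density p c; the
    points left over are handled by b. *)
Fixpoint kern {R : realType} {X : Type} (q : X -> R) (p : X -> X -> R) (Du : seq X)
    (b : seq X -> R) (xi : seq X) : R :=
  if Du is c :: Du' then
    (1 - q c) * kern q p Du' b xi +
    (if xi is x :: xi' then q c * p c x * kern q p Du' b xi' else 0)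
  else b xi.

Definition lower_block {R : realType} {X : Type} (nu : nat -> nat -> R)
    (pl : seq X -> X -> R) (Dl t : seq X) : R :=
  nu (size Dl) (size t) * \prod_(x <- t) pl Dl x.

Lemma kern_ksum {R : realType} {X : eqType} (x0 : X) (q : X -> R) p (Du : seq X) b xi :
  (forall c, c \in Du -> 1 - q c != 0) ->
  kern q p Du b xi = ksum x0 (fun i => q (tnth (in_tuple Du) i))
    (fun i => p (tnth (in_tuple Du) i)) b xi.
Proof.
elim: Du xi => [|c Du IH] xi q1 /=; first by rewrite ksum0.
rewrite ksumS; last by move=> i; apply: q1; exact: mem_tnth.
have tl i : tnth (in_tuple (c :: Du)) (lift ord0 i) = tnth (in_tuple Du) i.
  by rewrite !(tnth_nth c).
have q1' c' : c' \in Du -> 1 - q c' != 0.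
  by move=> cDu; apply: q1; rewrite inE cDu orbT.
have qE : (fun i => q (tnth (in_tuple (c :: Du)) i)) \o lift ord0 =
    fun i => q (tnth (in_tuple Du) i).
  by apply/funext => i /=; rewrite tl.
have pE : (fun i => p (tnth (in_tuple (c :: Du)) i)) \o lift ord0 =
    fun i => p (tnth (in_tuple Du) i).
  by apply/funext => i /=; rewrite tl.
rewrite qE pE -(IH _ q1'); congr (_ + _).
by case: xi => [//|x xi]; rewrite -(IH _ q1').
Qed.

(** Because of the increasing injections the kernel depends on the order of its
    points and of its centers; reading both lists from the head gives the form in
    which it can be integrated. *)
Lemma kernel1E {R : realType} (nu : nat -> nat -> R) (sigma : R) xi D :
  (forall c, c \in upper sigma D -> 1 - q_upper sigma c != 0) ->
  kernel1 nu sigma xi D = kern (q_upper sigma) (p_upper sigma) (upper sigma D)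
    (lower_block nu (p_lower sigma) (lower sigma D)) xi.
Proof.
move=> q1; rewrite (kern_ksum (0, 0))// /kernel1 /ksum; apply: eq_bigr => j jxi.
rewrite /lower_block size_drop -mulrA; congr (_ * _).
rewrite /injsum mulr_sumr; apply: eq_bigr => g _.
rewrite [LHS]mulrC; congr (_ * _); exact: prod_drop.
Qed.

(** * Integration operators of the kernel *)

Lemma measurable_nth0 {d} {E : measurableType d} (x0 : E) :
  measurable_fun setT (fun s : seq E => nth x0 s 0).
Proof.
apply: measurable_fun_seq1P => -[|n].
  rewrite (_ : (fun _ => _) = cst x0); first exact: measurable_cst.
  by apply/funext => t; rewrite tuple0.
rewrite (_ : (fun _ => _) = (fun t : n.+1.-tuple E => tnth t ord0)); first exact: measurable_tnth.
by apply/funext => t; rewrite (tnth_nth x0).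
Qed.

Section operators.
Context {R : realType}.
Notation E := (feature R).
Notation PT := (measurableTypeR R * measurableTypeR R)%type.
Variables (q : PT -> R) (p : PT -> PT -> R) (pl : seq PT -> PT -> R) (nu : nat -> nat -> R).
Hypotheses (mq : measurable_fun setT q)
  (mp : measurable_fun setT (fun r : PT * PT => p r.1 r.2))
  (mpl : measurable_fun setT (fun r : seq PT * PT => pl r.1 r.2))
  (q0 : forall c, 0 <= q c) (q1 : forall c, q c <= 1)
  (p0 : forall c y, 0 <= p c y) (pl0 : forall D y, 0 <= pl D y)
  (nu0 : forall L n, 0 <= nu L n).
Local Open Scope ereal_scope.

Definition Wk (k : nat) : set E := [set x | W R x.1 /\ x.2 = k].

Lemma measurable_Wk k : measurable (Wk k).
Proof.
rewrite (_ : Wk k = W R `*` [set k])//.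
by apply: measurableX => //; exact: measurable_W.
Qed.
Let mWk := measurable_Wk.

(** Integration over the fate of the upper center c. *)
Definition upop k (c : PT) (G : seq E -> \bar R) (t : seq E) : \bar R :=
  (1 - q c)%:E * G t +
  (q c)%:E * \int[fmu]_(x in Wk k) ((p c x.1)%:E * G (x :: t)).

Definition push k (Dl : seq PT) (G : seq E -> \bar R) (t : seq E) : \bar R :=
  \int[fmu]_(x in Wk k) ((pl Dl x.1)%:E * G (x :: t)).

(** Integration over the number and the positions of the lower features. *)
Definition lowop k (Dl : seq PT) (G : seq E -> \bar R) (t : seq E) : \bar R :=
  \sum_(n <oo) (nu (size Dl) n)%:E * iter n (push k Dl) G t.

Definition upops k (Du : seq PT) (G : seq E -> \bar R) : seq E -> \bar R :=
  foldr (upop k) G Du.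

Lemma upopE k c G t : upop k c G t = (1 - q c)%:E * G t +
  (q c)%:E * \int[fmu]_(x in Wk k) ((p c x.1)%:E * G (x :: t)).
Proof. by []. Qed.

Lemma lowopE k Dl G t : lowop k Dl G t =
  \sum_(n <oo) (nu (size Dl) n)%:E * iter n (push k Dl) G t.
Proof. by []. Qed.

Let q1' c : 0 <= (1 - q c)%:E. Proof. by rewrite lee_fin subr_ge0. Qed.
Let q0' c : 0 <= (q c)%:E. Proof. by rewrite lee_fin. Qed.

Lemma upop_ge0 k c G t : (forall s, 0 <= G s) -> 0 <= upop k c G t.
Proof.
move=> G0; apply: adde_ge0; apply: mule_ge0 => //.
by apply: integral_ge0 => x _; rewrite mule_ge0// lee_fin.
Qed.

Lemma push_ge0 k Dl G t : (forall s, 0 <= G s) -> 0 <= push k Dl G t.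
Proof. by move=> G0; apply: integral_ge0 => x _; rewrite mule_ge0// lee_fin. Qed.

Lemma iter_push_ge0 k Dl G n t : (forall s, 0 <= G s) -> 0 <= iter n (push k Dl) G t.
Proof. by elim: n t => //= n IH t G0; apply: push_ge0 => s; exact: IH. Qed.

Lemma lowop_ge0 k Dl G t : (forall s, 0 <= G s) -> 0 <= lowop k Dl G t.
Proof.
by move=> G0; apply: nneseries_ge0 => n _ _; rewrite mule_ge0 ?lee_fin ?iter_push_ge0.
Qed.

Lemma upops_ge0 k Du G t : (forall s, 0 <= G s) -> 0 <= upops k Du G t.
Proof. by elim: Du t => //= c Du IH t G0; apply: upop_ge0 => s; exact: IH. Qed.

Section parameter.
Context {d} {Y : measurableType d}.

Lemma measurable_push k (Dl : Y -> seq PT) (G : Y -> seq E -> \bar R) :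
  measurable_fun setT Dl ->
  measurable_fun setT (fun r : Y * seq E => G r.1 r.2) -> (forall y s, 0 <= G y s) ->
  measurable_fun setT (fun r : Y * seq E => push k (Dl r.1) (G r.1) r.2).
Proof.
move=> mDl mG G0.
apply: (@measurable_param_int _ _ _ fmu _ (Y * seq E)%type (Wk k) (fun (r : Y * seq E) x => (pl (Dl r.1) x.1)%:E * G r.1 (x :: r.2))) => //.
  apply: emeasurable_funM.
    apply/measurable_EFinP.
    apply: (measurableT_comp (g := fun r : Y * seq E * E => (Dl r.1.1, r.2.1)) mpl).
    by apply/measurable_fun_pair; apply: measurableT_comp => //; apply: measurableT_comp.
  by apply: (measurableT_comp (g := fun r : Y * seq E * E => (r.1.1, r.2 :: r.1.2)) mG); meas.
by move=> y x; rewrite mule_ge0// lee_fin.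
Qed.

Lemma measurable_iter_push k (Dl : Y -> seq PT) (G : Y -> seq E -> \bar R) n :
  measurable_fun setT Dl ->
  measurable_fun setT (fun r : Y * seq E => G r.1 r.2) -> (forall y s, 0 <= G y s) ->
  measurable_fun setT (fun r : Y * seq E => iter n (push k (Dl r.1)) (G r.1) r.2).
Proof.
move=> mDl mG G0; elim: n => [//|n IH] /=.
apply: (@measurable_push k Dl (fun y => iter n (push k (Dl y)) (G y))) => //.
by move=> y s; exact: iter_push_ge0.
Qed.

Lemma measurable_lowop k (Dl : Y -> seq PT) (G : Y -> seq E -> \bar R) :
  measurable_fun setT Dl ->
  measurable_fun setT (fun r : Y * seq E => G r.1 r.2) -> (forall y s, 0 <= G y s) ->
  measurable_fun setT (fun r : Y * seq E => lowop k (Dl r.1) (G r.1) r.2).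
Proof.
move=> mDl mG G0; apply: ge0_emeasurable_sum => [n r _ _|n _].
  by rewrite mule_ge0 ?lee_fin ?iter_push_ge0.
apply: emeasurable_funM; last exact: measurable_iter_push.
apply: (measurable_natfun (h := fun r : Y * seq E => size (Dl r.1)) (fun L => (nu L n)%:E)).
apply: (measurableT_comp measurable_size).
exact: measurableT_comp.
Qed.

(** Joint measurability in the centers is needed because they will be random. *)
Lemma measurable_upops k (Du : Y -> seq PT) (G : Y -> seq E -> \bar R) :
  measurable_fun setT Du ->
  measurable_fun setT (fun r : Y * seq E => G r.1 r.2) -> (forall y s, 0 <= G y s) ->
  measurable_fun setT (fun r : Y * seq E => upops k (Du r.1) (G r.1) r.2).
Proof.
move=> mDu mG G0.
suff H : measurable_fun setT (fun r : (Y * seq E) * seq PT => upops k r.2 (G r.1.1) r.1.2).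
  apply: (measurableT_comp (g := fun r : Y * seq E => (r, Du r.1)) H).
  by apply/measurable_fun_pair => //; apply: measurableT_comp.
apply: measurable_fun_seqP; elim => [|n IH].
  rewrite (_ : (fun _ => _) = fun r : (Y * seq E) * 0.-tuple PT => G r.1.1 r.1.2).
    by apply: (measurableT_comp (g := fun r : Y * seq E * 0.-tuple PT => (r.1.1, r.1.2)) mG); meas.
  by apply/funext => -[r t]; rewrite tuple0.
rewrite (_ : (fun _ => _) = fun r : (Y * seq E) * n.+1.-tuple PT =>
   upop k (thead r.2) (upops k (behead (tval r.2)) (G r.1.1)) r.1.2); last first.
  by apply/funext => -[r t]; rewrite /= {1}(tuple_eta t).
have := @measurable_fun_tupleS _ _ _ _ _ _ n
  (fun r : (Y * seq E) * PT * seq PT => upop k r.1.2 (upops k r.2 (G r.1.1.1)) r.1.1.2).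
apply => /=.
have mqq : measurable_fun setT (fun r : (Y * seq E) * PT * n.-tuple PT => q r.1.2).
  by apply: (measurableT_comp mq); meas.
apply: emeasurable_funD; apply: emeasurable_funM.
- by apply/measurable_EFinP; apply: measurable_funB.
- apply: (measurableT_comp (g := fun r : (Y * seq E) * PT * n.-tuple PT => (r.1.1, r.2)) IH).
  by meas.
- exact/measurable_EFinP.
apply: (@measurable_param_int _ _ _ fmu _ ((Y * seq E) * PT * n.-tuple PT)%type (Wk k) (fun (r : (Y * seq E) * PT * n.-tuple PT) x =>
   (p r.1.2 x.1)%:E * upops k r.2 (G r.1.1.1) (x :: r.1.1.2))) => //.
  apply: emeasurable_funM.
    apply/measurable_EFinP.
    apply: (measurableT_comp (g := fun r : (Y * seq E) * PT * n.-tuple PT * E => (r.1.1.2, r.2.1)) mp).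
    by meas.
  apply: (measurableT_comp (g := fun r : (Y * seq E) * PT * n.-tuple PT * E =>
     ((r.1.1.1.1, r.2 :: r.1.1.1.2), r.1.2)) IH).
  have m1 : measurable_fun setT (fun r : (Y * seq E) * PT * n.-tuple PT * E => r.1.1.1).
    by do 2 apply: measurableT_comp => //.
  apply/measurable_fun_pair; last by apply: measurableT_comp.
  apply/measurable_fun_pair; first exact: (measurableT_comp measurable_fst m1).
  by apply: measurable_fun_cons => //; exact: (measurableT_comp measurable_snd m1).
by move=> y x; rewrite mule_ge0 ?lee_fin ?upops_ge0.
Qed.
End parameter.

End operators.

(** * Algebra of the integration operators *)

Lemma symmetric_middle {U : Type} {E : eqType} (F : seq E -> U) x s t :
  symmetric_fun F -> F (s ++ x :: t) = F (x :: s ++ t).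
Proof.
by move=> Fs; apply: Fs; rewrite -cat_rcons -cat_cons perm_cat2r perm_rcons.
Qed.

Section operator_algebra.
Context {R : realType}.
Notation E := (feature R).
Notation PT := (measurableTypeR R * measurableTypeR R)%type.
Variables (q : PT -> R) (p : PT -> PT -> R) (pl : seq PT -> PT -> R) (nu : nat -> nat -> R).
Hypotheses (mq : measurable_fun setT q)
  (mp : measurable_fun setT (fun r : PT * PT => p r.1 r.2))
  (mpl : measurable_fun setT (fun r : seq PT * PT => pl r.1 r.2))
  (q0 : forall c, 0 <= q c) (q1 : forall c, q c <= 1)
  (p0 : forall c y, 0 <= p c y) (pl0 : forall D y, 0 <= pl D y)
  (nu0 : forall L n, 0 <= nu L n).
Local Open Scope ereal_scope.
Notation upop := (upop q p).
Notation upops := (upops q p).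
Notation push := (push pl).
Notation lowop := (lowop pl nu).

Definition nice (G : seq E -> \bar R) := [/\ measurable_fun setT G,
  forall s, 0 <= G s & symmetric_fun G].

Let mWk := @measurable_Wk R.

Let q1' c : 0 <= (1 - q c)%:E. Proof. by rewrite lee_fin subr_ge0. Qed.
Let q0' c : 0 <= (q c)%:E. Proof. by rewrite lee_fin. Qed.
Let p0' c y : 0 <= (p c y)%:E. Proof. by rewrite lee_fin. Qed.
Let pl0' c y : 0 <= (pl c y)%:E. Proof. by rewrite lee_fin. Qed.

Let mpc c : measurable_fun setT (fun x : E => (p c x.1)%:E).
Proof.
apply/measurable_EFinP.
by apply: (measurableT_comp (g := fun x : E => (c, x.1)) mp); meas.
Qed.

Let mcons (G : seq E -> \bar R) t : measurable_fun setT G ->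
  measurable_fun setT (fun x : E => G (x :: t)).
Proof. by move=> mG; apply: (measurableT_comp mG); meas. Qed.

Lemma measurable_upop1 k c G : measurable_fun setT G -> (forall s, 0 <= G s) ->
  measurable_fun setT (upop k c G).
Proof.
move=> mG G0.
have H := @measurable_upops R q p mq mp q0 q1 p0 _ unit k (fun=> [:: c]) (fun=> G).
have {}H := H (measurable_cst _) (measurableT_comp mG measurable_snd) (fun _ => G0).
by apply: (measurableT_comp (g := fun s : seq E => (tt, s)) H); meas.
Qed.

Lemma measurable_lowop1 k Dl G : measurable_fun setT G -> (forall s, 0 <= G s) ->
  measurable_fun setT (lowop k Dl G).
Proof.
move=> mG G0.
have H := @measurable_lowop R pl nu mpl pl0 nu0 _ unit k (fun=> Dl) (fun=> G).
have {}H := H (measurable_cst _) (measurableT_comp mG measurable_snd) (fun _ => G0).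
by apply: (measurableT_comp (g := fun s : seq E => (tt, s)) H); meas.
Qed.

Lemma upop_nice k c G : nice G -> nice (upop k c G).
Proof.
move=> [mG G0 Gs]; split; first exact: measurable_upop1.
  by move=> s; exact: upop_ge0.
move=> s t st; rewrite /upop (Gs _ _ st); congr (_ + _ * _).
by apply: eq_integral => x _; rewrite (Gs (x :: s) (x :: t))// perm_cons.
Qed.

Lemma upops_nice k Du G : nice G -> nice (upops k Du G).
Proof. by move=> nG; elim: Du => //= c Du; exact: upop_nice. Qed.

Lemma iter_push_sym k Dl n G : symmetric_fun G -> symmetric_fun (iter n (push k Dl) G).
Proof.
move=> Gs; elim: n => //= n IH s t st.
by apply: eq_integral => x _; rewrite (IH (x :: s) (x :: t))// perm_cons.
Qed.

Lemma lowop_nice k Dl G : nice G -> nice (lowop k Dl G).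
Proof.
move=> [mG G0 Gs]; split; first exact: measurable_lowop1.
  by move=> s; exact: lowop_ge0.
move=> s t st; apply: eq_eseriesr => n _.
by rewrite (iter_push_sym _ _ _ Gs st).
Qed.

(** Tonelli, and the symmetry of G in its first two entries. *)
Lemma upop_comm k c c' G t : nice G -> upop k c (upop k c' G) t = upop k c' (upop k c G) t.
Proof.
move=> [mG G0 Gs].
have I0 a u : 0 <= \int[fmu]_(x in Wk k) ((p a x.1)%:E * G (x :: u)).
  by apply: integral_ge0 => x _; rewrite mule_ge0.
have mI a : measurable_fun setT (fun x => \int[fmu]_(y in Wk k) ((p a y.1)%:E * G (y :: x :: t))).
  apply: (@measurable_param_int _ _ _ fmu _ E (Wk k) (fun x y => (p a y.1)%:E * G (y :: x :: t))) => //.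
    apply: emeasurable_funM; first by apply: (measurableT_comp (mpc a)); meas.
    by apply: (measurableT_comp mG); meas.
  by move=> y x; rewrite mule_ge0.
have key a b : upop k a (upop k b G) t =
   (1 - q a)%:E * ((1 - q b)%:E * G t) +
   (1 - q a)%:E * ((q b)%:E * \int[fmu]_(x in Wk k) ((p b x.1)%:E * G (x :: t))) +
   ((1 - q b)%:E * ((q a)%:E * \int[fmu]_(x in Wk k) ((p a x.1)%:E * G (x :: t))) +
   (q a)%:E * ((q b)%:E * \int[fmu]_(x in Wk k) \int[fmu]_(y in Wk k)
       ((p a x.1)%:E * ((p b y.1)%:E * G (y :: x :: t))))).
  rewrite {1}/upop ge0_muleDr ?mule_ge0//; congr (_ + _).
  rewrite muleCA -ge0_muleDr ?mule_ge0//; last first.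
    by apply: integral_ge0 => x _; apply: integral_ge0 => y _; rewrite !mule_ge0.
  congr (_ * _).
  rewrite (eq_integral (fun x => (1 - q b)%:E * ((p a x.1)%:E * G (x :: t)) +
     (q b)%:E * \int[fmu]_(y in Wk k) ((p a x.1)%:E * ((p b y.1)%:E * G (y :: x :: t))))).
    rewrite ge0_integralD//; last 4 first.
    - by move=> x _; rewrite !mule_ge0.
    - apply: measurable_funTS; apply: emeasurable_funM => //.
      by apply: emeasurable_funM => //; exact: mcons.
    - move=> x _; rewrite mule_ge0//; apply: integral_ge0 => y _.
      by rewrite !mule_ge0.
    - apply: measurable_funTS; apply: emeasurable_funM => //.
      rewrite (_ : (fun _ => _) = (fun x => (p a x.1)%:E * \int[fmu]_(y in Wk k) ((p b y.1)%:E * G (y :: x :: t)))).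
        exact: emeasurable_funM.
      apply/funext => x; rewrite ge0_integralZl//.
      + apply: measurable_funTS; apply: emeasurable_funM => //; exact: mcons.
      + by move=> y _; rewrite mule_ge0.
    rewrite ge0_integralZl//; last 2 first.
    - apply: measurable_funTS; apply: emeasurable_funM => //; exact: mcons.
    - by move=> y _; rewrite mule_ge0.
    rewrite ge0_integralZl//.
    - apply: measurable_funTS.
      rewrite (_ : (fun _ => _) = (fun x => (p a x.1)%:E * \int[fmu]_(y in Wk k) ((p b y.1)%:E * G (y :: x :: t)))).
        exact: emeasurable_funM.
      apply/funext => x; rewrite ge0_integralZl//.
      + apply: measurable_funTS; apply: emeasurable_funM => //; exact: mcons.
      + by move=> y _; rewrite mule_ge0.
    - by move=> x _; apply: integral_ge0 => y _; rewrite !mule_ge0.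
  move=> x _; rewrite /upop ge0_muleDr ?mule_ge0// muleCA; congr (_ + _).
  rewrite muleCA; congr (_ * _); rewrite ge0_integralZl//.
  - by apply: measurable_funTS; apply: emeasurable_funM => //; exact: mcons.
  - by move=> y _; rewrite mule_ge0.
have II : \int[fmu]_(x in Wk k) \int[fmu]_(y in Wk k)
       ((p c x.1)%:E * ((p c' y.1)%:E * G (y :: x :: t))) =
   \int[fmu]_(x in Wk k) \int[fmu]_(y in Wk k)
       ((p c' x.1)%:E * ((p c y.1)%:E * G (y :: x :: t))).
  have -> := @tonelli_param _ _ _ fmu _ _ fmu (Wk k) (Wk k)
    (fun x y => (p c x.1)%:E * ((p c' y.1)%:E * G (y :: x :: t))) (mWk k) (mWk k).
  - apply: eq_integral => y _; apply: eq_integral => x _.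
    rewrite muleCA (Gs (y :: x :: t) (x :: y :: t))//.
    by rewrite -[y :: x :: t]/([:: y] ++ [:: x] ++ t) perm_catCA.
  - apply: emeasurable_funM; first by apply: (measurableT_comp (mpc c)); meas.
    apply: emeasurable_funM; first by apply: (measurableT_comp (mpc c')); meas.
    by apply: (measurableT_comp mG); meas.
  - by move=> x y; rewrite !mule_ge0.
rewrite (key c c') (key c' c) II.
rewrite [(q c)%:E * ((q c')%:E * \int[_]_(x in _) \int[_]_(y in _) _)]muleCA.
by rewrite [(1 - q c')%:E * ((1 - q c)%:E * _)]muleCA [RHS]addeACA.
Qed.

(** Commuting operators may be applied in any order, so the result only depends on
    the multiset of centers; the kernel itself depends on their order. *)
Lemma upops_perm k Du Du' G : nice G -> perm_eq Du Du' -> upops k Du G = upops k Du' G.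
Proof.
move=> nG; elim: Du Du' => [|c Du IH] Du' DuDu'.
  by move/perm_size: (DuDu') => /esym/size0nil ->.
have : c \in Du' by rewrite -(perm_mem DuDu') mem_head.
move=> /path.splitPr H; case: H DuDu' => s1 s2.
move=> DuDu'; have /IH /= -> : perm_eq Du (s1 ++ s2).
  by rewrite -(perm_cons c) (perm_trans DuDu')// (perm_catCA s1 [:: c] s2).
elim: s1 {DuDu'} => //= c' s1 <-; apply/funext => t; apply: upop_comm; exact: upops_nice.
Qed.

Lemma lowop_perm k Dl Dl' G : (forall y, pl Dl y = pl Dl' y) ->
  perm_eq Dl Dl' -> lowop k Dl G = lowop k Dl' G.
Proof.
move=> plE DD'; rewrite /lowop (perm_size DD') (_ : push k Dl = push k Dl')//.
apply/funext => F; apply/funext => t.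
by apply: eq_integral => x _; rewrite plE.
Qed.

Lemma measurable_kern {d} {Y : measurableType d} Du (b : seq PT -> R) (xi : Y -> seq PT) :
  measurable_fun setT b -> measurable_fun setT xi ->
  measurable_fun setT (fun y => kern q p Du b (xi y)).
Proof.
move=> mb mxi; suff H : measurable_fun setT (kern q p Du b) by exact: measurableT_comp.
elim: Du => [//|c Du IH].
rewrite (_ : kern q p (c :: Du) b = fun s => (1 - q c) * kern q p Du b s +
   (if (0 < size s)%N then q c * p c (nth (0, 0) s 0) * kern q p Du b (behead s) else 0))%R; last first.
  by apply/funext => -[].
apply: measurable_funD; first exact: measurable_funM.
apply: measurable_fun_ifT => //.
  exact: (measurableT_comp (f := fun n => (0 < n)%N) _ measurable_size).
apply: measurable_funM.
  apply: measurable_funM => //.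
  apply: (measurableT_comp (g := fun s : seq PT => (c, nth (0, 0)%R s 0)) mp).
  apply/measurable_fun_pair => //; exact: measurable_nth0.
apply: (measurableT_comp IH); exact: measurable_behead_seq.
Qed.

Lemma measurable_lower_block Dl : measurable_fun setT (lower_block nu pl Dl).
Proof.
apply: measurable_funM.
  apply: (measurableT_comp (f := nu (size Dl)) _ measurable_size) => //.
rewrite (_ : (fun _ => _) = foldr (fun x r => pl Dl x * r)%R 1%R); last first.
  by apply/funext; elim => [|x s IH]; rewrite ?big_nil// big_cons IH.
apply: (@measurable_foldr _ _ _ _ (fun x r => pl Dl x * r)%R).
apply: measurable_funM => //.
by apply: (measurableT_comp (g := fun x : PT * R => (Dl, x.1)) mpl); meas.
Qed.

Lemma kern_ge0 Du b xi : (forall s, 0 <= b s)%R -> (0 <= kern q p Du b xi)%R.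
Proof.
move=> b0; elim: Du xi => [|c Du IH] xi //=; apply: addr_ge0.
  by rewrite mulr_ge0// subr_ge0.
by case: xi => // x xi; rewrite !mulr_ge0.
Qed.

Lemma lower_block_ge0 Dl t : (0 <= lower_block nu pl Dl t)%R.
Proof. by rewrite mulr_ge0// prodr_ge0. Qed.

Definition births_deaths (s : seq E) : seq PT := map fst s.

Lemma measurable_births_deaths : measurable_fun setT births_deaths.
Proof. by apply: (measurable_map (f := fst)); exact: measurable_fst. Qed.

Let mfst := measurable_births_deaths.

Let mcatr (F : seq E -> \bar R) t : measurable_fun setT F ->
  measurable_fun setT (fun s => F (s ++ t)).
Proof.
move=> mF; apply: (measurableT_comp mF).
rewrite (_ : (fun _ => _) = foldr cons t); last by apply/funext; elim=> //= x s ->.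
by apply: measurable_foldr; meas.
Qed.

(** Integrating n independent lower features is applying push n times, as G is
    symmetric. *)
Lemma totint_lower_block k Dl F t : nice F ->
  totint fmu (Wk k) (fun s => (lower_block nu pl Dl (births_deaths s))%:E * F (s ++ t)) =
  lowop k Dl F t.
Proof.
move=> nF; apply: eq_eseriesr => n _.
rewrite (@eq_iterint _ _ _ _ _ _ _ (fun s => (nu (size Dl) n)%:E *
   ((\prod_(x <- births_deaths s) pl Dl x)%:E * F (s ++ t)))); last first.
  by move=> s _ sn; rewrite /lower_block size_map sn EFinM muleA.
have mP : measurable_fun setT (fun s : seq E => (\prod_(x <- births_deaths s) pl Dl x)%:E).
  apply/measurable_EFinP.
  rewrite (_ : (fun _ => _) = foldr (fun x r => pl Dl x.1 * r)%R 1%R); last first.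
    by apply/funext; elim => [|x s IH]; rewrite ?big_nil// /= big_cons IH.
  apply: (@measurable_foldr _ _ _ _ (fun x r => pl Dl x.1 * r)%R).
  apply: measurable_funM => //.
  by apply: (measurableT_comp (g := fun x : E * R => (Dl, x.1.1)) mpl); meas.
have P0 s : 0 <= (\prod_(x <- births_deaths s) pl Dl x)%:E by rewrite lee_fin prodr_ge0.
case: nF => mF F0 Fs; rewrite iterintZ//; last 3 first.
- by apply: emeasurable_funM => //; exact: mcatr.
- by move=> s; rewrite mule_ge0.
- by rewrite lee_fin.
congr (_ * _); elim: n t => [|n IH] t; first by rewrite /= big_nil mul1e.
rewrite iterintS /=; apply: eq_integral => x _.
rewrite -IH -iterintZ//; last 2 first.
- by apply: emeasurable_funM => //; exact: mcatr.
- by move=> s; rewrite mule_ge0.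
apply: eq_iterint => s _ _.
by rewrite /= big_cons EFinM -muleA symmetric_middle.
Qed.

(** Induction on the upper centers: a list of points is integrated by its head if
    the first center produces it, and the symmetry of F moves this head behind
    the remaining points. *)
Lemma totint_kern k Du Dl F t : nice F ->
  totint fmu (Wk k) (fun s =>
    (kern q p Du (lower_block nu pl Dl) (births_deaths s))%:E * F (s ++ t)) =
  upops k Du (lowop k Dl F) t.
Proof.
move=> nF; elim: Du t => [|c Du IH] t /=; first exact: totint_lower_block.
set b := lower_block nu pl Dl.
have [mF F0 Fs] := nF.
have b0 : forall s, (0 <= b s)%R by exact: lower_block_ge0.
have mK D' : measurable_fun setT (fun s : seq E => (kern q p D' b (births_deaths s))%:E).
  apply/measurable_EFinP/measurable_kern => //; exact: measurable_lower_block.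
have K0 D' s : 0 <= (kern q p D' b s)%:E by rewrite lee_fin kern_ge0.
pose H (s : seq E) : \bar R := if s is x :: s' then
   (q c)%:E * ((p c x.1)%:E * ((kern q p Du b (births_deaths s'))%:E * F (s ++ t))) else 0.
have mH : measurable_fun setT H.
  pose x0 : E := ((0, 0)%R, 0%N).
  rewrite (_ : H = fun s => if (0 < size s)%N then
    (q c)%:E * ((p c (nth x0 s 0).1)%:E * ((kern q p Du b (births_deaths (behead s)))%:E * F (s ++ t))) else 0); last first.
    by apply/funext => -[].
  apply: measurable_fun_ifT => //.
    exact: (measurableT_comp (f := fun n => (0 < n)%N) _ measurable_size).
  apply: emeasurable_funM => //; apply: emeasurable_funM.
    by apply: (measurableT_comp (mpc c)); exact: measurable_nth0.
  apply: emeasurable_funM; last exact: mcatr.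
  by apply: (measurableT_comp (mK Du)); exact: measurable_behead_seq.
have H0 s : 0 <= H s by case: s => //= x s; rewrite !mule_ge0.
rewrite (@eq_totint _ _ _ _ _ _ (fun s => (1 - q c)%:E *
   ((kern q p Du b (births_deaths s))%:E * F (s ++ t)) + H s)); last first.
  move=> s _; rewrite /= EFinD ge0_muleDl; last 2 first.
  - by rewrite EFinM mule_ge0.
  - by case: s => //= x s; rewrite lee_fin !mulr_ge0// -lee_fin.
  rewrite EFinM muleA; congr (_ + _); case: s => [|x s]; first by rewrite mul0e.
  by rewrite /= !EFinM !muleA.
rewrite totintD//; last 2 first.
- by apply: emeasurable_funM => //; apply: emeasurable_funM => //; exact: mcatr.
- by move=> s; rewrite !mule_ge0.
rewrite totintZ//; last 3 first.
- by apply: emeasurable_funM => //; exact: mcatr.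
- by move=> s; rewrite mule_ge0.
- by rewrite subr_ge0.
rewrite IH /upop; congr (_ + _).
rewrite totint_recl// add0e /=.
rewrite (eq_integral (fun x : E => (q c)%:E * ((p c x.1)%:E *
   upops k Du (lowop k Dl F) (x :: t)))); last first.
  move=> x _; rewrite totintZ//; last 2 first.
  - apply: emeasurable_funM => //; apply: emeasurable_funM => //.
    exact: (measurable_shift1 _ (mcatr t mF)).
  - by move=> s; rewrite !mule_ge0.
  rewrite totintZ//; last 2 first.
  - apply: emeasurable_funM => //.
    exact: (measurable_shift1 _ (mcatr t mF)).
  - by move=> s; rewrite !mule_ge0.
  rewrite -IH; congr (_ * (_ * _)); apply: eq_totint => s _.
  by rewrite symmetric_middle.
have [mU U0 _] := upops_nice k Du (lowop_nice k Dl nF).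
rewrite ge0_integralZl//.
- by apply: measurable_funTS; apply: emeasurable_funM => //; exact: mcons.
- by move=> x _; rewrite mule_ge0.
Qed.

End operator_algebra.

(** * Merging the degrees *)

Lemma size_degree_part {R : realType} k (s : seq (feature R)) :
  size (degree_part k s) = count (fun x => x.2 == k) s.
Proof. by rewrite size_map size_filter. Qed.

Lemma sum_size_degree_part {R : realType} d (s : seq (feature R)) : over (Wdeg R d) s ->
  (\sum_(k < d) size (degree_part k s))%N = size s.
Proof.
elim: s => [_|x s IH /over_cons[[_ xd] /IH {}IH]]; first by rewrite big1.
under eq_bigr do rewrite size_degree_part /=.
rewrite big_split /=; under [X in (_ + X)%N]eq_bigr do rewrite -size_degree_part.
rewrite IH (bigD1 (Ordinal xd))//= eqxx big1 ?addn0 ?add1n// => k.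
by rewrite -val_eqE /= eq_sym => /negbTE ->.
Qed.

Section multi_degree.
Context {R : realType}.
Notation E := (feature R).
Notation PT := (measurableTypeR R * measurableTypeR R)%type.
Variables (sigma : R).
Variables (q : PT -> R) (p : PT -> PT -> R) (pl : seq PT -> PT -> R) (nu : nat -> nat -> R).
Hypotheses (mq : measurable_fun setT q)
  (mp : measurable_fun setT (fun r : PT * PT => p r.1 r.2))
  (mpl : measurable_fun setT (fun r : seq PT * PT => pl r.1 r.2))
  (q0 : forall c, 0 <= q c) (q1 : forall c, q c <= 1)
  (p0 : forall c y, 0 <= p c y) (pl0 : forall D y, 0 <= pl D y)
  (plperm : forall D D' y, perm_eq D D' -> pl D y = pl D' y)
  (nu0 : forall L n, 0 <= nu L n).
Local Open Scope ereal_scope.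

Definition degop k (z : seq E) (G : seq E -> \bar R) : seq E -> \bar R :=
  upops q p k (upper sigma (degree_part k z))
    (lowop pl nu k (lower sigma (degree_part k z)) G).

(** One operator for each degree; the highest degree acts on the functional first. *)
Fixpoint totop d (z : seq E) (F : seq E -> \bar R) : seq E -> \bar R :=
  if d is d'.+1 then totop d' z (degop d' z F) else F.

Definition degkern k (z : seq E) (xi : seq PT) : R :=
  kern q p (upper sigma (degree_part k z))
    (lower_block nu pl (lower sigma (degree_part k z))) xi.

(** The kernel restricted to the first d degrees. *)
Definition multikern d (z s : seq E) : R :=
  ((\prod_(k < d) (size (degree_part k s))`!%:R) /
   ((\sum_(k < d) size (degree_part k s))`!)%N%:R *
   \prod_(k < d) degkern k z (degree_part k s))%R.

Lemma degop_nice k z G : nice G -> nice (degop k z G).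
Proof. by move=> nG; apply: upops_nice => //; exact: lowop_nice. Qed.

Lemma degop_ge0 k z G t : (forall s, 0 <= G s) -> 0 <= degop k z G t.
Proof. by move=> G0; apply: upops_ge0 => // s; exact: lowop_ge0. Qed.

Lemma degop_perm k z z' G : nice G -> perm_eq z z' -> degop k z G = degop k z' G.
Proof.
move=> nG zz'.
have dp : perm_eq (degree_part k z) (degree_part k z').
  by apply: perm_map; exact: perm_filter.
rewrite /degop (@lowop_perm _ _ _ _ _ (lower sigma (degree_part k z'))).
- by apply: upops_perm => //; [exact: lowop_nice|exact: perm_filter].
- by move=> y; apply: plperm; exact: perm_filter.
- exact: perm_filter.
Qed.

Lemma totop_perm d z z' F : nice F -> perm_eq z z' -> totop d z F = totop d z' F.
Proof.
move=> + zz'; elim: d F => //= d IH F nF.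
by rewrite (degop_perm _ nF zz') IH//; exact: degop_nice.
Qed.

Lemma measurable_degree_part k : measurable_fun setT (@degree_part R k).
Proof.
apply: (measurableT_comp (f := map fst) (g := seq.filter (fun x : E => x.2 == k))).
  by apply: (measurable_map (f := fst)); exact: measurable_fst.
apply: measurable_filter.
apply: (measurableT_comp (f := fun n : nat => n == k)) => //; exact: measurable_snd.
Qed.

Lemma measurable_gap : measurable_fun setT (fun c : PT => c.2 - c.1)%R.
Proof. by apply: measurable_funB; [exact: measurable_snd|exact: measurable_fst]. Qed.

Lemma measurable_upper : measurable_fun setT (@upper R sigma).
Proof.
apply: measurable_filter; apply: measurable_fun_ler => //; exact: measurable_gap.
Qed.

Lemma measurable_lower : measurable_fun setT (@lower R sigma).
Proof.
apply: measurable_filter; apply: measurable_fun_ltr => //; exact: measurable_gap.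
Qed.

Lemma measurable_degop k (G : seq E -> seq E -> \bar R) :
  measurable_fun setT (fun r : seq E * seq E => G r.1 r.2) -> (forall y s, 0 <= G y s) ->
  measurable_fun setT (fun r : seq E * seq E => degop k r.1 (G r.1) r.2).
Proof.
move=> mG G0.
apply: (@measurable_upops R q p mq mp q0 q1 p0 _ _ k
  (fun z => upper sigma (degree_part k z))
  (fun z => lowop pl nu k (lower sigma (degree_part k z)) (G z))).
- exact: measurableT_comp measurable_upper (measurable_degree_part k).
- apply: (@measurable_lowop R pl nu mpl pl0 nu0 _ _ k
    (fun z => lower sigma (degree_part k z))) => //.
  exact: measurableT_comp measurable_lower (measurable_degree_part k).
- by move=> z s; exact: lowop_ge0.
Qed.

Lemma measurable_totop d (F : seq E -> seq E -> \bar R) :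
  measurable_fun setT (fun r : seq E * seq E => F r.1 r.2) -> (forall y s, 0 <= F y s) ->
  measurable_fun setT (fun r : seq E * seq E => totop d r.1 (F r.1) r.2).
Proof.
elim: d F => //= d IH F mF F0; apply: (IH (fun z => degop d z (F z))).
  exact: measurable_degop.
by move=> z s; exact: degop_ge0.
Qed.

Lemma degkern_ge0 k z xi : (0 <= degkern k z xi)%R.
Proof. by apply: kern_ge0 => // s; exact: lower_block_ge0. Qed.

Lemma multikern_ge0 d z s : (0 <= multikern d z s)%R.
Proof.
apply: mulr_ge0; last by apply: prodr_ge0 => k _; exact: degkern_ge0.
by rewrite divr_ge0// prodr_ge0.
Qed.

Lemma measurable_multikern d z : measurable_fun setT (multikern d z).
Proof.
apply: measurable_funM; last first.
  apply: measurable_prod => k _.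
  apply: measurable_kern => //; first exact: measurable_lower_block.
  exact: measurable_degree_part.
have msz k : measurable_fun setT (fun s : seq E => size (degree_part k s)).
  exact: measurableT_comp measurable_size (measurable_degree_part k).
apply: measurable_funM.
  apply: measurable_prod => k _.
  exact: (measurableT_comp (f := fun n => (n`!)%:R : R) _ (msz k)).
apply: (measurableT_comp (f := fun n => ((n`!)%:R : R)^-1%R)) => //.
elim: d => [|d IH].
  by rewrite (_ : (fun _ => _) = cst 0%N)//; apply/funext => s; rewrite big_ord0.
under eq_fun do rewrite big_ord_recr.
apply: (measurableT_comp (f := fun r : nat * nat => (r.1 + r.2)%N)
  (g := fun s : seq E => ((\sum_(k < d) size (degree_part k s))%N, size (degree_part d s)))).
  by move=> _ A _; exact: measurable_nat_pairs.
by apply/measurable_fun_pair.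
Qed.

(** The multinomial factor for d.+1 degrees is the one for d degrees times the
    inverse of the number of ways to interleave the points of degree d with the
    others. *)
Lemma multikernS d z s : over (Wdeg R d.+1) s ->
  multikern d.+1 z s =
  ('C(size s, size [seq x <- s | x \in [set x : E | x.2 = d]])%:R^-1 *
  (degkern d z (births_deaths [seq x <- s | x \in [set x : E | x.2 = d]]) *
   multikern d z [seq x <- s | x \notin [set x : E | x.2 = d]]))%R.
Proof.
move=> Ds.
have inA (x : E) : (x \in [set x : E | x.2 = d]) = (x.2 == d).
  by apply/idP/eqP => [/set_mem//|xd]; exact: mem_set.
set s1 := [seq x <- s | x \in _]; set s2 := [seq x <- s | x \notin _].
have s1E : degree_part d s = births_deaths s1.
  by rewrite /degree_part /s1 (eq_filter inA).
have s2E k : (k < d)%N -> degree_part k s = degree_part k s2.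
  move=> kd; rewrite /degree_part -filter_predI; congr (map _ _).
  apply: eq_filter => x /=; rewrite inA; case: eqVneq => //= ->.
  by rewrite ltn_eqF.
have Ds2 : over (Wdeg R d) s2.
  move=> x; rewrite mem_filter inA => /andP[xd /Ds[Wx]].
  by rewrite ltnS leq_eqVlt (negbTE xd).
have sz : size s = (size s1 + size s2)%N.
  by rewrite !size_filter -(count_predC (fun x => x \in [set x : E | x.2 = d])).
rewrite /multikern !big_ord_recr /= s1E.
have big_s2 (f : seq PT -> R) : (\prod_(k < d) f (degree_part k s) = \prod_(k < d) f (degree_part k s2))%R.
  by apply: eq_bigr => k _; rewrite s2E.
have -> : (\sum_(k < d) size (degree_part k s) = \sum_(k < d) size (degree_part k s2))%N.
  by apply: eq_bigr => k _; rewrite s2E.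
rewrite (big_s2 (fun r => (size r)`!%:R)%R) (sum_size_degree_part Ds2).
have -> : (\prod_(k < d) degkern k z (degree_part k s) = \prod_(k < d) degkern k z (degree_part k s2))%R.
  by apply: eq_bigr => k _; rewrite s2E.
rewrite size_map sz [(size s1 + _)%N in X in (_ = X)%R]addnC [(size s2 + size s1)%N]addnC.
set n1 := size s1; set n2 := size s2.
set P := (\prod_(k < d) _)%R; set K := (\prod_(k < d) degkern _ _ _)%R.
have bf : ('C(n1 + n2, n1)%:R * (n1`!%:R * n2`!%:R) = (n1 + n2)`!%:R :> R)%R.
  by rewrite -!natrM -(bin_fact (leq_addr n2 n1)) addKn.
have [h1 h2 hC] : [/\ n1`!%:R != 0 :> R, n2`!%:R != 0 :> R & 'C(n1 + n2, n1)%:R != 0 :> R]%R.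
  by rewrite !pnatr_eq0 -!lt0n !fact_gt0 bin_gt0 leq_addr.
have -> : (P * n1`!%:R / (n1 + n2)`!%:R = 'C(n1 + n2, n1)%:R^-1 * (P / n2`!%:R))%R.
  rewrite -bf !invfM -!mulrA; set i1 := (n1`!%:R^-1)%R.
  by rewrite (mulrCA (n1`!%:R)%R) [(n1`!%:R * _)%R]mulrA divff// mul1r mulrCA.
by rewrite -!mulrA; congr (_ * _)%R; rewrite [RHS]mulrCA; congr (_ * _)%R; rewrite [RHS]mulrC mulrA.
Qed.

Lemma measurable_cat : measurable_fun setT (fun r : seq E * seq E => r.1 ++ r.2).
Proof.
have H := @measurable_fun_foldr _ E _ _ (seq E) (seq E) (fun _ x s => x :: s) id.
have {}H : measurable_fun setT (fun r : seq E * seq E => foldr cons r.1 r.2).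
  by apply: H; meas.
rewrite (_ : (fun _ => _) = (fun r => foldr cons r.1 r.2) \o (fun r => (r.2, r.1))).
  by apply: measurableT_comp; meas.
by apply/funext => -[s t] /=; elim: s => //= x s ->.
Qed.

(** The points of the highest degree are integrated first, by [totint_kern]; their
    interleaving with the others is undone by [totint_filter]. *)
Lemma totint_multikern d z F t : nice F ->
  totint fmu (Wdeg R d) (fun s => (multikern d z s)%:E * F (s ++ t)) = totop d z F t.
Proof.
elim: d F t => [|d IH] F t nF.
  have -> : Wdeg R 0 = set0 by apply/seteqP; split => // x [].
  have [mF F0 _] := nF.
  rewrite totint_recl.
  - rewrite integral_set0 adde0 /= /multikern !big_ord0 divr1 !mulr1/= mul1e.
    by [].
  - exact: measurable0.
  - apply: emeasurable_funM.
      by apply/measurable_EFinP; exact: measurable_multikern.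
    apply: (measurableT_comp mF).
    by apply: (measurableT_comp measurable_cat (g := fun s : seq E => (s, t))); meas.
  - by move=> s; rewrite mule_ge0// lee_fin multikern_ge0.
have [mF F0 Fs] := nF; set A := [set x : E | x.2 = d].
pose H (s r : seq E) := (multikern d z r)%:E * ((degkern d z (births_deaths s))%:E * F (s ++ (r ++ t))).
have mA : measurable A by rewrite (_ : A = setT `*` [set d]); [exact: measurableX|apply/seteqP; split=> x //= []].
rewrite (@eq_totint _ _ _ _ _ _ (fun s =>
    ('C(size s, size [seq x <- s | x \in A])%:R^-1)%:E *
    H [seq x <- s | x \in A] [seq x <- s | x \notin A])); last first.
  move=> s Ds; rewrite multikernS// EFinM -muleA; congr (_ * _).
  rewrite EFinM /H -!muleA muleCA; congr (_ * (_ * _)).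
  by apply: Fs; rewrite catA perm_cat2r perm_sym perm_filterC.
have mH : measurable_fun setT (fun r : seq E * seq E => H r.1 r.2).
  apply: emeasurable_funM.
    apply/measurable_EFinP; apply: (measurableT_comp (measurable_multikern d z)).
    exact: measurable_snd.
  apply: emeasurable_funM.
    apply/measurable_EFinP; apply: measurable_kern => //.
      exact: measurable_lower_block.
    by apply: (measurableT_comp (f := @births_deaths R) (g := fst)) => //; exact: measurable_births_deaths.
  apply: (measurableT_comp mF).
  apply: (measurableT_comp measurable_cat (g := fun r : seq E * seq E => (r.1, r.2 ++ t))).
  apply/measurable_fun_pair; first by meas.
  by apply: (measurableT_comp measurable_cat (g := fun r : seq E * seq E => (r.2, t))); meas.
have mk0 s : 0 <= (multikern d z s)%:E by rewrite lee_fin multikern_ge0.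
have dk0 s : 0 <= (degkern d z s)%:E by rewrite lee_fin degkern_ge0.
rewrite (totint_filter _ (@measurable_Wdeg R d.+1) mA mH); last by move=> s r; rewrite !mule_ge0.
have -> : Wdeg R d.+1 `&` ~` A = Wdeg R d.
  apply/seteqP; split => x; rewrite /Wdeg /A /=.
    by move=> [[? +] /eqP/negbTE xd]; rewrite ltnS leq_eqVlt xd.
  move=> [? xd]; split; first by split => //; rewrite ltnS ltnW.
  by move=> xdE; rewrite xdE ltnn in xd.
have -> : Wdeg R d.+1 `&` A = Wk d.
  apply/seteqP; split => x; rewrite /Wdeg /A /Wk /=; first by case=> -[].
  by move=> [? ->]; split.
rewrite /= -IH; last exact: degop_nice.
apply: eq_totint => r _; rewrite /H totintZ//.
- by congr (_ * _); apply: totint_kern.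
- exact: measurable_Wk.
- apply: emeasurable_funM.
    apply/measurable_EFinP; apply: measurable_kern => //.
      exact: measurable_lower_block.
    exact: measurable_births_deaths.
  apply: (measurableT_comp mF).
  by apply: (measurableT_comp measurable_cat (g := fun s : seq E => (s, r ++ t))); meas.
- by move=> s; rewrite mule_ge0.
- exact: multikern_ge0.
Qed.
End multi_degree.

(** * Gaussian estimates *)

Section gaussian.
Context {R : realType}.
Notation PT := (measurableTypeR R * measurableTypeR R)%type.
Notation mu2 := (lebesgue2 R).
Local Open Scope ring_scope.
Implicit Types (c x : PT) (sigma : R) (Dl : seq PT).

Lemma gauss2_ge0 sigma c x : 0 <= gauss2 sigma c x.
Proof.
by rewrite divr_ge0 ?expR_ge0// mulr_ge0 ?sqr_ge0// mulr_ge0 ?pi_ge0.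
Qed.

Lemma measurable_gauss2 sigma :
  measurable_fun setT (fun r : PT * PT => gauss2 sigma r.1 r.2).
Proof.
apply: measurable_funM => //; apply: measurableT_comp => //.
apply: measurable_funM => //; apply: measurableT_comp => //.
have m1 : measurable_fun setT (fun r : PT * PT => r.1.1) by apply: measurableT_comp.
have m2 : measurable_fun setT (fun r : PT * PT => r.1.2) by apply: measurableT_comp.
have m3 : measurable_fun setT (fun r : PT * PT => r.2.1) by apply: measurableT_comp.
have m4 : measurable_fun setT (fun r : PT * PT => r.2.2) by apply: measurableT_comp.
by apply: measurable_funD; apply: measurable_funX; exact: measurable_funB.
Qed.

Lemma measurable_gauss2r sigma c : measurable_fun setT (gauss2 sigma c).
Proof.
apply: (measurableT_comp (measurable_gauss2 sigma) (g := fun x => (c, x))).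
by apply/measurable_fun_pair.
Qed.

Lemma gauss2_normal_pdf sigma c x : 0 < sigma ->
  gauss2 sigma c x = normal_pdf c.1 sigma x.1 * normal_pdf c.2 sigma x.2.
Proof.
move=> s0; rewrite /normal_pdf !gt_eqF// mulrACA /gauss2 /normal_fun.
rewrite -expRD [LHS]mulrC; congr (_ * expR _); last first.
  by rewrite -mulrDl -opprD mulr_natl.
rewrite /normal_peak -invfM -expr2 sqr_sqrtr.
  by congr (_^-1); lra.
by rewrite mulrn_wge0// mulr_ge0 ?sqr_ge0// pi_ge0.
Qed.

Lemma int_gauss2 sigma c : 0 < sigma ->
  (\int[mu2]_x (gauss2 sigma c x)%:E = 1)%E.
Proof.
move=> s0; have mg : measurable_fun setT (fun x : PT => (gauss2 sigma c x)%:E).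
  by apply/measurable_EFinP; exact: measurable_gauss2r.
rewrite fubini_tonelli1//; last by move=> x; rewrite lee_fin gauss2_ge0.
rewrite -(integral_normal_pdf c.1 sigma); apply: eq_integral => u _.
rewrite /fubini_F (eq_integral (fun v : measurableTypeR R => (normal_pdf c.1 sigma u)%:E *
  (normal_pdf c.2 sigma v)%:E)%E); last by move=> v _; rewrite gauss2_normal_pdf// EFinM.
rewrite ge0_integralZl//.
- by rewrite integral_normal_pdf mule1.
- by apply/measurable_EFinP; exact: measurable_normal_pdf.
- by move=> v _; rewrite lee_fin normal_pdf_ge0.
- by rewrite lee_fin normal_pdf_ge0.
Qed.

(** With y the ratio of the sup distance to sigma, y <= 1 + y^2 / 4 <= exp (y^2 / 4)
    absorbs the factor y into half of the exponent, which is again a Gaussian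
    density, of variance 2 sigma^2.  This avoids computing a first moment. *)
Lemma gauss2_supdist sigma c x : 0 < sigma ->
  supdist c x * gauss2 sigma c x <= 2 * sigma * gauss2 (Num.sqrt 2 * sigma) c x.
Proof.
move=> s0; rewrite /gauss2 exprMn sqr_sqrtr//.
set rho := (_ ^+ 2 + _ ^+ 2).
have r2 : supdist c x ^+ 2 <= rho.
  rewrite /supdist /rho (distrC c.1) (distrC c.2).
  case: (leP `|x.1 - c.1| `|x.2 - c.2|) => _; rewrite real_normK ?num_real//.
    by rewrite lerDr sqr_ge0.
  by rewrite lerDl sqr_ge0.
set e := expR (- rho / (2 * (2 * sigma ^+ 2))).
have -> : expR (- rho / (2 * sigma ^+ 2)) = e * e.
  rewrite -expRD -mulrDl; congr expR; rewrite -opprD -mulr2n -[rho *+ 2]mulr_natl.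
  by rewrite !mulNr; congr (- _); rewrite !invfM; lra.
have key : supdist c x * e <= sigma.
  set y := supdist c x / sigma.
  have -> : supdist c x = y * sigma by rewrite /y divfK ?gt_eqF.
  rewrite mulrAC -[leRHS]mul1r ler_pM2r//.
  rewrite /e mulNr expRN ler_pdivrMr ?expR_gt0// mul1r.
  apply: (@le_trans _ _ (expR (y ^+ 2 / 4))); last first.
    rewrite ler_expR /y expr_div_n.
    have -> : rho / (2 * (2 * sigma ^+ 2)) = rho / sigma ^+ 2 / 4.
      by rewrite !invfM -!mulrA; congr (_ * _); lra.
    by rewrite ler_pM2r ?invr_gt0// ler_pM2r// invr_gt0 exprn_gt0.
  apply: le_trans (expR_ge1Dx _).
  have : 0 <= (y / 2 - 1) ^+ 2 by exact: sqr_ge0.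
  rewrite sqrrB expr_div_n; lra.
have pg : 0 < (2 * pi * sigma ^+ 2)^-1 :> R.
  by rewrite invr_gt0 !mulr_gt0 ?ltr0n ?pi_gt0// exprn_gt0.
have -> : 2 * sigma * (e / (2 * pi * (2 * sigma ^+ 2))) = sigma * e * (2 * pi * sigma ^+ 2)^-1.
  have -> : (2 * pi * (2 * sigma ^+ 2))^-1 = 2^-1 * (2 * pi * sigma ^+ 2)^-1 :> R.
    by rewrite -invfM; congr (_^-1); lra.
  lra.
rewrite mulrA ler_pM2r// mulrA ler_pM2r ?expR_gt0//.
Qed.

Lemma measurable_supdist2 c : measurable_fun setT (fun x : PT => supdist c x).
Proof. by apply: measurable_supdist. Qed.

Lemma int_gauss2_supdist sigma c : 0 < sigma ->
  (\int[mu2]_x (supdist c x * gauss2 sigma c x)%:E <= (2 * sigma)%:E)%E.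
Proof.
move=> s0.
have s20 : 0 < Num.sqrt 2 * sigma by rewrite mulr_gt0// sqrtr_gt0.
rewrite -[leRHS]mule1 -(int_gauss2 c s20) -ge0_integralZl//; last 3 first.
- by apply/measurable_EFinP; exact: measurable_gauss2r.
- by move=> x _; rewrite lee_fin gauss2_ge0.
- by rewrite lee_fin mulr_ge0// ltW.
apply: ge0_le_integral => //.
- by move=> x _; rewrite lee_fin mulr_ge0 ?gauss2_ge0 ?supdist_ge0.
- apply/measurable_EFinP; apply: measurable_funM; last exact: measurable_gauss2r.
  exact: measurable_supdist2.
- apply: emeasurable_funM => //; apply/measurable_EFinP; exact: measurable_gauss2r.
- by move=> x _; rewrite -EFinM lee_fin; exact: gauss2_supdist.
Qed.

(** A square of side l sigma at distance O(sigma) from the center has a mass that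
    does not depend on sigma. *)
Lemma gauss2_box sigma c (a b l : R) (A : set PT) : 0 < sigma -> 0 < l -> measurable A ->
  `[c.1 + a * sigma, c.1 + (a + l) * sigma] `*` `[c.2 + b * sigma, c.2 + (b + l) * sigma] `<=` A ->
  ((expR (- ((`|a| + l) ^+ 2 + (`|b| + l) ^+ 2) / 2) / (2 * pi) * l ^+ 2)%:E <=
   \int[mu2]_(x in A) (gauss2 sigma c x)%:E)%E.
Proof.
move=> s0 l0 mA; set B := _ `*` _ => BA.
have mB : measurable B by apply: measurableX.
apply: (@le_trans _ _ (\int[mu2]_(x in B) (gauss2 sigma c x)%:E)%E); last first.
  apply: ge0_subset_integral => //.
  - by apply/measurable_EFinP/measurable_funTS; exact: measurable_gauss2r.
  - by move=> x _; rewrite lee_fin gauss2_ge0.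
set k := expR _.
have mB2 : mu2 B = ((l * sigma) ^+ 2)%:E.
  pose I1 : set (measurableTypeR R) := `[c.1 + a * sigma, c.1 + (a + l) * sigma]%classic.
  pose I2 : set (measurableTypeR R) := `[c.2 + b * sigma, c.2 + (b + l) * sigma]%classic.
  transitivity (@lebesgue_measure R I1 * @lebesgue_measure R I2)%E.
    by apply: product_measure1E; exact: measurable_itv.
  rewrite /I1 /I2 !lebesgue_measure_itv /= !lte_fin.
  rewrite !ltrD2l !ltr_pM2r// !ltrDl l0 -!EFinD -EFinM; congr (_%:E); lra.
apply: (@le_trans _ _ (\int[mu2]_(x in B) (k / (2 * pi) / sigma ^+ 2)%:E)%E); last first.
  apply: ge0_le_integral => //.
  - by move=> x _; rewrite lee_fin divr_ge0 ?sqr_ge0// divr_ge0 ?expR_ge0// mulr_ge0 ?pi_ge0.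
  - by apply/measurable_EFinP/measurable_funTS; exact: measurable_gauss2r.
  move=> x [/= x1 x2]; rewrite lee_fin /gauss2 -mulrA -invfM.
  rewrite ler_pM2r; last by rewrite invr_gt0 !mulr_gt0 ?pi_gt0 ?exprn_gt0.
  rewrite ler_expR.
  have aux (u v w : R) : u \in `[v + w * sigma, v + (w + l) * sigma] ->
      (u - v) ^+ 2 <= (`|w| + l) ^+ 2 * sigma ^+ 2.
    rewrite in_itv/= => /andP[h1 h2]; rewrite -exprMn -ler_sqrt ?exprn_ge0//; last first.
      by rewrite mulr_ge0 ?addr_ge0// ltW.
    rewrite !sqrtr_sqr [leRHS]ger0_norm; last by rewrite mulr_ge0 ?addr_ge0// ltW.
    rewrite ler_norml; have := ler_norm w; have := lerNnormlW (lexx `|w|).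
    move=> h3 h4; apply/andP; split; last first.
      have : (w + l) * sigma <= (`|w| + l) * sigma by rewrite ler_pM2r// lerD2r.
      lra.
    have : - (`|w| + l) * sigma <= w * sigma by rewrite ler_pM2r//; lra.
    lra.
  have := aux _ _ _ x1; have := aux _ _ _ x2 => h1 h2.
  rewrite !mulNr lerN2 invfM.
  have sp : 0 < sigma ^+ 2 by rewrite exprn_gt0.
  have -> : (`|a| + l) ^+ 2 + (`|b| + l) ^+ 2 = ((`|a| + l) ^+ 2 * sigma ^+ 2 + (`|b| + l) ^+ 2 * sigma ^+ 2) / sigma ^+ 2.
    by rewrite -mulrDl mulfK ?gt_eqF.
  rewrite mulrA mulrAC ler_pM2r ?invr_gt0// ler_pM2r ?invr_gt0//.
  by rewrite lerD.
rewrite integral_cst// mB2 -EFinM lee_fin exprMn.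
rewrite [X in _ <= X](_ : _ = k / (2 * pi) * l ^+ 2 * (sigma ^+ 2 / sigma ^+ 2)); last by lra.
by rewrite divff ?mulr1// gt_eqF// exprn_gt0.
Qed.

(** The mass bound of [gauss2_box] for the square of side sigma / 2 whose lower
    left corner is c + (0, sigma); it lies in W as soon as c is in the closure
    of W. *)
Definition kappa : R :=
  expR (- ((0 + 1 / 2) ^+ 2 + (1 + 1 / 2) ^+ 2) / 2) / (2 * pi) * (1 / 2) ^+ 2.

Lemma kappa_gt0 : 0 < kappa.
Proof.
have h : 0 < 1 / 2 :> R by lra.
apply: mulr_gt0; last exact: exprn_gt0.
by rewrite divr_gt0 ?expR_gt0// mulr_gt0 ?pi_gt0.
Qed.

Let mg sigma c : measurable_fun setT (fun x : PT => (gauss2 sigma c x)%:E).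
Proof. by apply/measurable_EFinP; exact: measurable_gauss2r. Qed.

Let g0 sigma c x : (0 <= (gauss2 sigma c x)%:E)%E.
Proof. by rewrite lee_fin gauss2_ge0. Qed.

Let mW := @measurable_W R.

Let mind : measurable_fun setT (\1_(W R) : PT -> R).
Proof. exact: measurable_indic. Qed.

Lemma kappa_le sigma c : 0 < sigma -> 0 <= c.1 -> c.1 <= c.2 ->
  (kappa%:E <= \int[mu2]_(x in W R) (gauss2 sigma c x)%:E)%E.
Proof.
move=> s0 c0 c12; have := @gauss2_box sigma c 0 1 (1 / 2) (W R) s0.
rewrite normr0 normr1 /kappa; apply; [lra|exact: mW|].
move=> x [/=]; rewrite !in_itv/= => /andP[h1 h2] /andP[h3 h4]; split; lra.
Qed.

Lemma gauss2_mass sigma c (A : set PT) : 0 < sigma -> measurable A ->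
  (\int[mu2]_(x in A) (gauss2 sigma c x)%:E <= 1)%E.
Proof.
move=> s0 mA; rewrite -(int_gauss2 c s0); apply: ge0_subset_integral => //.
Qed.

Lemma gauss2_massE sigma c (A : set PT) : 0 < sigma -> measurable A ->
  (\int[mu2]_(x in A) gauss2 sigma c x)%:E = (\int[mu2]_(x in A) (gauss2 sigma c x)%:E)%E.
Proof.
move=> s0 mA; rewrite /Rintegral fineK// ge0_fin_numE; last by apply: integral_ge0.
by rewrite (le_lt_trans (gauss2_mass c s0 mA))// ltry.
Qed.

Lemma measurable_above : measurable [set x : PT | x.1 < x.2].
Proof.
rewrite -[X in measurable X]setTI.
exact: (measurable_fun_ltr measurable_fst measurable_snd measurableT (Y := [set true])).
Qed.
Let mab := measurable_above.

Lemma q_upperE sigma c : 0 < sigma ->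
  (q_upper sigma c)%:E = (\int[mu2]_(x in [set x : PT | (x.1 < x.2)%R]) (gauss2 sigma c x)%:E)%E.
Proof. by move=> s0; exact: gauss2_massE. Qed.

Lemma q_upper_ge0 sigma c : 0 <= q_upper sigma c.
Proof. by apply: Rintegral_ge0 => x _; exact: gauss2_ge0. Qed.

Lemma q_upper_le1 sigma c : 0 < sigma -> q_upper sigma c <= 1.
Proof. by move=> s0; rewrite -lee_fin q_upperE// gauss2_mass. Qed.

Lemma q_upperC sigma c : 0 < sigma ->
  (1 - q_upper sigma c)%:E =
  (\int[mu2]_(x in ~` [set x : PT | (x.1 < x.2)%R]) (gauss2 sigma c x)%:E)%E.
Proof.
move=> s0; rewrite EFinB q_upperE// -(int_gauss2 c s0) -(setUv [set x : PT | x.1 < x.2]).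
rewrite ge0_integral_setU//; first last.
- by apply/disj_setPCl.
- exact: measurable_funTS.
- exact: measurableC.
by rewrite [X in (X - _)%E]addeC addeK// -q_upperE.
Qed.

(** A square of side sigma below the diagonal has positive mass. *)
Lemma q_upper_neq1 sigma c : 0 < sigma -> 1 - q_upper sigma c != 0.
Proof.
move=> s0; rewrite gt_eqF// -lte_fin q_upperC//.
have := @gauss2_box sigma c ((c.2 - c.1) / sigma + 1) 0 1 (~` [set x : PT | x.1 < x.2]) s0 ltr01.
move=> /(_ (measurableC mab)) H; apply: lt_le_trans (H _).
  rewrite lte_fin expr1n mulr1 divr_gt0 ?expR_gt0// mulr_gt0 ?pi_gt0//.
move=> x [/=]; rewrite !in_itv/= => /andP[h1 h2] /andP[h3 h4]; apply/negP; rewrite -leNgt.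
apply: (le_trans h4); apply: le_trans h1.
by rewrite [(_ / _ + 1) * _]mulrDl divfK ?gt_eqF//; lra.
Qed.

(** A center far from the diagonal is rarely dropped: to cross the diagonal, the
    Gaussian has to move it by at least half its persistence. *)
Lemma q_upper_half_pers sigma c : 0 < sigma -> c.1 <= c.2 ->
  (1 - q_upper sigma c) * ((c.2 - c.1) / 2) <= 2 * sigma.
Proof.
move=> s0 c12; rewrite -lee_fin EFinM q_upperC// muleC.
apply: le_trans (int_gauss2_supdist c s0).
have msg : measurable_fun setT (fun x : PT => (supdist c x * gauss2 sigma c x)%:E).
  apply/measurable_EFinP; apply: measurable_funM; last exact: measurable_gauss2r.
  exact: measurable_supdist2.
have sg0 x : (0 <= (supdist c x * gauss2 sigma c x)%:E)%E.
  by rewrite lee_fin mulr_ge0 ?gauss2_ge0 ?supdist_ge0.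
have mC := measurableC mab.
apply: (@le_trans _ _ (\int[mu2]_(x in ~` [set x : PT | (x.1 < x.2)%R]) (supdist c x * gauss2 sigma c x)%:E)%E).
  rewrite -ge0_integralZl//; last 2 first.
  - exact: measurable_funTS.
  - by rewrite lee_fin divr_ge0// subr_ge0.
  apply: ge0_le_integral => //.
  - by move=> x _; rewrite mule_ge0// lee_fin divr_ge0// subr_ge0.
  - by apply: emeasurable_funM => //; exact: measurable_funTS.
  - exact: measurable_funTS.
  - move=> x /negP; rewrite -leNgt => x21; rewrite -EFinM lee_fin ler_wpM2r ?gauss2_ge0//.
    have h1 : x.1 - c.1 <= supdist c x.
      by rewrite /supdist le_max distrC ler_norm.
    have h2 : c.2 - x.2 <= supdist c x.
      by rewrite /supdist le_max ler_norm orbT.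
    lra.
by apply: ge0_subset_integral.
Qed.

Lemma measurable_gauss2_mass sigma (A : set PT) : measurable A ->
  measurable_fun setT (fun c => \int[mu2]_(x in A) gauss2 sigma c x).
Proof.
move=> mA; apply: measurableT_comp; first exact: fine_measurable.
apply: (@measurable_param_int _ _ _ (plane_measure (R := R)) _ PT A
  (fun c x => (gauss2 sigma c x)%:E)) => //.
apply/measurable_EFinP; exact: measurable_gauss2.
Qed.

Lemma measurable_q_upper sigma : measurable_fun setT (q_upper sigma : PT -> R).
Proof. exact: measurable_gauss2_mass. Qed.

Lemma measurable_p_upper sigma :
  measurable_fun setT (fun r : PT * PT => p_upper sigma r.1 r.2).
Proof.
apply: measurable_funM; last first.
  exact: (measurableT_comp mind measurable_snd).
apply: measurable_funM; first exact: measurable_gauss2.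
rewrite (_ : (fun _ => _) = (fun r : PT * PT =>
    (\int[mu2]_(x in W R) gauss2 sigma r.1 x) `^ (-1))); last first.
  by apply/funext => r; rewrite powR_inv1// Rintegral_ge0// => x _; exact: gauss2_ge0.
apply: (measurableT_comp (measurable_powR _)).
by apply: (measurableT_comp (measurable_gauss2_mass sigma mW)).
Qed.

Definition W_mass sigma c : R := \int[mu2]_(x in W R) gauss2 sigma c x.

Lemma W_mass_kappa sigma c : 0 < sigma -> 0 <= c.1 -> c.1 <= c.2 -> kappa <= W_mass sigma c.
Proof. by move=> s0 c0 c12; rewrite -lee_fin gauss2_massE// kappa_le. Qed.

(** Renormalizing to W only divides by the mass of W, which [kappa_le] bounds from
    below. *)
Lemma int_W_indic (g : PT -> R) (k : R) (h : PT -> \bar R) : 0 <= k ->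
  measurable_fun setT g -> measurable_fun setT h ->
  (forall x, 0 <= g x) -> (forall x, 0 <= h x)%E ->
  (\int[mu2]_(x in W R) ((g x / k * \1_(W R) x)%:E * h x) =
   k^-1%:E * \int[mu2]_(x in W R) ((g x)%:E * h x))%E.
Proof.
move=> k0 mg' mh g0' h0; rewrite -ge0_integralZl//; first last.
- by rewrite lee_fin invr_ge0.
- by move=> x _; rewrite mule_ge0// lee_fin.
- by apply: measurable_funTS; apply: emeasurable_funM => //; exact/measurable_EFinP.
apply: eq_integral => x xW; rewrite indicE xW mulr1 EFinM [(_%:E * k^-1%:E)%E]muleC.
by rewrite muleA.
Qed.

Lemma p_upper_ge0 sigma c x : 0 <= p_upper sigma c x.
Proof.
rewrite mulr_ge0// divr_ge0 ?gauss2_ge0// Rintegral_ge0// => y _; exact: gauss2_ge0.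
Qed.

Lemma int_p_upper sigma c : 0 < sigma -> 0 <= c.1 -> c.1 <= c.2 ->
  (\int[mu2]_(x in W R) (p_upper sigma c x)%:E = 1)%E.
Proof.
move=> s0 c0 c12; have mk := lt_le_trans kappa_gt0 (W_mass_kappa s0 c0 c12).
have := @int_W_indic (gauss2 sigma c) (W_mass sigma c) (fun=> 1%E) (ltW mk).
move=> /(_ (measurable_gauss2r _ _) (measurable_cst _) (gauss2_ge0 _ _) (fun=> lee01)).
under eq_integral do rewrite mule1.
under [in RHS]eq_integral do rewrite mule1.
by move=> ->; rewrite -gauss2_massE// -EFinM mulVf ?gt_eqF.
Qed.

Lemma int_p_upper_supdist sigma c : 0 < sigma -> 0 <= c.1 -> c.1 <= c.2 ->
  (\int[mu2]_(x in W R) ((p_upper sigma c x)%:E * (supdist c x)%:E) <= (2 / kappa * sigma)%:E)%E.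
Proof.
move=> s0 c0 c12; have mk := W_mass_kappa s0 c0 c12.
have mk0 := lt_le_trans kappa_gt0 mk.
have msd : measurable_fun setT (fun x : PT => (supdist c x)%:E).
  by apply/measurable_EFinP; exact: measurable_supdist2.
rewrite (@int_W_indic (gauss2 sigma c) (W_mass sigma c) (fun x => (supdist c x)%:E))//; last 4 first.
- exact: ltW.
- exact: measurable_gauss2r.
- exact: gauss2_ge0.
- by move=> x; rewrite lee_fin supdist_ge0.
apply: (@le_trans _ _ ((kappa^-1)%:E * (2 * sigma)%:E)%E); last by rewrite -EFinM lee_fin; lra.
apply: lee_pmul.
- by rewrite lee_fin invr_ge0 ltW.
- by apply: integral_ge0 => x _; rewrite mule_ge0// lee_fin supdist_ge0.
- by rewrite lee_fin lef_pV2// posrE kappa_gt0.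
apply: le_trans (int_gauss2_supdist c s0).
under eq_integral do rewrite muleC -EFinM.
apply: ge0_subset_integral => //.
- apply/measurable_EFinP; apply: measurable_funM; last exact: measurable_gauss2r.
  exact: measurable_supdist2.
- by move=> x _; rewrite lee_fin mulr_ge0 ?supdist_ge0 ?gauss2_ge0.
Qed.

(** The projection of a center to the diagonal. *)
Definition mid c : PT := ((c.1 + c.2) / 2, (c.1 + c.2) / 2).

(** The mixture is, up to the factor 2, an average of the Gaussian densities around
    the projections of the centers. *)
Lemma lower_mixE sigma Dl x :
  lower_mix sigma Dl x = (size Dl)%:R^-1 * \sum_(c <- Dl) 2 * gauss2 sigma (mid c) x.
Proof.
congr (_ * _); apply: eq_bigr => c _; rewrite /gauss2 /mid /=.
rewrite (_ : (pi * sigma ^+ 2)^-1 = 2 * (2 * pi * sigma ^+ 2)^-1); first lra.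
by rewrite -[2 * pi * _]mulrA [(2 * _)^-1]invfM mulVKf.
Qed.

Lemma lower_mix_ge0 sigma Dl x : 0 <= lower_mix sigma Dl x.
Proof.
rewrite lower_mixE mulr_ge0// sumr_ge0// => c _.
by rewrite mulr_ge0 ?gauss2_ge0.
Qed.

Lemma measurable_lower_mix sigma :
  measurable_fun setT (fun r : seq PT * PT => lower_mix sigma r.1 r.2).
Proof.
under eq_fun do rewrite lower_mixE.
apply: measurable_funM.
  apply: (measurableT_comp (f := fun n => n%:R^-1 : R) (g := fun r : seq PT * PT => size r.1)) => //.
  exact: (measurableT_comp measurable_size).
rewrite (_ : (fun _ => _) = (fun r : PT * seq PT => foldr (fun c v =>
  2 * gauss2 sigma (mid c) r.1 + v)%R 0 r.2) \o (fun r => (r.2, r.1))); last first.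
  by apply/funext => -[D x] /=; elim: D => [|c D IH]; rewrite ?big_nil// big_cons IH.
apply: measurableT_comp; last by meas.
have H := @measurable_fun_foldr _ PT _ _ PT R
  (fun y c v => 2 * gauss2 sigma (mid c) y + v) (fun=> 0).
apply: H => //.
apply: measurable_funD => //; apply: measurable_funM => //.
apply: (measurableT_comp (measurable_gauss2 sigma) (g := fun r : PT * PT * R => (mid r.1.2, r.1.1))).
have m1 : measurable_fun setT (fun r : PT * PT * R => (r.1.2.1 + r.1.2.2) / 2).
  apply: measurable_funM => //; apply: measurable_funD.
    by apply: measurableT_comp => //; meas.
  by apply: measurableT_comp => //; meas.
by apply/measurable_fun_pair; [apply/measurable_fun_pair|meas].
Qed.

Let mlm sigma Dl : measurable_fun setT (lower_mix sigma Dl : PT -> R).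
Proof.
by apply: (measurableT_comp (measurable_lower_mix sigma) (g := fun x : PT => (Dl, x))); meas.
Qed.

Lemma measurable_p_lower sigma :
  measurable_fun setT (fun r : seq PT * PT => p_lower sigma r.1 r.2).
Proof.
apply: measurable_funM; last exact: (measurableT_comp mind measurable_snd).
apply: measurable_funM; first exact: measurable_lower_mix.
rewrite (_ : (fun _ => _) = (fun r : seq PT * PT =>
    (\int[mu2]_(x in W R) lower_mix sigma r.1 x) `^ (-1))); last first.
  by apply/funext => r; rewrite powR_inv1// Rintegral_ge0// => x _; exact: lower_mix_ge0.
apply: (measurableT_comp (measurable_powR _)).
apply: (measurableT_comp (f := fun D : seq PT => \int[mu2]_(x in W R) lower_mix sigma D x) _ measurable_fst).
apply: measurableT_comp; first exact: fine_measurable.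
apply: (@measurable_param_int _ _ _ (plane_measure (R := R)) _ (seq PT) (W R)
  (fun D x => (lower_mix sigma D x)%:E)) => //.
  apply/measurable_EFinP; exact: measurable_lower_mix.
by move=> D x; rewrite lee_fin lower_mix_ge0.
Qed.

Lemma p_lower_ge0 sigma Dl x : 0 <= p_lower sigma Dl x.
Proof.
rewrite mulr_ge0// divr_ge0 ?lower_mix_ge0// Rintegral_ge0// => y _; exact: lower_mix_ge0.
Qed.

Lemma p_lower_perm sigma Dl Dl' x : perm_eq Dl Dl' -> p_lower sigma Dl x = p_lower sigma Dl' x.
Proof.
rewrite /p_lower => DD'; have -> // : lower_mix sigma Dl = lower_mix sigma Dl'.
  by apply/funext => y; rewrite !lower_mixE (perm_size DD') (perm_big _ DD').
Qed.

Lemma int_lower_mix sigma Dl (h : PT -> \bar R) : measurable_fun setT h ->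
  (forall x, 0 <= h x)%E ->
  (\int[mu2]_(x in W R) ((lower_mix sigma Dl x)%:E * h x) =
  ((size Dl)%:R^-1 * 2)%:E *
   \sum_(c <- Dl) \int[mu2]_(x in W R) ((gauss2 sigma (mid c) x)%:E * h x))%E.
Proof.
move=> mh h0.
have m1 c : measurable_fun (W R) (fun x : PT => (gauss2 sigma (mid c) x)%:E * h x)%E.
  by apply: measurable_funTS; apply: emeasurable_funM; [exact: mg|exact: mh].
rewrite -ge0_integral_sum//; last by move=> c x _; rewrite mule_ge0.
rewrite -ge0_integralZl//; last 2 first.
- exact: emeasurable_sum.
- by move=> x _; apply: sume_ge0 => c _; rewrite mule_ge0.
apply: eq_integral => x _; rewrite lower_mixE -mulr_sumr mulrA EFinM -muleA; congr (_ * _)%E.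
by rewrite -sumEFin ge0_sume_distrl.
Qed.

Lemma mean_bounds Dl (I : PT -> \bar R) (lo hi : R) : Dl != [::] ->
  (forall c, c \in Dl -> lo%:E <= I c <= hi%:E)%E ->
  ((lo * 2)%:E <= ((size Dl)%:R^-1 * 2)%:E * \sum_(c <- Dl) I c <= (hi * 2)%:E)%E.
Proof.
move=> D0 HI.
have n0 : (0 < size Dl)%N by rewrite lt0n size_eq0.
have cn (v : R) : ((v * 2)%:E = ((size Dl)%:R^-1 * 2)%:E * \sum_(c <- Dl) v%:E)%E.
  rewrite sumEFin big_const_seq count_predT iter_addr addr0 -EFinM; congr (_%:E).
  by rewrite -[v *+ _]mulr_natl mulrAC mulKf// pnatr_eq0 -lt0n.
rewrite (cn lo) (cn hi); apply/andP; split; apply: lee_wpmul2l; rewrite ?lee_fin ?mulr_ge0 ?invr_ge0//;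
  rewrite big_seq [leRHS]big_seq; apply: lee_sum => c /HI /andP[]//.
Qed.

Lemma lower_mix_mass sigma Dl : 0 < sigma -> Dl != [::] ->
  (forall c, c \in Dl -> 0 <= c.1 /\ c.1 <= c.2) ->
  (\int[mu2]_(x in W R) lower_mix sigma Dl x)%:E = (\int[mu2]_(x in W R) (lower_mix sigma Dl x)%:E)%E /\
  2 * kappa <= \int[mu2]_(x in W R) lower_mix sigma Dl x.
Proof.
move=> s0 D0 Dc; have := int_lower_mix sigma Dl (measurable_cst 1%E) (fun=> lee01).
under eq_integral do rewrite mule1.
move=> E; have := @mean_bounds Dl (fun c => \int[mu2]_(x in W R) (gauss2 sigma (mid c) x)%:E)%E kappa 1 D0.
rewrite (eq_bigr (fun c => \int[mu2]_(x in W R) ((gauss2 sigma (mid c) x)%:E * cst 1 x))%E); last first.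
  by move=> c _; under [RHS]eq_integral do rewrite mule1.
rewrite -E => H; have /andP[H1 H2] : ((kappa * 2)%:E <= \int[mu2]_(x in W R) (lower_mix sigma Dl x)%:E <= (1 * 2)%:E)%E.
  apply: H => c /Dc[c1 c2]; rewrite kappa_le ?gauss2_mass//=; lra.
have Efin : (\int[mu2]_(x in W R) lower_mix sigma Dl x)%:E = (\int[mu2]_(x in W R) (lower_mix sigma Dl x)%:E)%E.
  rewrite /Rintegral fineK// ge0_fin_numE; last by apply: integral_ge0 => x _; rewrite lee_fin lower_mix_ge0.
  by rewrite (le_lt_trans H2)// ltry.
by split => //; rewrite -lee_fin Efin mulrC.
Qed.

Lemma int_p_lower sigma Dl : 0 < sigma -> Dl != [::] ->
  (forall c, c \in Dl -> 0 <= c.1 /\ c.1 <= c.2) ->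
  (\int[mu2]_(x in W R) (p_lower sigma Dl x)%:E = 1)%E.
Proof.
move=> s0 D0 Dc; have [E mk] := lower_mix_mass s0 D0 Dc.
have k0 : 0 < \int[mu2]_(x in W R) lower_mix sigma Dl x.
  by apply: lt_le_trans mk; rewrite mulr_gt0// kappa_gt0.
have := int_W_indic (ltW k0) (mlm sigma Dl) (measurable_cst 1%E) (lower_mix_ge0 sigma Dl) (fun=> lee01).
under eq_integral do rewrite mule1.
under [in RHS]eq_integral do rewrite mule1.
by move=> ->; rewrite -E -EFinM mulVf ?gt_eqF.
Qed.

Lemma int_p_lower_half_pers sigma Dl : 0 < sigma -> Dl != [::] ->
  (forall c, c \in Dl -> 0 <= c.1 /\ c.1 <= c.2) ->
  (\int[mu2]_(x in W R) ((p_lower sigma Dl x)%:E * (Num.max 0 ((x.2 - x.1) / 2))%:E) <=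
   (2 / kappa * sigma)%:E)%E.
Proof.
move=> s0 D0 Dc; have [E mk] := lower_mix_mass s0 D0 Dc.
have kp := kappa_gt0.
have k0 : 0 < \int[mu2]_(x in W R) lower_mix sigma Dl x.
  by apply: lt_le_trans mk; rewrite mulr_gt0.
pose h (x : PT) : R := Num.max 0 ((x.2 - x.1) / 2).
have mh : measurable_fun setT (fun x => (h x)%:E).
  apply/measurable_EFinP; apply: measurable_maxr => //.
  by apply: measurable_funM => //; apply: measurable_funB.
have h0 x : (0 <= (h x)%:E)%E by rewrite lee_fin le_max lexx.
rewrite (int_W_indic (ltW k0) (mlm sigma Dl) mh (lower_mix_ge0 sigma Dl) h0).
rewrite int_lower_mix//.
have Hc c : c \in Dl -> (0%:E <= \int[mu2]_(x in W R) ((gauss2 sigma (mid c) x)%:E * (h x)%:E) <= (2 * sigma)%:E)%E.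
  move=> /Dc[c1 c2]; apply/andP; split.
    by apply: integral_ge0 => x _; rewrite mule_ge0.
  apply: le_trans (int_gauss2_supdist (mid c) s0).
  have msg : measurable_fun setT (fun x : PT => (supdist (mid c) x * gauss2 sigma (mid c) x)%:E).
    apply/measurable_EFinP; apply: measurable_funM; last exact: measurable_gauss2r.
    exact: measurable_supdist2.
  have sg0 x : (0 <= (supdist (mid c) x * gauss2 sigma (mid c) x)%:E)%E.
    by rewrite lee_fin mulr_ge0 ?gauss2_ge0 ?supdist_ge0.
  apply: (@le_trans _ _ (\int[mu2]_(x in W R) (supdist (mid c) x * gauss2 sigma (mid c) x)%:E)%E); last first.
    by apply: ge0_subset_integral.
  apply: ge0_le_integral => //.
  - by move=> x _; rewrite mule_ge0.
  - by apply: measurable_funTS; apply: emeasurable_funM.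
  - exact: measurable_funTS.
  move=> x _; rewrite -EFinM lee_fin mulrC ler_wpM2r ?gauss2_ge0// /h ge_max supdist_ge0/=.
  have h1 : (mid c).1 - x.1 <= supdist (mid c) x by rewrite /supdist le_max ler_norm.
  have h2 : x.2 - (mid c).2 <= supdist (mid c) x.
    by rewrite supdistC /supdist le_max ler_norm orbT.
  rewrite /mid /= in h1 h2 *; lra.
have /andP[_ H] := mean_bounds D0 Hc.
apply: (@le_trans _ _ (((2 * kappa)^-1)%:E * (2 * sigma * 2)%:E)%E); last first.
  by rewrite -EFinM lee_fin invfM; lra.
apply: lee_pmul.
- by rewrite lee_fin invr_ge0 ltW.
- rewrite mule_ge0// ?lee_fin ?mulr_ge0 ?invr_ge0//; apply: sume_ge0 => c _.
  by apply: integral_ge0 => x _; rewrite mule_ge0.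
- by rewrite lee_fin lef_pV2// posrE mulr_gt0.
exact: H.
Qed.

End gaussian.

(** * Each operator costs O(sigma) *)

Lemma nneseriesZr_ereal {R : realType} (f : nat -> R) (a : \bar R) :
  (forall n, 0 <= f n) -> (0 <= a)%E ->
  (\sum_(n <oo) (f n)%:E * a = (\sum_(n <oo) (f n)%:E) * a)%E.
Proof.
move=> f0 a0; under eq_eseriesr do rewrite muleC.
have f0' n : (0 <= (f n)%:E)%E by rewrite lee_fin.
have af0 n : (0 <= a * (f n)%:E)%E by rewrite mule_ge0.
by rewrite -(ge0_integral_count af0) ge0_integralZl// ge0_integral_count// muleC.
Qed.

Section near.
Context {R : realType}.
Local Open Scope ereal_scope.
Implicit Types a b c : \bar R.

(** Closeness as two additions, since subtraction is badly behaved on extended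
    reals. *)
Definition near a b (e : R) := a <= b + e%:E /\ b <= a + e%:E.

Lemma near_trans a b c e1 e2 : near a b e1 -> near b c e2 -> near a c (e1 + e2).
Proof.
move=> [ab ba] [bc cb]; split; rewrite EFinD.
  rewrite [e1%:E + _]addeC addeA; apply: (le_trans ab).
  by apply: leeD => //.
by rewrite addeA; apply: (le_trans cb); apply: leeD.
Qed.

Lemma near_le a b (e e' : R) : (e <= e')%R -> near a b e -> near a b e'.
Proof.
move=> ee' [ab ba]; split; [apply: (le_trans ab)|apply: (le_trans ba)];
by apply: leeD => //; rewrite lee_fin.
Qed.

Lemma near_refl a (e : R) : (0 <= e)%R -> near a a e.
Proof. by move=> e0; split; rewrite leeDl// lee_fin. Qed.

End near.

Section estimates.
Context {R : realType} (dg : nat) (sigma : R) (m : R) (nu : nat -> nat -> R).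
Notation E := (feature R).
Notation PT := (measurableTypeR R * measurableTypeR R)%type.
Hypotheses (s0 : 0 < sigma) (nu_law : lower_count_law m nu).
Local Open Scope ereal_scope.
Notation upop := (upop (q_upper sigma) (p_upper sigma)).
Notation upops := (upops (q_upper sigma) (p_upper sigma)).
Notation push := (push (p_lower sigma)).
Notation lowop := (lowop (p_lower sigma) nu).
Notation WD := (Wdeg R dg).

Let nu0 L n : (0 <= nu L n)%R. Proof. by case: (nu_law L). Qed.
Let mq := @measurable_q_upper R sigma.
Let mp := @measurable_p_upper R sigma.
Let mpl := @measurable_p_lower R sigma.
Let q0 := @q_upper_ge0 R sigma.
Let q1 c := @q_upper_le1 R sigma c s0.
Let p0 := @p_upper_ge0 R sigma.
Let pl0 := @p_lower_ge0 R sigma.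
Let mWk := @measurable_Wk R.

Lemma int_Wk k (g : E -> \bar R) : measurable_fun setT g -> (forall x, 0 <= g x) ->
  \int[fmu]_(x in Wk k) g x = \int[lebesgue2 R]_(y in W R) g (y, k).
Proof.
move=> mg g0; rewrite integral_mkcond integral_fmu; last 2 first.
- by apply/(measurable_restrictT g (mWk k)); exact: measurable_funTS.
- by move=> x; exact: erestrict_ge0.
have E j : j != k -> \int[lebesgue2 R]_y (g \_ (Wk k)) (y, j) = 0.
  move=> jk; apply: integral0_eq => y _; rewrite patchE ifF//.
  by apply/negbTE/negP => /set_mem [_ /= jkE]; rewrite jkE eqxx in jk.
rewrite (@eseries_fin _ _ k.+1); last 2 first.
- by move=> j; apply: integral_ge0 => y _; exact: erestrict_ge0.
- by move=> j kj; apply: E; rewrite gt_eqF.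
rewrite big_ord_recr /= big1 ?add0e; last by move=> i _; apply: E; rewrite ltn_eqF.
rewrite [RHS]integral_mkcond; apply: eq_integral => y _; rewrite !patchE.
congr (if _ then _ else _); apply/idP/idP => /set_mem; first by case=> ? _; exact/mem_set.
by move=> ?; apply/mem_set.
Qed.

Section average.
Variables (k : nat) (w : E -> R).
Hypotheses (mw : measurable_fun setT w) (w0 : forall x, (0 <= w x)%R)
  (w1 : \int[fmu]_(x in Wk k) (w x)%:E = 1).

Let mwE : measurable_fun setT (EFin \o w). Proof. exact/measurable_EFinP. Qed.

(** Averaging a pointwise bound against a density w on the features of degree k. *)
Lemma average_le (g h e : E -> \bar R) :
  measurable_fun setT g -> measurable_fun setT h -> measurable_fun setT e ->
  (forall x, 0 <= g x) -> (forall x, 0 <= h x) -> (forall x, 0 <= e x) ->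
  (forall x, Wk k x -> g x <= h x + e x) ->
  \int[fmu]_(x in Wk k) ((w x)%:E * g x) <=
  \int[fmu]_(x in Wk k) ((w x)%:E * h x) + \int[fmu]_(x in Wk k) ((w x)%:E * e x).
Proof.
move=> mg mh me g0 h0 e0 ghe.
have w0' x : 0 <= (w x)%:E by rewrite lee_fin.
rewrite -ge0_integralD//; last 4 first.
- by move=> x _; rewrite mule_ge0.
- by apply: measurable_funTS; exact: emeasurable_funM.
- by move=> x _; rewrite mule_ge0.
- by apply: measurable_funTS; exact: emeasurable_funM.
apply: ge0_le_integral => //.
- by move=> x _; rewrite mule_ge0.
- by apply: measurable_funTS; exact: emeasurable_funM.
- by apply: measurable_funTS; apply: emeasurable_funD; exact: emeasurable_funM.
- by move=> x Wx; rewrite -ge0_muleDr//; apply: lee_wpmul2l => //; exact: ghe.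
Qed.

Lemma average_cst (a : \bar R) : 0 <= a -> \int[fmu]_(x in Wk k) ((w x)%:E * a) = a.
Proof.
move=> a0; under eq_integral do rewrite muleC.
rewrite ge0_integralZl//; first by rewrite w1 mule1.
- by apply: measurable_funTS.
- by move=> x _; rewrite lee_fin.
Qed.

End average.

Let w_up c (x : E) : R := p_upper sigma c x.1.
Let w_low Dl (x : E) : R := p_lower sigma Dl x.1.

Let mw_up c : measurable_fun setT (w_up c).
Proof. by apply: (measurableT_comp (g := fun x : E => (c, x.1)) mp); meas. Qed.

Let mw_low Dl : measurable_fun setT (w_low Dl).
Proof. by apply: (measurableT_comp (g := fun x : E => (Dl, x.1)) mpl); meas. Qed.

Let w_up0 c x : (0 <= w_up c x)%R. Proof. exact: p0. Qed.
Let w_low0 Dl x : (0 <= w_low Dl x)%R. Proof. exact: pl0. Qed.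

Let W_le c : W R c -> (0 <= c.1 /\ c.1 <= c.2)%R.
Proof. by move=> [? /ltW]. Qed.

Lemma w_up1 k c : W R c -> \int[fmu]_(x in Wk k) (w_up c x)%:E = 1.
Proof.
move=> /W_le[c0 c12]; rewrite int_Wk; first exact: int_p_upper.
- exact/measurable_EFinP.
- by move=> x; rewrite lee_fin p0.
Qed.

Lemma w_low1 k Dl : Dl != [::] -> (forall c, c \in Dl -> W R c) ->
  \int[fmu]_(x in Wk k) (w_low Dl x)%:E = 1.
Proof.
move=> D0 DW; rewrite int_Wk; first by apply: int_p_lower => // c /DW/W_le.
- exact/measurable_EFinP.
- by move=> x; rewrite lee_fin pl0.
Qed.

Let msd c : measurable_fun setT (fun x : E => (supdist c x.1)%:E).
Proof. by apply/measurable_EFinP; apply: measurable_supdist => //; meas. Qed.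

Let hp (x : E) : R := Num.max 0%R (half_pers x).

Let mhp : measurable_fun setT (EFin \o hp).
Proof.
apply/measurable_EFinP; apply: measurable_maxr => //; apply: measurable_funM => //.
by apply: measurable_funB; apply: measurableT_comp => //; meas.
Qed.

Let hpE x : Wdeg R dg x -> half_pers x = hp x.
Proof. by move=> [[_ /ltW x12] _]; rewrite /hp max_r// divr_ge0// subr_ge0. Qed.

Let hp0 x : (0 <= hp x)%R. Proof. by rewrite le_max lexx. Qed.

(** The constant of the bounds on the displacement of an upper feature and on the
    persistence of a lower feature, both of order sigma. *)
Definition spread : R := (2 / kappa)%R.

Lemma spread_gt0 : (0 < spread)%R.
Proof. by rewrite divr_gt0// kappa_gt0. Qed.

Let Bs0 : (0 <= spread * sigma)%R. Proof. by rewrite mulr_ge0 ?ltW// spread_gt0. Qed.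

Lemma w_up_supdist k c : W R c ->
  \int[fmu]_(x in Wk k) ((w_up c x)%:E * (supdist c x.1)%:E) <= (spread * sigma)%:E.
Proof.
move=> /W_le[c0 c12]; rewrite int_Wk; first exact: int_p_upper_supdist.
- apply: emeasurable_funM => //; exact/measurable_EFinP.
- by move=> x; rewrite mule_ge0// lee_fin ?supdist_ge0// p0.
Qed.

Lemma w_low_hp k Dl : Dl != [::] -> (forall c, c \in Dl -> W R c) ->
  \int[fmu]_(x in Wk k) ((w_low Dl x)%:E * (hp x)%:E) <= (spread * sigma)%:E.
Proof.
move=> D0 DW; rewrite int_Wk; first by apply: int_p_lower_half_pers => // c /DW/W_le.
- apply: emeasurable_funM => //; exact/measurable_EFinP.
- by move=> x; rewrite mule_ge0// lee_fin// pl0.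
Qed.

Let meas0 (G : seq E -> \bar R) := measurable_fun setT G /\ forall s, 0 <= G s.

Let mcons (G : seq E -> \bar R) t : measurable_fun setT G ->
  measurable_fun setT (fun x : E => G (x :: t)).
Proof. by move=> mG; apply: (measurableT_comp mG); meas. Qed.

(** Operators that average over the features they insert: they preserve uniform
    upper bounds, and they do not touch the features already in the list. *)
Definition markov_op (T : (seq E -> \bar R) -> seq E -> \bar R) := [/\
  forall G, nice G -> nice (T G),
  forall G x s, symmetric_fun G -> T G (x :: s) = T (fun r => G (x :: r)) s &
  forall G H (d : R), meas0 G -> meas0 H -> (0 <= d)%R ->
    (forall s, over WD s -> G s <= H s + d%:E) ->
    forall s, over WD s -> T G s <= T H s + d%:E].

Lemma half_pers_ge0 x : WD x -> (0 <= half_pers x)%R.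
Proof. by move=> /hpE ->. Qed.

(** For a fixed feature x, the operator acts on the functional with x prepended, so
    a bound between two such functionals is inherited. *)
Lemma markov_lip T G : markov_op T -> nice G -> lip_bounds dg G -> lip_bounds dg (T G).
Proof.
move=> [_ Tsh Tm] [mG G0 Gs] [L1 L2 L3].
have m0 x : meas0 (fun r => G (x :: r)) by split => //; exact: measurable_shift1.
split.
- move=> x x' s Wx Wx' xx' Ws; rewrite !Tsh//; apply: Tm => //.
    exact: supdist_ge0.
  by move=> r Wr; exact: L1.
- move=> x s Wx Ws; rewrite !Tsh//; apply: Tm => //; first exact: half_pers_ge0.
  by move=> r Wr; exact: L2.
- move=> x s Wx Ws; rewrite !Tsh//; apply: Tm => //; first exact: half_pers_ge0.
  by move=> r Wr; exact: L3.
Qed.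

Let q1' c : 0 <= (1 - q_upper sigma c)%:E. Proof. by rewrite lee_fin subr_ge0 q1. Qed.
Let q0' c : 0 <= (q_upper sigma c)%:E. Proof. by rewrite lee_fin q0. Qed.

Lemma mix_le c (a b a' b' : \bar R) (d e : R) : 0 <= a' -> 0 <= b' -> (0 <= d)%R -> (0 <= e)%R ->
  a <= a' + d%:E -> b <= b' + e%:E ->
  (1 - q_upper sigma c)%:E * a + (q_upper sigma c)%:E * b <=
  (1 - q_upper sigma c)%:E * a' + (q_upper sigma c)%:E * b' +
  ((1 - q_upper sigma c) * d + q_upper sigma c * e)%:E.
Proof.
move=> a0 b0 d0 e0 aa' bb'.
rewrite [(_ * d + _)%:E]EFinD !EFinM addeACA.
rewrite -(@ge0_muleDr _ _ _ d%:E)// -(@ge0_muleDr _ _ _ e%:E)//.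
by apply: leeD; apply: lee_wpmul2l.
Qed.

Lemma mix_cst c (a : \bar R) : 0 <= a ->
  (1 - q_upper sigma c)%:E * a + (q_upper sigma c)%:E * a = a.
Proof. by move=> a0; rewrite -ge0_muleDl// -EFinD subrK mul1e. Qed.

Lemma upop_markov k c : (k < dg)%N -> W R c -> markov_op (upop k c).
Proof.
move=> kd Wc; split.
- by move=> G; exact: upop_nice.
- move=> G x s Gs; rewrite !upopE; congr (_ + _ * _).
  apply: eq_integral => y _; congr (_ * _); apply: Gs.
  by rewrite -[y :: x :: s]/([:: y] ++ [:: x] ++ s) perm_catCA.
- move=> G H d [mG G0] [mH H0] d0 GH s Ws.
  have I0 (F : seq E -> \bar R) : (forall s, 0 <= F s) ->
      0 <= \int[fmu]_(x in Wk k) ((p_upper sigma c x.1)%:E * F (x :: s)).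
    by move=> F0; apply: integral_ge0 => x _; rewrite mule_ge0// lee_fin p0.
  have -> : d = ((1 - q_upper sigma c) * d + q_upper sigma c * d)%R by rewrite -mulrDl subrK mul1r.
  apply: mix_le => //; [exact: I0|exact: GH|].
  rewrite -[X in _ + X](average_cst (mw_up c) (w_up0 c) (w_up1 k Wc)) ?lee_fin//.
  apply: (average_le (mw_up c) (w_up0 c)) => //; try exact: mcons.
  by move=> x [Wx xk]; apply: GH; apply/over_cons; split => //; split => //; rewrite xk.
Qed.

Lemma iter_push_cons k Dl n G x s : symmetric_fun G ->
  iter n (push k Dl) G (x :: s) = iter n (push k Dl) (fun r => G (x :: r)) s.
Proof.
move=> Gs; elim: n s => // n IH s /=.
apply: eq_integral => y _; congr (_ * _).
rewrite -[RHS]IH; apply: (@iter_push_sym R (p_lower sigma) k Dl n G Gs).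
by rewrite -[y :: x :: s]/([:: y] ++ [:: x] ++ s) perm_catCA.
Qed.

Let miter k Dl n G : meas0 G -> meas0 (iter n (push k Dl) G).
Proof.
move=> [mG G0]; split; last by move=> s; exact: iter_push_ge0.
have H := @measurable_iter_push R (p_lower sigma) mpl pl0 _ unit k (fun=> Dl) (fun=> G) n.
have {}H := H (measurable_cst _) (measurableT_comp mG measurable_snd) (fun _ => G0).
by apply: (measurableT_comp (g := fun s : seq E => (tt, s)) H); meas.
Qed.

Lemma iter_push_markov k Dl n G H (d : R) : (k < dg)%N -> Dl != [::] ->
  (forall c, c \in Dl -> W R c) -> meas0 G -> meas0 H -> (0 <= d)%R ->
  (forall s, over WD s -> G s <= H s + d%:E) ->
  forall s, over WD s -> iter n (push k Dl) G s <= iter n (push k Dl) H s + d%:E.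
Proof.
move=> kd D0 DW mG mH d0 GH; elim: n => [//|n IH] s Ws /=.
have [mG' G0'] := miter k Dl n mG; have [mH' H0'] := miter k Dl n mH.
rewrite -[X in _ + X](average_cst (mw_low Dl) (w_low0 Dl) (w_low1 k D0 DW)) ?lee_fin//.
apply: (average_le (mw_low Dl) (w_low0 Dl)) => //; try exact: mcons.
by move=> x [Wx xk]; apply: IH; apply/over_cons; split => //; split => //; rewrite xk.
Qed.

(** Without lower centers the bound on the support forces the point mass at 0.  This
    case is separate because p_lower is then not a density. *)
Lemma nu_nil n : nu 0 n = if n == 0%N then 1%R else 0%R.
Proof.
have [_ S _ Z] := nu_law 0%N.
have nu_pos j : (0 < j)%N -> nu 0 j = 0%R by move=> j0; apply: Z; rewrite mulr0 ltr0n.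
case: n => [|n] /=; last exact: nu_pos.
apply/EFin_inj; rewrite -S nneseries_recl//; last by move=> j; rewrite lee_fin.
by rewrite eseries0 ?adde0// => j j0 _; rewrite nu_pos.
Qed.

Lemma lowop_nil k G t : (forall s, 0 <= G s) -> lowop k [::] G t = G t.
Proof.
move=> G0; rewrite lowopE nneseries_recl//; last first.
  by move=> j; rewrite mule_ge0 ?lee_fin ?iter_push_ge0.
rewrite /= nu_nil mul1e eseries0 ?adde0// => -[//|j] _ _.
by rewrite nu_nil mul0e.
Qed.

Lemma lowop_cst (Dl : seq PT) (a : \bar R) : 0 <= a ->
  \sum_(n <oo) (nu (size Dl) n)%:E * a = a.
Proof.
by move=> a0; rewrite nneseriesZr_ereal//; have [_ -> _ _] := nu_law (size Dl); rewrite mul1e.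
Qed.

Lemma lowop_le (Dl : seq PT) (a b : nat -> \bar R) (d : R) : (0 <= d)%R ->
  (forall n, 0 <= a n) -> (forall n, 0 <= b n) -> (forall n, a n <= b n + (n%:R * d)%:E) ->
  \sum_(n <oo) (nu (size Dl) n)%:E * a n <=
  \sum_(n <oo) (nu (size Dl) n)%:E * b n + (d * (size Dl)%:R)%:E.
Proof.
move=> d0 a0 b0 ab.
have nu0' n : 0 <= (nu (size Dl) n)%:E by rewrite lee_fin.
have [_ _ mean _] := nu_law (size Dl).
rewrite EFinM -mean muleC -nneseriesZr_ereal ?lee_fin//; last by move=> n; rewrite mulr_ge0.
rewrite -nneseriesD; last 2 first.
- by move=> n _; rewrite mule_ge0.
- by move=> n _; rewrite mule_ge0// lee_fin ?mulr_ge0.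
apply: lee_nneseries => n _; first by rewrite mule_ge0.
rewrite EFinM [n%:R%:E * _]muleC -muleA -ge0_muleDr// ?lee_fin ?mulr_ge0//.
by apply: lee_wpmul2l => //; rewrite -EFinM.
Qed.

Lemma lowop_markov k Dl : (k < dg)%N -> (forall c, c \in Dl -> W R c) ->
  markov_op (lowop k Dl).
Proof.
move=> kd DW; split.
- by move=> G; apply: lowop_nice.
- move=> G x s Gs; apply: eq_eseriesr => n _; congr (_ * _); exact: iter_push_cons.
move=> G H d [mG G0] [mH H0] d0 GH s Ws.
have [->|D0] := eqVneq Dl [::]; first by rewrite !lowop_nil//; exact: GH.
rewrite -[X in _ + X](lowop_cst Dl (a := d%:E)) ?lee_fin// -nneseriesD; last 2 first.
- by move=> n _; rewrite mule_ge0 ?lee_fin ?iter_push_ge0.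
- by move=> n _; rewrite mule_ge0 ?lee_fin.
apply: lee_nneseries => n _; first by rewrite mule_ge0 ?lee_fin ?iter_push_ge0.
rewrite -ge0_muleDr ?iter_push_ge0 ?lee_fin//.
by apply: lee_wpmul2l; rewrite ?lee_fin//; apply: (iter_push_markov n kd D0 DW _ _ d0 GH).
Qed.

Definition lip_nice (G : seq E -> \bar R) := nice G /\ lip_bounds dg G.

(** The center survives with weight q, moved by O(sigma) on average, or is dropped
    with weight 1 - q, at a cost that [q_upper_half_pers] bounds. *)
Lemma upop_near k c G t : (k < dg)%N -> W R c -> lip_nice G -> over WD t ->
  near (upop k c G t) (G ((c, k) :: t)) ((2 + spread) * sigma).
Proof.
move=> kd Wc [[mG G0 Gs] [L1 L2 L3]] Wt.
have Wck : WD (c, k) by split.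
have h0 := half_pers_ge0 Wck.
have I0 : 0 <= \int[fmu]_(x in Wk k) ((p_upper sigma c x.1)%:E * G (x :: t)).
  by apply: integral_ge0 => x _; rewrite mule_ge0// lee_fin p0.
have WkW x : Wk k x -> WD x by move=> [? xk]; split => //; rewrite xk.
have sd0 x : 0 <= (supdist c x)%:E by rewrite lee_fin supdist_ge0.
have bd : ((1 - q_upper sigma c) * half_pers (c, k) + q_upper sigma c * (spread * sigma) <= (2 + spread) * sigma)%R.
  rewrite [leRHS]mulrDl; apply: lerD; first by apply: q_upper_half_pers => //; case: (W_le Wc).
  by rewrite -[leRHS]mul1r ler_wpM2r ?q1.
have avg := average_le (mw_up c) (w_up0 c) (k := k).
have cst := average_cst (mw_up c) (w_up0 c) (w_up1 k Wc).
apply: (near_le bd); split.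
  rewrite -[X in X + _](mix_cst c (G0 ((c, k) :: t))).
  apply: mix_le => //; first exact: L2.
  apply: le_trans (avg (fun x => G (x :: t)) (fun=> G ((c, k) :: t))
    (fun x => (supdist c x.1)%:E) _ _ _ _ _ _ _) _ => //.
  - exact: mcons.
  - by move=> x Wx; apply: (L1 (c, k) x t) => //; [exact: WkW|case: Wx].
  - by rewrite cst//; apply: leeD => //; exact: w_up_supdist.
rewrite -[X in X <= _](mix_cst c (G0 ((c, k) :: t))).
apply: mix_le => //; first exact: L3.
rewrite -[X in X <= _](cst _ (G0 ((c, k) :: t))).
apply: le_trans (avg (fun=> G ((c, k) :: t)) (fun x => G (x :: t))
    (fun x => (supdist c x.1)%:E) _ _ _ _ _ _ _) _ => //.
- exact: mcons.
- move=> x Wx; rewrite supdistC; apply: (L1 x (c, k) t) => //; first exact: WkW.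
  by case: Wx.
- by apply: leeD => //; exact: w_up_supdist.
Qed.

(** Each inserted lower feature has expected persistence O(sigma). *)
Lemma iter_push_near k Dl n G t : (k < dg)%N -> Dl != [::] ->
  (forall c, c \in Dl -> W R c) -> lip_nice G -> over WD t ->
  near (iter n (push k Dl) G t) (G t) (n%:R * (spread * sigma)).
Proof.
move=> kd D0 DW [[mG G0 Gs] [L1 L2 L3]].
have WkW x : Wk k x -> WD x by move=> [? xk]; split => //; rewrite xk.
have avg := average_le (mw_low Dl) (w_low0 Dl) (k := k).
have cst := average_cst (mw_low Dl) (w_low0 Dl) (w_low1 k D0 DW).
elim: n t => [|n IH] t Wt; first by apply: near_refl; rewrite mul0r.
have [mG' G0'] := miter k Dl n (conj mG G0).
pose e (x : E) := (hp x + n%:R * (spread * sigma))%:E.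
have me : measurable_fun setT e.
  by apply/measurable_EFinP; apply: measurable_funD => //; exact/measurable_EFinP.
have e0 x : 0 <= e x by rewrite lee_fin addr_ge0// mulr_ge0.
have Ie : \int[fmu]_(x in Wk k) ((w_low Dl x)%:E * e x) <= (n.+1%:R * (spread * sigma))%:E.
  have nB0 : 0 <= (n%:R * (spread * sigma))%:E by rewrite lee_fin mulr_ge0.
  apply: le_trans (avg e (EFin \o hp) (fun=> (n%:R * (spread * sigma))%:E) _ _ _ _ _ _ _) _ => //.
  rewrite cst// -natr1 mulrDl addrC mul1r EFinD; apply: leeD => //.
  exact: w_low_hp.
have Wxt x : Wk k x -> over WD (x :: t) by move=> Wx; apply/over_cons; split => //; exact: WkW.
split => /=.
  apply: le_trans (avg (fun x => iter n (push k Dl) G (x :: t)) (fun=> G t) e _ _ _ _ _ _ _) _ => //.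
  - exact: mcons.
  - move=> x Wx; have [H _] := IH _ (Wxt x Wx); apply: (le_trans H).
    rewrite /e EFinD addeA; apply: leeD => //.
    by rewrite -hpE; [apply: L3 => //; exact: WkW|exact: WkW].
  - by rewrite cst//; apply: leeD.
rewrite -[X in X <= _](cst _ (G0 t)).
apply: le_trans (avg (fun=> G t) (fun x => iter n (push k Dl) G (x :: t)) e _ _ _ _ _ _ _) _ => //.
- exact: mcons.
- move=> x Wx; have [_ H] := IH _ (Wxt x Wx).
  apply: (le_trans (L2 x t (WkW _ Wx) Wt)).
  rewrite /e (addrC (hp x)) EFinD addeA -hpE; last exact: WkW.
  by apply: leeD.
- by apply: leeD.
Qed.

(** The mean number of lower features is the number of lower centers. *)
Lemma lowop_near k Dl G t : (k < dg)%N -> (forall c, c \in Dl -> W R c) ->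
  lip_nice G -> over WD t ->
  near (lowop k Dl G t) (G t) (spread * sigma * (size Dl)%:R).
Proof.
move=> kd DW LG Wt; have [[mG G0 Gs] _] := LG.
have [->|D0] := eqVneq Dl [::].
  by rewrite lowop_nil//; apply: near_refl; rewrite mulr0.
have it0 n : 0 <= iter n (push k Dl) G t by exact: iter_push_ge0.
split.
  rewrite -[X in X + _](lowop_cst Dl (G0 t)); apply: lowop_le => // n.
  by have [] := iter_push_near n kd D0 DW LG Wt.
rewrite -[X in X <= _](lowop_cst Dl (G0 t)); apply: lowop_le => // n.
by have [] := iter_push_near n kd D0 DW LG Wt.
Qed.

Lemma lip_nice_op T G : markov_op T -> lip_nice G -> lip_nice (T G).
Proof.
move=> mT [nG lG]; split; last exact: markov_lip.
by case: mT => H _ _; exact: H.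
Qed.

Lemma upops_lip k Du G : (k < dg)%N -> (forall c, c \in Du -> W R c) ->
  lip_nice G -> lip_nice (upops k Du G).
Proof.
move=> kd + LG; elim: Du => [//|c Du IH] DW.
have Wc : W R c by apply: DW; rewrite mem_head.
apply: (lip_nice_op (upop_markov kd Wc)).
by apply: IH => c' c'D; apply: DW; rewrite inE c'D orbT.
Qed.

Let at_degree k (D : seq PT) : seq E := [seq (c, k) | c <- D].

Let at_degree_over k D : (k < dg)%N -> (forall c, c \in D -> W R c) -> over WD (at_degree k D).
Proof. by move=> kd DW x /mapP[c /DW Wc ->]; split. Qed.

Let over_cat s t : over WD s -> over WD t -> over WD (s ++ t).
Proof. by move=> Ws Wt x; rewrite mem_cat => /orP[/Ws|/Wt]. Qed.

Lemma upops_near k Du G t : (k < dg)%N -> (forall c, c \in Du -> W R c) ->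
  lip_nice G -> over WD t ->
  near (upops k Du G t) (G (at_degree k Du ++ t)) ((2 + spread) * sigma * (size Du)%:R).
Proof.
move=> kd + LG; elim: Du t => [|c Du IH] t DW Wt.
  by apply: near_refl; rewrite mulr0.
have Wc : W R c by apply: DW; rewrite mem_head.
have DW' c' : c' \in Du -> W R c' by move=> c'D; apply: DW; rewrite inE c'D orbT.
have [[_ _ Gs] _] := LG.
have H1 := upop_near kd Wc (upops_lip kd DW' LG) Wt.
have H2 : near _ _ _ := IH ((c, k) :: t) DW' _.
rewrite (symmetric_middle _ _ _ Gs) in H2.
apply: near_le (near_trans H1 (H2 _)).
  by rewrite -[X in (X + _)%R]mulr1 -mulrDr nat1r.
by apply/over_cons; split => //; split.
Qed.

(** The lower centers are within sigma of the diagonal, so they can be put back. *)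
Lemma delete_near k Dl G t : (k < dg)%N ->
  (forall c, c \in Dl -> W R c /\ (c.2 - c.1 < sigma)%R) -> lip_nice G -> over WD t ->
  near (G t) (G (at_degree k Dl ++ t)) (sigma * (size Dl)%:R).
Proof.
move=> kd + [_ [_ L2 L3]] Wt; elim: Dl => [|c Dl IH] DW.
  by apply: near_refl; rewrite mulr0.
have [Wc cs] : W R c /\ (c.2 - c.1 < sigma)%R by apply: DW; rewrite mem_head.
have DW' c' : c' \in Dl -> W R c' /\ (c'.2 - c'.1 < sigma)%R.
  by move=> c'D; apply: DW; rewrite inE c'D orbT.
apply: near_le (near_trans (IH DW') (_ : near _ _ sigma)).
  by rewrite -[X in (_ + X)%R]mulr1 -mulrDr natr1.
have Wck : WD (c, k) by split.
have Wr : over WD (at_degree k Dl ++ t).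
  by apply: over_cat => //; apply: at_degree_over => // c' /DW'[].
have hps : (half_pers (c, k) <= sigma)%R.
  by rewrite /half_pers /=; have := s0; lra.
by apply: (near_le hps); split; [exact: L2|exact: L3].
Qed.

End estimates.

(** * Mean deviation of a kernel and of the density estimate *)

Section kernel_operators.
Context {R : realType} (dg : nat) (sigma : R) (m : R) (nu : nat -> nat -> R).
Notation E := (feature R).
Notation PT := (measurableTypeR R * measurableTypeR R)%type.
Hypotheses (s0 : 0 < sigma) (nu_law : lower_count_law m nu).
Local Open Scope ereal_scope.
Notation degop := (degop sigma (q_upper sigma) (p_upper sigma) (p_lower sigma) nu).
Notation totop := (totop sigma (q_upper sigma) (p_upper sigma) (p_lower sigma) nu).
Notation multikern := (multikern sigma (q_upper sigma) (p_upper sigma) (p_lower sigma) nu).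
Notation WD := (Wdeg R dg).
Notation upops := (upops (q_upper sigma) (p_upper sigma)).
Notation lowop := (lowop (p_lower sigma) nu).

Let nu0 L n : (0 <= nu L n)%R. Proof. by case: (nu_law L). Qed.
Let mq := @measurable_q_upper R sigma.
Let mp := @measurable_p_upper R sigma.
Let mpl := @measurable_p_lower R sigma.
Let q0 := @q_upper_ge0 R sigma.
Let q1 c := @q_upper_le1 R sigma c s0.
Let p0 := @p_upper_ge0 R sigma.
Let pl0 := @p_lower_ge0 R sigma.
Let plperm := @p_lower_perm R sigma.

Lemma degree_part_W k (z : seq E) c : over WD z -> c \in degree_part k z -> W R c.
Proof. by move=> Wz /mapP[x]; rewrite mem_filter => /andP[_ /Wz[Wx _]] ->. Qed.

Lemma degree_part_features k (z : seq E) :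
  [seq (c, k) | c <- degree_part k z] = [seq x <- z | x.2 == k].
Proof.
rewrite /degree_part -map_comp -[RHS]map_id; apply/eq_in_map => -[x j].
by rewrite mem_filter /= => /andP[/eqP ->].
Qed.

Let A : R := (spread + 3)%R.

Let up k (z : seq E) : seq PT := upper sigma (degree_part k z).
Let lo k (z : seq E) : seq PT := lower sigma (degree_part k z).

Let upW k z c : over WD z -> c \in up k z -> W R c.
Proof. by move=> Wz; rewrite mem_filter => /andP[_]; exact: degree_part_W. Qed.

Let loW k z c : over WD z -> c \in lo k z -> W R c /\ (c.2 - c.1 < sigma)%R.
Proof.
by move=> Wz; rewrite mem_filter => /andP[cs cz]; split => //; exact: degree_part_W cz.
Qed.

Let loW' k z c : over WD z -> c \in lo k z -> W R c.
Proof. by move=> Wz /(loW Wz)[]. Qed.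

Let up_lo k z : perm_eq (lo k z ++ up k z) (degree_part k z).
Proof.
rewrite /lo /up /lower /upper perm_catC.
rewrite (_ : [seq c <- degree_part k z | (c.2 - c.1 < sigma)%R] =
  [seq c <- degree_part k z | ~~ (sigma <= c.2 - c.1)%R]); last first.
  by apply: eq_filter => c; rewrite ltNge.
by rewrite perm_filterC.
Qed.

Lemma degop_lip k z G : (k < dg)%N -> over WD z -> lip_nice dg G -> lip_nice dg (degop k z G).
Proof.
move=> kd Wz LG; apply: (upops_lip s0 kd) => [c|]; first exact: upW.
apply: lip_nice_op LG; apply: (lowop_markov s0 nu_law kd).
by move=> c; exact: loW'.
Qed.

(** The upper features are moved back to their centers, the lower features are
    deleted, and the lower centers are put back. *)
Lemma degop_near k z G t : (k < dg)%N -> over WD z -> lip_nice dg G -> over WD t ->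
  near (degop k z G t) (G ([seq x <- z | x.2 == k] ++ t))
    (A * sigma * (size [seq x <- z | x.2 == k])%:R).
Proof.
move=> kd Wz LG Wt.
have uW c : c \in up k z -> W R c by exact: upW.
have lW c : c \in lo k z -> W R c by exact: loW'.
have lW2 c : c \in lo k z -> W R c /\ (c.2 - c.1 < sigma)%R by exact: loW.
have L1 : lip_nice dg (lowop k (lo k z) G).
  by apply: lip_nice_op LG; exact: (lowop_markov s0 nu_law kd lW).
have Wut : over WD ([seq (c, k) | c <- up k z] ++ t).
  by move=> x; rewrite mem_cat => /orP[/mapP[c /uW Wc ->]|/Wt].
have H1 := upops_near s0 kd uW L1 Wt.
have H2 := lowop_near s0 nu_law kd lW LG Wut.
have H3 := delete_near s0 kd lW2 LG Wut.
have [[_ _ Gs] _] := LG.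
have pe : perm_eq ([seq (c, k) | c <- lo k z] ++ [seq (c, k) | c <- up k z] ++ t)
    ([seq x <- z | x.2 == k] ++ t).
  by rewrite catA perm_cat2r -degree_part_features -map_cat; apply: perm_map; exact: up_lo.
rewrite (Gs _ _ pe) in H3.
apply: near_le (near_trans (near_trans H1 H2) H3).
rewrite -degree_part_features size_map -(perm_size (up_lo k z)) size_cat natrD.
have h1 : (0 <= sigma * (size (up k z))%:R)%R by rewrite mulr_ge0// ltW.
have h2 : (0 <= sigma * (size (lo k z))%:R)%R by rewrite mulr_ge0// ltW.
rewrite /A; lra.
Qed.

Lemma totop_near d z F t : (d <= dg)%N -> over WD z -> lip_nice dg F -> over WD t ->
  near (totop d z F t) (F ([seq x <- z | (x.2 < d)%N] ++ t))
    (A * sigma * (size [seq x <- z | (x.2 < d)%N])%:R).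
Proof.
move=> + Wz; elim: d F t => [|d IH] F t dd LF Wt.
  rewrite (_ : [seq x <- z | _] = [::]); first by apply: near_refl; rewrite mulr0.
  by rewrite (eq_filter (a2 := pred0)) ?filter_pred0.
have LD := degop_lip dd Wz LF.
have H1 := IH _ _ (ltnW dd) LD Wt.
have Wzt : over WD ([seq x <- z | (x.2 < d)%N] ++ t).
  by move=> x; rewrite mem_cat mem_filter => /orP[/andP[_ /Wz]|/Wt].
have H2 := degop_near dd Wz LF Wzt.
have [[_ _ Fs] _] := LF.
have pe : perm_eq ([seq x <- z | x.2 == d] ++ [seq x <- z | (x.2 < d)%N])
    [seq x <- z | (x.2 < d.+1)%N].
  rewrite perm_sym -(perm_filterC (fun x : E => x.2 == d) [seq x <- z | (x.2 < d.+1)%N]).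
  rewrite -!filter_predI (eq_filter (a2 := fun x : E => x.2 == d)); last first.
    by move=> x /=; case: eqVneq => // ->; rewrite ltnSn.
  rewrite (@eq_filter _ (predI (predC _) _) (fun x : E => (x.2 < d)%N))// => x /=.
  by rewrite ltnS ltn_neqAle.
rewrite (Fs _ ([seq x <- z | (x.2 < d.+1)%N] ++ t)) in H2; last by rewrite catA perm_cat2r.
apply: near_le (near_trans H1 H2).
by rewrite -mulrDr -natrD -(perm_size pe) size_cat addnC.
Qed.

Lemma totop_nearW z F : over WD z -> lip_nice dg F ->
  near (totop dg z F [::]) (F z) (A * sigma * (size z)%:R).
Proof.
move=> Wz LF; have := totop_near (leqnn dg) Wz LF (over_nil WD).
rewrite (_ : [seq x <- z | (x.2 < dg)%N] = z) ?cats0//.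
by apply/all_filterP/allP => x /Wz[].
Qed.

(** The mean deviation from Z0 under the kernel centred at Z. *)
Definition kernel_mad (Z0 Z : diagram R) : \bar R :=
  totop dg (enum_mset Z) (bot0 dg Z0) [::].

Lemma kernel_multikern (s : seq E) (Z : diagram R) :
  Defs.kernel dg nu sigma s Z = multikern dg (enum_mset Z) s.
Proof.
congr (_ * _)%R; apply: eq_bigr => k _; apply: kernel1E => c _.
exact: q_upper_neq1.
Qed.

Hypothesis dg_gt0 : (0 < dg)%N.

Lemma bot0_nice (Z0 : diagram R) : lip_nice dg (bot0 dg Z0).
Proof.
split; last exact: bot0_lip.
by split; [exact: measurable_bot0|exact: bot0_ge0|exact: bot0_sym].
Qed.

(** The operators do not depend on the order in which the features of Z are
    enumerated, so the functional is symmetric in them. *)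
Lemma measurable_kernel_mad (Z0 : diagram R) :
  measurable_fun setT (kernel_mad Z0 : mdiagram R -> \bar R).
Proof.
apply: (@measurable_on_diagrams R _ _ (fun z => totop dg z (bot0 dg Z0) [::])).
  have H := @measurable_totop R sigma (q_upper sigma) (p_upper sigma) (p_lower sigma) nu
    mq mp mpl q0 q1 p0 pl0 nu0 dg (fun=> bot0 dg Z0).
  have {}H := H (measurableT_comp (measurable_bot0 dg_gt0 Z0) measurable_snd)
     (fun _ => bot0_ge0 dg_gt0 Z0).
  by apply: (measurableT_comp (g := fun z : seq E => (z, [::])) H); meas.
move=> z z' zz'; congr (_ [::]); apply: totop_perm => //.
by have [] := bot0_nice Z0.
Qed.

Lemma kernel_mad_near (Z0 Z : diagram R) : in_diagram Z `<=` WD ->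
  near (kernel_mad Z0 Z) (bot0 dg Z0 (enum_mset Z)) (A * sigma * (size (enum_mset Z))%:R).
Proof. by move=> WZ; apply: totop_nearW; [exact: WZ|exact: bot0_nice]. Qed.

(** Linearity of the integral. *)
Lemma MAD_kde (Z0 : diagram R) n (D : nat -> diagram R) :
  MAD dg Z0 (kde dg nu sigma n D) = (n%:R^-1)%:E * \sum_(i < n) kernel_mad Z0 (D i).
Proof.
have mk0 i s : (0 <= multikern dg (enum_mset (D i)) s)%R by exact: multikern_ge0.
have mmk i : measurable_fun setT (fun s => (multikern dg (enum_mset (D i)) s)%:E).
  by apply/measurable_EFinP; exact: measurable_multikern.
have kdeE s : kde dg nu sigma n D s = (n%:R^-1 * \sum_(i < n) multikern dg (enum_mset (D i)) s)%R.
  by rewrite /kde; under eq_bigr do rewrite kernel_multikern.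
have kde0 s : (0 <= kde dg nu sigma n D s)%R.
  by rewrite kdeE mulr_ge0 ?invr_ge0// sumr_ge0.
have mkde : measurable_fun setT (kde dg nu sigma n D).
  rewrite (funext kdeE).
  apply: measurable_funM => //; apply: measurable_sum => i.
  exact: measurable_multikern.
rewrite MADE//; last first.
  apply: measurable_fun_ifT => //; first exact: measurable_asbool_over (@measurable_Wdeg R dg).
  exact/measurable_EFinP.
have mWD := @measurable_Wdeg R dg.
have mb := measurable_bot0 dg_gt0 Z0; have b0 := bot0_ge0 dg_gt0 Z0.
rewrite (@eq_totint _ _ _ _ _ _ (fun s => (n%:R^-1)%:E *
    \sum_(i < n) (multikern dg (enum_mset (D i)) s)%:E * bot0 dg Z0 s)); last first.
  move=> s Ws; rewrite /on_W asboolT// kdeE EFinM muleC -muleA; congr (_ * _).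
  by rewrite -sumEFin ge0_sume_distrl// => i _; rewrite lee_fin.
have mt i : measurable_fun setT (fun s => (multikern dg (enum_mset (D i)) s)%:E * bot0 dg Z0 s).
  exact: emeasurable_funM.
have t0 i s : 0 <= (multikern dg (enum_mset (D i)) s)%:E * bot0 dg Z0 s.
  by rewrite mule_ge0// lee_fin.
rewrite totintZ//; last 2 first.
- exact: emeasurable_sum.
- by move=> s; apply: sume_ge0.
congr (_ * _).
have kE j : kernel_mad Z0 (D j) =
    totint fmu WD (fun s => (multikern dg (enum_mset (D j)) s)%:E * bot0 dg Z0 s).
  have [nb _] := bot0_nice Z0.
  apply: (@eq_trans _ _ (totint fmu WD
    (fun s => (multikern dg (enum_mset (D j)) s)%:E * bot0 dg Z0 (s ++ [::])))).
    by apply/esym; apply: totint_multikern.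
  by apply: eq_totint => s _; rewrite cats0.
have IH j : totint fmu WD (fun s => \sum_(i < j) (multikern dg (enum_mset (D i)) s)%:E * bot0 dg Z0 s) =
   \sum_(i < j) kernel_mad Z0 (D i).
  elim: j => [|j IH].
    rewrite big_ord0 -[RHS](mul0e (totint fmu WD (bot0 dg Z0))) -totintZ//.
    by apply: eq_totint => s _; rewrite big_ord0 mul0e.
  rewrite big_ord_recr /=.
  rewrite (@eq_totint _ _ _ _ _ _ (fun s =>
    (\sum_(i < j) (multikern dg (enum_mset (D i)) s)%:E * bot0 dg Z0 s) +
    (multikern dg (enum_mset (D j)) s)%:E * bot0 dg Z0 s)); last first.
    by move=> s _; rewrite big_ord_recr.
  rewrite totintD//.
  - by rewrite IH kE.
  - exact: emeasurable_sum.
  - by move=> s; apply: sume_ge0.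
exact: IH.
Qed.

End kernel_operators.

(** * A weak law of large numbers in L1 *)

Section pair_of_random_elements.
Context {dT dU} {T : measurableType dT} {U : measurableType dU} {R : realType}
  {P : probability T R}.
Variables X Y : {RV P >-> U}.
Local Open Scope ereal_scope.

Definition pair_rv (w : T) : U * U := (X w, Y w).

Let mpair : measurable_fun setT pair_rv.
Proof. by apply/measurable_fun_pair; exact: measurable_funPT. Qed.

HB.instance Definition _ := isMeasurableFun.Build _ _ _ _ pair_rv mpair.

(** Independence says that the joint law is the product law, as both agree on
    rectangles; the identity is then Tonelli's theorem. *)
Lemma independent_product (g h : U -> \bar R) :
  (forall A B, measurable A -> measurable B ->
    P ((X @^-1` A) `&` (Y @^-1` B)) = P (X @^-1` A) * P (Y @^-1` B)) ->
  measurable_fun setT g -> measurable_fun setT h ->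
  (forall x, 0 <= g x) -> (forall x, 0 <= h x) ->
  \int[P]_w (g (X w) * h (Y w)) = \int[P]_w g (X w) * \int[P]_w h (Y w).
Proof.
move=> ind mg mh g0 h0.
have mgh : measurable_fun setT (fun z : U * U => g z.1 * h z.2).
  by apply: emeasurable_funM; apply: measurableT_comp.
have gh0 (z : U * U) : 0 <= g z.1 * h z.2 by rewrite mule_ge0.
transitivity (\int[distribution P pair_rv]_z (g z.1 * h z.2)).
  by rewrite ge0_integral_distribution.
transitivity (\int[(distribution P X \x distribution P Y)]_z (g z.1 * h z.2)).
  apply: eq_measure_integral => A mA _; apply/esym.
  by apply: product_measure_unique => // B C mB mC; rewrite -ind.
rewrite fubini_tonelli1//.
transitivity (\int[distribution P X]_x (g x * \int[P]_w h (Y w))).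
  apply: eq_integral => x _; rewrite /fubini_F /= ge0_integralZl//.
  by rewrite ge0_integral_distribution.
rewrite ge0_integral_distribution//; last 2 first.
- exact: emeasurable_funM.
- by move=> x; rewrite mule_ge0//; exact: integral_ge0.
have mgX : measurable_fun setT (g \o X) by exact: measurableT_comp.
rewrite [RHS]muleC -ge0_integralZl//; last exact: integral_ge0.
by apply: eq_integral => w _; rewrite muleC.
Qed.
End pair_of_random_elements.

Lemma cvg_probability0 {dT} {T : measurableType dT} {R : realType} (P : probability T R)
    (B : nat -> set T) : (forall n, measurable (B n)) ->
  (forall eps : R, 0 < eps -> \forall n \near \oo, (P (B n) <= eps%:E)%E) ->
  P (B n) @[n --> \oo] --> 0%E.
Proof.
move=> mB bound.
have fin n : P (B n) \is a fin_num.
  by rewrite ge0_fin_numE// (le_lt_trans (probability_le1 P (mB n)))// ltry.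
apply/fine_cvgP; split; first exact: nearW.
apply/cvgrPdist_le => eps eps0; near=> n.
rewrite sub0r normrN ger0_norm ?fine_ge0// -lee_fin fineK//.
by near: n; exact: bound.
Unshelve. all: by end_near. Qed.

Section weak_law.
Context {dT dU} {T : measurableType dT} {U : measurableType dU} {R : realType}
  {P : probability T R} (D : nat -> {RV P >-> U}).
Hypotheses (law : forall i A, measurable A -> P (D i @^-1` A) = P (D 0 @^-1` A))
  (ind : forall i j A B, i != j -> measurable A -> measurable B ->
    P ((D i @^-1` A) `&` (D j @^-1` B)) = (P (D i @^-1` A) * P (D j @^-1` B))%E).
Local Open Scope ereal_scope.

Lemma same_expectation i (g : U -> \bar R) : measurable_fun setT g -> (forall x, 0 <= g x) ->
  \int[P]_w g (D i w) = \int[P]_w g (D 0 w).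
Proof.
move=> mg g0; rewrite -[LHS](ge0_integral_distribution (D i) mg g0)//.
rewrite -[RHS](ge0_integral_distribution (D 0) mg g0)//.
by apply: eq_measure_integral => A mA _; exact: law.
Qed.

Lemma int_prob_cst (r : R) : \int[P]_w r%:E = r%:E.
Proof.
rewrite (integral_cst P measurableT r%:E).
by rewrite -[RHS]mule1; congr (_ * _); exact: probability_setT.
Qed.

(** Only pairwise independence is used.  Expanding the square would involve
    negative terms; moving the cross term to the other side keeps all the
    integrands nonnegative. *)
Lemma second_moment (psi : U -> R) (K c : R) n :
  measurable_fun setT psi -> (forall x, 0 <= psi x <= K)%R ->
  \int[P]_w (psi (D 0 w))%:E = c%:E ->
  \int[P]_w ((\sum_(i < n) psi (D i w) - n%:R * c) ^+ 2)%:E <= (n%:R * K ^+ 2)%:E.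
Proof.
move=> mpsi psiK Ec.
have psi0 x : (0 <= psi x)%R by case/andP: (psiK x).
have mpsiE : measurable_fun setT (fun x => (psi x)%:E) by exact/measurable_EFinP.
have psi0E x : 0 <= (psi x)%:E by rewrite lee_fin.
have mY i : measurable_fun setT (fun w => psi (D i w)) by exact: measurableT_comp.
have c0 : (0 <= c)%R by rewrite -lee_fin -Ec; exact: integral_ge0.
have EY i : \int[P]_w (psi (D i w))%:E = c%:E.
  by rewrite (same_expectation i (g := fun x => (psi x)%:E)).
pose S w := (\sum_(i < n) psi (D i w))%R.
have mS : measurable_fun setT S by apply: measurable_sum => i.
have S0 w : (0 <= S w)%R by apply: sumr_ge0.
have ES : \int[P]_w (S w)%:E = (n%:R * c)%:E.
  under eq_integral do rewrite -sumEFin.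
  rewrite ge0_integral_sum//; last by move=> i; exact/measurable_EFinP.
  rewrite (eq_bigr (fun=> c%:E)) => [|i _]; last exact: EY.
  by rewrite sumEFin big_const_ord iter_addr addr0 mulr_natl.
have EYY i j : \int[P]_w (psi (D i w) * psi (D j w))%:E <= ((i == j)%:R * K ^+ 2 + c ^+ 2)%:E.
  have [->|ij] := eqVneq i j.
    apply: (@le_trans _ _ (\int[P]_w (K ^+ 2)%:E)).
      apply: ge0_le_integral => //.
      - by move=> w _; rewrite lee_fin mulr_ge0.
      - by apply/measurable_EFinP; exact: measurable_funM.
      - move=> w _; rewrite lee_fin expr2; have /andP[h1 h2] := psiK (D j w).
        exact: ler_pM.
    rewrite int_prob_cst lee_fin mul1r lerDl sqr_ge0//.
  under eq_integral do rewrite EFinM.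
  rewrite (independent_product (g := fun x => (psi x)%:E) (h := fun x => (psi x)%:E))//; last first.
    by move=> A B; exact: ind.
  by rewrite !EY -EFinM lee_fin mul0r add0r expr2.
have ESS : \int[P]_w (S w ^+ 2)%:E <= (n%:R * K ^+ 2 + (n%:R * c) ^+ 2)%:E.
  have mYY i j : measurable_fun setT (fun w => (psi (D i w) * psi (D j w))%:E).
    by apply/measurable_EFinP; exact: measurable_funM.
  have YY0 i j w : 0 <= (psi (D i w) * psi (D j w))%:E by rewrite lee_fin mulr_ge0.
  rewrite (eq_integral (fun w => \sum_(i < n) \sum_(j < n) (psi (D i w) * psi (D j w))%:E)); last first.
    move=> w _; rewrite expr2 /S big_distrlr /= -sumEFin.
    by apply: eq_bigr => i _; rewrite -sumEFin.
  rewrite ge0_integral_sum//; last 2 first.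
  - by move=> i; exact: emeasurable_sum.
  - by move=> i w _; exact: sume_ge0.
  apply: (@le_trans _ _ (\sum_(i < n) \sum_(j < n) (((i : nat) == j)%:R * K ^+ 2 + c ^+ 2)%:E)).
    by apply: lee_sum => i _; rewrite ge0_integral_sum//; apply: lee_sum => j _; exact: EYY.
  rewrite (eq_bigr (fun=> (K ^+ 2 + n%:R * c ^+ 2)%:E)); last first.
    move=> i _; rewrite sumEFin big_split /=; congr (_ + _)%:E.
      rewrite (bigD1 i)//= eqxx mul1r big1 ?addr0// => j.
      by rewrite -val_eqE eq_sym => /negbTE ->; rewrite mul0r.
    by rewrite big_const_ord iter_addr addr0 mulr_natl.
  rewrite sumEFin big_const_ord iter_addr addr0 lee_fin -[leLHS]mulr_natl.
  rewrite exprMn [(n%:R ^+ 2)%R]expr2; lra.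
pose V w := ((S w - n%:R * c) ^+ 2)%R.
have mV : measurable_fun setT V by apply: measurable_funX; exact: measurable_funB.
have nc0 : (0 <= 2 * (n%:R * c))%R by rewrite !mulr_ge0.
have : \int[P]_w (V w)%:E + (2 * (n%:R * c) * (n%:R * c))%:E <=
    (n%:R * K ^+ 2 + (n%:R * c) ^+ 2)%:E + ((n%:R * c) ^+ 2)%:E.
  rewrite EFinM -ES -ge0_integralZl//; last 2 first.
  - exact/measurable_EFinP.
  - by move=> w _; rewrite lee_fin.
  rewrite -ge0_integralD//; last 4 first.
  - by move=> w _; rewrite lee_fin sqr_ge0.
  - exact/measurable_EFinP.
  - by move=> w _; rewrite -EFinM lee_fin mulr_ge0.
  - by apply: emeasurable_funM => //; exact/measurable_EFinP.
  rewrite (eq_integral (fun w => (S w ^+ 2)%:E + ((n%:R * c) ^+ 2)%:E)); last first.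
    by move=> w _; rewrite -EFinM -!EFinD /V; congr (_%:E); lra.
  rewrite ge0_integralD//; last 3 first.
  - by move=> w _; rewrite lee_fin sqr_ge0.
  - by apply/measurable_EFinP; exact: measurable_funX.
  - by move=> w _; rewrite lee_fin sqr_ge0.
  rewrite int_prob_cst.
  exact: leeD.
rewrite -leeBrDr// => /le_trans; apply; rewrite -!EFinD.
rewrite lee_fin; lra.
Qed.

Lemma markov_ge0 (V : T -> R) (a b : R) : (0 < a)%R -> measurable_fun setT V ->
  (forall w, 0 <= V w)%R -> \int[P]_w (V w)%:E <= b%:E ->
  P [set w | (a <= V w)%R] <= (b / a)%:E.
Proof.
move=> a0 mV V0 IV.
have mA : measurable [set w | (a <= V w)%R].
  rewrite -[X in measurable X]setTI.
  exact: (measurable_fun_ler (measurable_cst a) mV measurableT (Y := [set true])).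
rewrite mulrC EFinM lee_pdivlMl//.
apply: le_trans IV; apply: (@le_trans _ _ (\int[P]_(w in [set w | (a <= V w)%R]) (V w)%:E)).
  rewrite -integral_cst//; apply: ge0_le_integral => //.
  - by move=> w _; rewrite lee_fin ltW.
  - by apply: measurable_funTS; exact/measurable_EFinP.
apply: ge0_subset_integral => //; first exact/measurable_EFinP.
by move=> w _; rewrite lee_fin.
Qed.

Variables (phi : U -> R) (mu : R).
Hypotheses (mphi : measurable_fun setT phi) (phi0 : forall x, (0 <= phi x)%R)
  (Emu : \int[P]_w (phi (D 0 w))%:E = mu%:E).

(** Monotone convergence: a variable in L1 loses little expectation when it is
    truncated at a high level. *)
Lemma truncation (d : R) : (0 < d)%R -> exists K : nat, exists2 c : R,
  \int[P]_w (Num.min (phi (D 0 w)) K%:R)%:E = c%:E & (mu - d <= c <= mu)%R.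
Proof.
move=> d0.
pose g K w := (Num.min (phi (D 0 w)) K%:R)%:E.
have mX : measurable_fun setT (fun w => phi (D 0 w)) by exact: measurableT_comp.
have mg K : measurable_fun setT (g K).
  by apply/measurable_EFinP; apply: measurable_minr.
have g0 K w : 0 <= g K w by rewrite lee_fin le_min phi0 ler0n.
have gle K : \int[P]_w g K w <= mu%:E.
  rewrite -Emu; apply: ge0_le_integral => //.
  - exact/measurable_EFinP.
  - by move=> w _; rewrite lee_fin ge_min lexx.
have lim w : limn (g ^~ w) = (phi (D 0 w))%:E.
  apply/cvg_lim => //; apply: cvg_near_cst.
  have [K _ HK] := nbhs_infty_ger (phi (D 0 w)).
  exists K => // n /= Kn; rewrite /g min_l//; exact: HK.
have cvgI : \int[P]_w g K w @[K --> \oo] --> mu%:E.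
  rewrite -Emu; under [X in _ --> X]eq_integral do rewrite -lim.
  apply: cvg_monotone_convergence => //.
  by move=> w _ a b ab; rewrite lee_fin le_min ge_min lexx /= ge_min ler_nat ab orbT.
have Ifin K : \int[P]_w g K w \is a fin_num.
  rewrite ge0_fin_numE ?(le_lt_trans (gle K)) ?ltry//.
  by apply: integral_ge0 => w _; exact: g0.
have cvgR : fine (\int[P]_w g K w) @[K --> \oo] --> mu.
  exact: fine_cvg cvgI.
move/cvgrPdist_le : cvgR => /(_ d d0)[K _ HK].
exists K; exists (fine (\int[P]_w g K w)); first by rewrite fineK.
have := HK K (leqnn K); rewrite /= ler_distl => /andP[_ h].
by rewrite lerBlDr h /= -lee_fin fineK.
Qed.

(** Truncated variables obey Chebyshev's inequality, and Markov's inequality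
    controls the remainders, whose expectation is at most d. *)
Lemma weak_law_of_large_numbers (e : R) : (0 < e)%R ->
  P [set w | (e <= `|n%:R^-1 * \sum_(i < n) phi (D i w) - mu|)%R] @[n --> \oo] --> 0.
Proof.
move=> e0.
have mX i : measurable_fun setT (fun w => phi (D i w)) by exact: measurableT_comp.
have mA n : measurable_fun setT (fun w => n%:R^-1 * \sum_(i < n) phi (D i w))%R.
  by apply: measurable_funM => //; apply: measurable_sum => i.
pose B n := [set w | (e <= `|n%:R^-1 * \sum_(i < n) phi (D i w) - mu|)%R].
have mB n : measurable (B n).
  rewrite -[X in measurable X]setTI.
  apply: (measurable_fun_ler (measurable_cst e) _ measurableT (Y := [set true])) => //.
  by apply: measurableT_comp => //; apply: measurable_funB.
suff bound (eps : R) : (0 < eps)%R -> \forall n \near \oo, P (B n) <= eps%:E.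
  exact: cvg_probability0.
move=> eps0.
pose d : R := Num.min (e / 4)%R (eps * e / 8)%R.
have d0 : (0 < d)%R by rewrite lt_min !divr_gt0// mulr_gt0.
have d1 : (d <= e / 4)%R by rewrite ge_min lexx.
have d2 : (d <= eps * e / 8)%R by rewrite ge_min lexx orbT.
have [K [c Ec /andP[c1 c2]]] := truncation d0.
pose psi x : R := Num.min (phi x) K%:R%R.
have mpsi : measurable_fun setT psi by apply: measurable_minr.
have psiK x : (0 <= psi x <= K%:R)%R by rewrite le_min phi0 ler0n /= ge_min lexx orbT.
pose rho x := (phi x - psi x)%R.
have mrho : measurable_fun setT rho by exact: measurable_funB.
have rho0 x : (0 <= rho x)%R by rewrite subr_ge0 ge_min lexx.
have mpsiE : measurable_fun setT (fun x => (psi x)%:E) by exact/measurable_EFinP.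
have mrhoE : measurable_fun setT (fun x => (rho x)%:E) by exact/measurable_EFinP.
have mY i : measurable_fun setT (fun w => psi (D i w)) by exact: measurableT_comp.
have mZ i : measurable_fun setT (fun w => rho (D i w)) by exact: measurableT_comp.
have Erho i : \int[P]_w (rho (D i w))%:E <= d%:E.
  rewrite (same_expectation i mrhoE); last by move=> x; rewrite lee_fin.
  have : \int[P]_w (rho (D 0 w))%:E + c%:E = mu%:E.
    rewrite -Ec -Emu -ge0_integralD//; last 4 first.
    - by move=> w _; rewrite lee_fin.
    - exact/measurable_EFinP.
    - by move=> w _; rewrite lee_fin le_min phi0 ler0n.
    - by apply/measurable_EFinP; exact: mY.
    by apply: eq_integral => w _; rewrite -EFinD /rho subrK.
  move=> H; rewrite -(@leeD2rE _ c%:E)// H -EFinD lee_fin; lra.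
pose S n w := (\sum_(i < n) psi (D i w))%R.
pose Q n w := (\sum_(i < n) rho (D i w))%R.
have mS n : measurable_fun setT (S n) by apply: measurable_sum => i.
have mQ n : measurable_fun setT (Q n) by apply: measurable_sum => i.
have Q0 n w : (0 <= Q n w)%R by apply: sumr_ge0.
have EQ n : \int[P]_w (Q n w)%:E <= (n%:R * d)%:E.
  rewrite /Q; under eq_integral do rewrite -sumEFin.
  rewrite ge0_integral_sum//; last 2 first.
  - by move=> i; exact/measurable_EFinP.
  - by move=> i w _; rewrite lee_fin.
  apply: (@le_trans _ _ (\sum_(i < n) d%:E)); first by apply: lee_sum => i _; exact: Erho.
  by rewrite sumEFin big_const_ord iter_addr addr0 mulr_natl.
near=> n.
have n0 : (0 < n%:R :> R)%R by rewrite ltr0n; near: n; exact: nbhs_infty_gt.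
pose B1 := [set w | ((n%:R * (e / 4)) ^+ 2 <= (S n w - n%:R * c) ^+ 2)%R].
pose B2 := [set w | (n%:R * (e / 2) <= Q n w)%R].
have mB1 : measurable B1.
  rewrite -[X in measurable X]setTI.
  apply: (measurable_fun_ler (measurable_cst _) _ measurableT (Y := [set true])) => //.
  by apply: measurable_funX; apply: measurable_funB.
have mB2 : measurable B2.
  rewrite -[X in measurable X]setTI.
  exact: (measurable_fun_ler (measurable_cst _) (mQ n) measurableT (Y := [set true])).
have sub : B n `<=` B1 `|` B2.
  move=> w Bw; apply: contrapT => /not_orP[/negP h1 /negP h2].
  rewrite -ltNge in h1; rewrite -ltNge in h2.
  move: Bw; rewrite /B /= => h3.
  have e4 : (0 <= n%:R * (e / 4))%R by rewrite mulr_ge0 ?divr_ge0// ltW.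
  have h1' : (`|S n w - n%:R * c| < n%:R * (e / 4))%R.
    rewrite -(ger0_norm e4) -ltr_sqr ?nnegrE// !real_normK ?num_real//.
  have h4 : (\sum_(i < n) phi (D i w) = S n w + Q n w)%R.
    by rewrite /S /Q -big_split /=; apply: eq_bigr => i _; rewrite /rho addrC subrK.
  have h5 : (n%:R^-1 * \sum_(i < n) phi (D i w) - mu =
      n%:R^-1 * (S n w - n%:R * c) + n%:R^-1 * Q n w - (mu - c))%R.
    rewrite h4 mulrBr mulKf ?gt_eqF// mulrDr; lra.
  have h6 : (`|n%:R^-1 * (S n w - n%:R * c)| < e / 4)%R.
    by rewrite normrM gtr0_norm ?invr_gt0// ltr_pdivrMl.
  have h7 : (n%:R^-1 * Q n w < e / 2)%R by rewrite ltr_pdivrMl.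
  have h8 : (0 <= n%:R^-1 * Q n w)%R by rewrite mulr_ge0// invr_ge0 ltW.
  move: h3; apply/negP; rewrite -ltNge h5 ltr_norml; move: h6; rewrite ltr_norml => /andP[h9 h10].
  by apply/andP; split; lra.
apply: (le_trans (le_measure P _ _ sub)); rewrite ?inE//; first exact: measurableU.
have PU : P (B1 `|` B2) <= P B1 + P B2 by exact: measureU2.
apply: (le_trans PU) => {PU}.
apply: (@le_trans _ _ ((eps / 2)%:E + (eps / 2)%:E)); last by rewrite -EFinD lee_fin; lra.
apply: leeD.
  apply: (@le_trans _ _ ((n%:R * K%:R ^+ 2) / (n%:R * (e / 4)) ^+ 2)%:E).
    apply: markov_ge0.
    - by rewrite exprn_gt0// mulr_gt0// divr_gt0.
    - by apply: measurable_funX; apply: measurable_funB.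
    - by move=> w; exact: sqr_ge0.
    - exact: second_moment.
  have n_big : (K%:R ^+ 2 * 16 / e ^+ 2 / (eps / 2) <= n%:R)%R.
    by near: n; exact: nbhs_infty_ger.
  rewrite lee_fin ler_pdivrMr; last by rewrite exprn_gt0// mulr_gt0// divr_gt0.
  move: n_big; rewrite !ler_pdivrMr ?divr_gt0 ?exprn_gt0// => h.
  have := ler_wpM2l (ltW n0) h; rewrite exprMn expr_div_n [(n%:R ^+ 2)%R]expr2; lra.
apply: (@le_trans _ _ ((n%:R * d) / (n%:R * (e / 2)))%:E).
  by apply: markov_ge0 => //; rewrite mulr_gt0// divr_gt0.
rewrite lee_fin ler_pdivrMr; last by rewrite mulr_gt0// divr_gt0.
have : (0 <= n%:R * (eps * e))%R by rewrite !mulr_ge0// ltW.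
have := ler_wpM2l (ltW n0) d2; lra.
Unshelve. all: by end_near. Qed.

End weak_law.

(** * Integrability of the bottleneck distance *)

Lemma dyadic_bracket {R : realType} (r : R) : 1 <= r ->
  exists k, 2 ^+ k <= r < 2 ^+ k.+1.
Proof.
move=> r1; have /andP[h1 h2] := truncn_itv (le_trans ler01 r1).
have n0 : (0 < Num.trunc r)%N by rewrite -ltnS -(ltr_nat R); exact: le_lt_trans h2.
have /andP[h3 h4] := trunc_log_bounds (isT : (1 < 2)%N) n0.
exists (trunc_log 2 (Num.trunc r)); apply/andP; split.
  by apply: le_trans h1; rewrite -natrX ler_nat.
by apply: (lt_le_trans h2); rewrite -natrX ler_nat.
Qed.

Lemma bigmax_ge {R : realType} {X : eqType} (s : seq X) (F : X -> R) x : x \in s ->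
  F x <= \big[Num.max/0]_(y <- s) F y.
Proof.
elim: s => // y s IH; rewrite inE big_cons le_max => /predU1P[->|/IH ->].
  by rewrite lexx.
by rewrite orbT.
Qed.

Lemma bigmax_attained {R : realType} {X : eqType} (s : seq X) (F : X -> R) :
  \big[Num.max/0]_(x <- s) F x = 0 \/
  exists2 y, y \in s & \big[Num.max/0]_(x <- s) F x = F y.
Proof.
elim: s => [|x s IH]; first by left; rewrite big_nil.
rewrite big_cons; case: (leP (F x)) => _; last by right; exists x; rewrite ?mem_head.
case: IH => [->|[y ys ->]]; [by left|right].
by exists y => //; rewrite inE ys orbT.
Qed.

Lemma dyadic_volume {R : realType} (d : R) k N :
  (2 ^+ k) ^- (2 * N).+1 * (d * (2 ^+ k.+1) ^+ 2) ^+ N = (4 * d) ^+ N / 2 ^+ k.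
Proof.
have : (2 ^+ k : R) != 0 by rewrite expf_neq0.
rewrite [2 ^+ k.+1]exprS; move: (2 ^+ k) => u u0.
have -> : d * (2 * u) ^+ 2 = 4 * d * u ^+ 2 by rewrite exprMn; lra.
by rewrite [(_ * u ^+ 2) ^+ N]exprMn -exprM [u ^+ (2 * N).+1]exprSr invfM mulrC -mulrA mulVKf// expf_neq0.
Qed.

Section death_boxes.
Context {R : realType} (dg : nat).
Notation E := (feature R).
Local Open Scope ereal_scope.
Notation WD := (Wdeg R dg).

(** The births of features in W are nonnegative and less than the deaths, so the
    features that are below L fill a set of area at most L^2 in each degree. *)
Definition below (L : R) (x : E) : bool := (x.1.2 < L)%R.

Lemma measurable_below L : measurable_fun setT (below L).
Proof.
apply: measurable_fun_ltr => //; apply: measurableT_comp; last exact: measurable_fst.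
exact: measurable_snd.
Qed.

Lemma measurable_all_below L : measurable_fun setT (fun s : seq E => ((all (below L) s)%:R)%:E : \bar R).
Proof.
have H : measurable_fun setT (fun s : seq E => foldr (fun x b => below L x && b) true s).
  apply: measurable_foldr; apply: measurable_and => //.
  by apply: (measurableT_comp (measurable_below L)).
have E2 : (fun s : seq E => foldr (fun x b => below L x && b) true s) = all (below L).
  by apply/funext; elim=> //= x s ->.
by apply: measurable_bool_indicator; rewrite -E2.
Qed.

Lemma fmu_below (L : R) : (0 < L)%R ->
  \int[fmu]_(x in WD) ((below L x)%:R)%:E <= (dg%:R * L ^+ 2)%:E.
Proof.
move=> L0.
have mb : measurable_fun setT (fun x : E => ((below L x)%:R)%:E : \bar R).
  by apply: measurable_bool_indicator; exact: measurable_below.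
rewrite -[WD]setIT -int_featureE//.
apply: (@le_trans _ _ (\sum_(k < dg) (L ^+ 2)%:E)); last first.
  by rewrite sumEFin big_const_ord iter_addr addr0 mulr_natl.
apply: lee_sum => k _.
pose I : set (measurableTypeR R) := `[0%R, L]%classic.
have mI : measurable I by exact: measurable_itv.
have mII : measurable (I `*` I) by exact: measurableX.
have II : lebesgue2 R (I `*` I) = (L ^+ 2)%:E.
  transitivity (@lebesgue_measure R I * @lebesgue_measure R I); first exact: product_measure1E.
  by rewrite /I lebesgue_measure_itv /= lte_fin L0 -EFinD subr0 -EFinM expr2.
rewrite -II -[X in _ <= X]mul1e -(integral_cst _ mII) [leRHS]integral_mkcond [leLHS]integral_mkcond.
have mW : measurable [set p : measurableTypeR R * measurableTypeR R | W R p /\ [set: E] (p, nat_of_ord k)].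
  rewrite (_ : [set p | _] = W R); first exact: measurable_W.
  by apply/seteqP; split => p; [case|].
have mbk : measurable_fun setT (fun p : measurableTypeR R * measurableTypeR R => ((below L (p, nat_of_ord k))%:R)%:E : \bar R).
  by apply: (measurableT_comp mb); meas.
apply: ge0_le_integral => //.
- by move=> p _; apply: erestrict_ge0 => x _; rewrite lee_fin.
- by apply/(measurable_restrictT _ mW); exact: measurable_funTS.
- by apply/(measurable_restrictT _ mII).
move=> p _; rewrite !patchE; case: ifPn => [/set_mem[[p1 p2] _]|_]; last by case: ifP => //=; rewrite lee_fin.
rewrite /below /=; case: (ltP p.2 L) => pL; last by case: ifP => //=; rewrite lee_fin.
rewrite ifT//; apply/mem_set; rewrite /I; split; rewrite /= in_itv/=; apply/andP; split => //.
- by apply: ltW; apply: lt_trans pL.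
- by apply: ltW; apply: le_lt_trans p1 p2.
- exact: ltW.
Qed.

Lemma iterint_all_below (L : R) N : (0 < L)%R ->
  iterint fmu WD N (fun s => ((all (below L) s)%:R)%:E) <= ((dg%:R * L ^+ 2) ^+ N)%:E.
Proof.
move=> L0; have mWD := @measurable_Wdeg R dg.
have mb : measurable_fun setT (fun x : E => ((below L x)%:R)%:E : \bar R).
  by apply: measurable_bool_indicator; exact: measurable_below.
have l0 : (0 <= (dg%:R * L ^+ 2))%R by rewrite mulr_ge0// sqr_ge0.
elim: N => [|N IH]; first by rewrite /= expr0.
rewrite iterintS.
rewrite (eq_integral (fun x => ((below L x)%:R)%:E *
    iterint fmu WD N (fun s => ((all (below L) s)%:R)%:E))); last first.
  move=> x _; rewrite -iterintZ//; last exact: measurable_all_below.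
  apply: eq_iterint => s _ _; rewrite /= -EFinM -natrM.
  by case: (below L x); rewrite ?mul1n ?mul0n.
under eq_integral do rewrite muleC.
rewrite ge0_integralZl//; last 2 first.
- exact: measurable_funTS.
- by apply: iterint_ge0 => s; rewrite lee_fin.
rewrite exprSr EFinM; apply: lee_pmul => //.
- by apply: iterint_ge0 => s; rewrite lee_fin.
- by apply: integral_ge0 => x _; rewrite lee_fin.
- exact: fmu_below.
Qed.

(** The decay (A3), multiplied by the linear growth of the bottleneck distance, is
    of order r^-(2N+1) at lists whose largest death is r.  This sum dominates
    it: the term k bounds it for 2^k <= r < 2^(k+1), on a box of volume of order
    2^(2Nk). *)
Definition dyadic_tail N (s : seq E) : \bar R :=
  \sum_(k <oo) (((2 ^+ k) ^- (2 * N).+1)%:E * ((all (below (2 ^+ k.+1)) s)%:R)%:E).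

Lemma dyadic_tail_ge0 N s : 0 <= dyadic_tail N s.
Proof.
by apply: nneseries_ge0 => k _ _; rewrite mule_ge0 ?lee_fin ?invr_ge0 ?exprn_ge0.
Qed.

Lemma measurable_dyadic_tail N : measurable_fun setT (dyadic_tail N).
Proof.
apply: ge0_emeasurable_sum => [k s _ _|k _].
  by rewrite mule_ge0 ?lee_fin ?invr_ge0 ?exprn_ge0.
apply: emeasurable_funM => //; exact: measurable_all_below.
Qed.

Lemma dyadic_tail_ge N s (r : R) : (1 <= r)%R -> (forall x, x \in s -> (x.1.2 <= r)%R) ->
  (r ^- (2 * N).+1)%:E <= dyadic_tail N s.
Proof.
move=> r1 rs; have [k /andP[k1 k2]] := dyadic_bracket r1.
have p2 : (0 < (2 ^+ k : R))%R by rewrite exprn_gt0.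
have t0 j : 0 <= (((2 ^+ j) ^- (2 * N).+1)%:E * ((all (below (2 ^+ j.+1)) s)%:R)%:E) :> \bar R.
  by rewrite mule_ge0 ?lee_fin ?invr_ge0 ?exprn_ge0.
rewrite /dyadic_tail (nneseries_split _ k.+1)//; apply: (@le_trans _ _
    (\sum_(0 <= j < k.+1) (((2 ^+ j) ^- (2 * N).+1)%:E * ((all (below (2 ^+ j.+1)) s)%:R)%:E))); last first.
  by rewrite add0n leeDl// nneseries_ge0.
rewrite big_nat_recr//= -[leLHS]add0e; apply: leeD; first by apply: sume_ge0.
rewrite (_ : all _ s); last by apply/allP => x /rs xr; apply: le_lt_trans k2.
rewrite mule1 lee_fin lef_pV2 ?posrE ?exprn_gt0//; last exact: lt_le_trans r1.
by rewrite lerXn2r// nnegrE ltW// (lt_le_trans _ r1).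
Qed.

(** The terms are a constant times 2^-k. *)
Lemma iterint_dyadic_tail N : iterint fmu WD N (dyadic_tail N) < +oo.
Proof.
have mWD := @measurable_Wdeg R dg.
rewrite /dyadic_tail iterint_nneseries//; last first.
  by move=> k; apply: emeasurable_funM => //; exact: measurable_all_below.
apply: (@le_lt_trans _ _ (\sum_(k <oo) ((4 * dg%:R) ^+ N / 2 ^+ k)%:E)).
  apply: lee_nneseries => k _.
    by move=> _; apply: iterint_ge0 => s; rewrite mule_ge0 ?lee_fin ?invr_ge0 ?exprn_ge0.
  have w0 : 0 <= ((2 ^+ k) ^- (2 * N).+1)%:E :> \bar R by rewrite lee_fin invr_ge0 ?exprn_ge0.
  rewrite iterintZ//; last exact: measurable_all_below.
  apply: (@le_trans _ _ (((2 ^+ k) ^- (2 * N).+1)%:E * ((dg%:R * (2 ^+ k.+1) ^+ 2) ^+ N)%:E)).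
    apply: lee_wpmul2l; first by rewrite lee_fin invr_ge0 ?exprn_ge0.
    exact: iterint_all_below.
  rewrite -EFinM lee_fin.
  by rewrite dyadic_volume.
have H := @cvg_geometric_eseries_half R (2 * (4 * dg%:R) ^+ N) 0.
rewrite (eq_eseriesr (g := fun k => (2 * (4 * dg%:R) ^+ N / (2 ^ (k + 1))%:R)%:E)); last first.
  by move=> k _; rewrite natrX exprD invfM; congr (_%:E); lra.
by move/cvg_lim : H => ->//; rewrite ltry.
Qed.

End death_boxes.

Section integrability.
Context {R : realType} (dg : nat) {dT : measure_display} {T : measurableType dT}
  (P : probability T R) (D : {RV P >-> mdiagram R}) (f : seq (feature R) -> R) (M : nat).
Notation E := (feature R).
Notation WD := (Wdeg R dg).
Hypotheses (dg_gt0 : (0 < dg)%N) (f_pdf : has_global_pdf dg D f)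
  (A1 : forall s, seq_over WD s -> (M < size s)%N -> f s = 0)
  (A3 : exists C : R, 0 < C /\ forall N : nat, (1 <= N <= M)%N ->
       forall s, seq_over WD s -> size s = N ->
         f s <= C * coord_norm s ^- (2 * N + 2)).
Variables (Z0 : diagram R).
Hypothesis Z0_diagram : in_diagram Z0 `<=` WD.
Local Open Scope ereal_scope.
Let h := on_W dg f.
Let h0 s : 0 <= h s. Proof. exact: (pdf_ge0 f_pdf). Qed.
Let mh : measurable_fun setT h. Proof. exact: (measurable_pdf f_pdf). Qed.

Lemma totint_pdf : totint fmu WD h = 1.
Proof.
have := expectation_of_global_pdf f_pdf (measurable_cst 1) (fun=> lee01) (fun=> ltry 1).
under [in RHS]eq_totint do rewrite mule1.
by move=> <-; rewrite integral_cst// mul1e; exact: probability_setT.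
Qed.

(** Where all the deaths are at most 1 the bottleneck distance is bounded and f has
    total mass 1; elsewhere [dyadic_tail] dominates. *)
Lemma expected_bottleneck_fin : totint fmu WD (fun s => bot0 dg Z0 s * h s) < +oo.
Proof.
have mWD := @measurable_Wdeg R dg.
have [C [C0 A3']] := A3.
have [M_ H_] := (measurable_bot0 dg_gt0 Z0, bot0_ge0 dg_gt0 Z0).
have mbh : measurable_fun setT (fun s => bot0 dg Z0 s * h s) by exact: emeasurable_funM.
have bh0 s : 0 <= bot0 dg Z0 s * h s by rewrite mule_ge0.
pose C1 : R := (\sum_(x <- enum_mset Z0) half_pers x)%R.
have hp0 x : WD x -> (0 <= half_pers x)%R.
  by move=> [[_ /ltW x12] _]; rewrite divr_ge0// subr_ge0.
have C10 : (0 <= C1)%R.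
  by rewrite /C1 big_seq sumr_ge0// => x xZ; apply: hp0; exact: Z0_diagram.
have bound N s : over WD s -> size s = N -> (N <= M)%N ->
    bot0 dg Z0 s * h s <= (C1 + M%:R)%:E * h s + (M%:R * C)%:E * dyadic_tail N s.
  move=> Ws sN NM.
  have f0 : (0 <= f s)%R by case: f_pdf => _ _ + _ _; apply.
  rewrite bot0E// /h /on_W asboolT//.
  pose r : R := (\big[Num.max/0]_(x <- s) x.1.2)%R.
  have xr x : x \in s -> (x.1.2 <= r)%R.
    by move=> xs; exact: (bigmax_ge (fun x : E => x.1.2)).
  have r0 : (0 <= r)%R.
    rewrite /r; case: (bigmax_attained s (fun x : E => x.1.2)) => [->//|[y ys ->]].
    by have [[y0 yd] _] := Ws y ys; exact: ltW (le_lt_trans y0 yd).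
  have Hs : (\sum_(x <- s) half_pers x <= N%:R * r)%R.
    rewrite -sN; apply: (@le_trans _ _ (\sum_(x <- s) r)%R); last first.
      by rewrite big_const_seq count_predT iter_addr addr0 mulr_natl.
    rewrite big_seq [leRHS]big_seq; apply: ler_sum => x xs.
    have [[x0 x12] _] := Ws x xs; have := xr x xs; rewrite /half_pers; lra.
  have dt0 := dyadic_tail_ge0 N s.
  have MC0 : (0 <= (M%:R * C)%:E :> \bar R) by rewrite lee_fin mulr_ge0// ltW.
  apply: (@le_trans _ _ ((C1 + N%:R * r) * f s)%:E).
    rewrite EFinM; apply: lee_wpmul2r; first by rewrite lee_fin.
    apply: (le_trans (bot_le Z0_diagram Ws)); rewrite lee_fin lerD2l//.
  have [r1|r1] := leP r 1%R.
    rewrite -[X in X <= _]adde0; apply: leeD; last by rewrite mule_ge0.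
    rewrite -EFinM lee_fin ler_wpM2r// lerD2l -[leRHS]mulr1.
    by apply: ler_pM => //; rewrite ler_nat.
  have N0 : (0 < N)%N.
    rewrite -sN lt0n size_eq0; apply: contraL (r1) => /eqP s0.
    by rewrite /r s0 big_nil -leNgt ler01.
  rewrite mulrDl EFinD; apply: leeD.
    by rewrite -EFinM lee_fin ler_wpM2r// lerDl.
  apply: (@le_trans _ _ ((M%:R * C)%:E * (r ^- (2 * N).+1)%:E)); last first.
    by apply: lee_wpmul2l => //; apply: dyadic_tail_ge => //; exact: ltW.
  have r0' : (0 < r)%R by exact: lt_trans r1.
  have nr : (r <= coord_norm s)%R.
    have [y ys ry] : exists2 y, y \in s & (r <= y.1.2)%R.
      case: (bigmax_attained s (fun x : E => x.1.2)) => [r00|[y ys ry]].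
        by move: r0'; rewrite /r r00 ltxx.
      by exists y => //; rewrite /r ry.
    apply: (le_trans ry); rewrite /coord_norm.
    have [[y0 y12] _] := Ws y ys.
    have yp : (0 <= y.1.2)%R by apply: ltW; exact: le_lt_trans y12.
    rewrite -[leLHS]ger0_norm// -sqrtr_sqr ler_wsqrtr// (big_rem y)//=.
    rewrite -addrA addrCA lerDl addr_ge0 ?sqr_ge0// sumr_ge0// => x _.
    by rewrite addr_ge0 ?sqr_ge0.
  have n0 : (0 < coord_norm s)%R by exact: lt_le_trans nr.
  have fs : (f s <= C * r ^- (2 * N + 2))%R.
    apply: (le_trans (A3' N _ s Ws sN)); first by rewrite N0.
    rewrite ler_pM2l// lef_pV2 ?posrE ?exprn_gt0//.
    by apply: lerXn2r; rewrite // nnegrE ltW.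
  rewrite -EFinM lee_fin.
  apply: (@le_trans _ _ (N%:R * r * (C * r ^- (2 * N + 2)))%R).
    by rewrite ler_wpM2l// mulr_ge0.
  have -> : (N%:R * r * (C * r ^- (2 * N + 2)) = N%:R * (C * r ^- (2 * N).+1))%R.
    rewrite addn2 [(r ^+ (2 * N).+2)%R]exprS invfM -!mulrA; congr (_ * _)%R.
    by rewrite [(r^-1 * _)%R]mulrC mulrCA [(r * (_ * r^-1))%R]mulrCA mulfV ?mulr1// gt_eqF.
  rewrite -mulrA ler_wpM2r ?ler_nat// mulr_ge0 ?invr_ge0 ?exprn_ge0// ltW//.
have hiter N : iterint fmu WD N h <= 1.
  rewrite -totint_pdf /totint (nneseries_split _ N.+1)//; last by move=> *; exact: iterint_ge0.
  rewrite add0n big_nat_recr//= -addeA addeCA leeDl// adde_ge0//.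
    by apply: sume_ge0 => *; exact: iterint_ge0.
  by apply: nneseries_ge0 => *; exact: iterint_ge0.
have mt N := measurable_dyadic_tail (R := R) N.
have t0 N s := dyadic_tail_ge0 N s.
rewrite /totint (@eseries_fin _ _ M.+1); last 2 first.
- by move=> N; exact: iterint_ge0.
- move=> N MN; rewrite (@eq_iterint _ _ _ _ _ _ _ (fun s => 0 * h s)).
    by rewrite iterintZ// mul0e.
  move=> s Ws sN; rewrite mul0e /h /on_W asboolT// A1 ?mule0//.
  by rewrite sN.
apply: lte_sum_pinfty => N _.
have NM : (N <= M)%N by rewrite -ltnS.
have MC0 : (0 <= (M%:R * C)%:E :> \bar R) by rewrite lee_fin mulr_ge0// ltW.
have CM0 : (0 <= (C1 + M%:R)%:E :> \bar R) by rewrite lee_fin addr_ge0.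
apply: (@le_lt_trans _ _ (iterint fmu WD N (fun s =>
   (C1 + M%:R)%:E * h s + (M%:R * C)%:E * dyadic_tail N s))).
  apply: le_iterint => //.
  - by apply: emeasurable_funD; exact: emeasurable_funM.
  - by move=> s; rewrite adde_ge0// mule_ge0.
  - by move=> s Ws sN; exact: bound.
rewrite iterintD//; last 4 first.
- exact: emeasurable_funM.
- exact: emeasurable_funM.
- by move=> s; rewrite mule_ge0.
- by move=> s; rewrite mule_ge0.
rewrite !iterintZ//; apply: lte_add_pinfty.
  by apply: lte_mul_pinfty => //; apply: (le_lt_trans (hiter N)); rewrite ltry.
by apply: lte_mul_pinfty => //; exact: iterint_dyadic_tail.
Qed.

End integrability.

(** * Convergence in probability *)

Lemma bigO_powR_cvg0 {R : realType} (sigma : nat -> R) (alpha : R) : 0 < alpha ->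
  sigma =O_\oo (fun n : nat => n%:R `^ (- alpha)) ->
  forall d : R, 0 < d -> \forall n \near \oo, sigma n <= d.
Proof.
move=> a0 /eqOP [k0 [_ Hk]] d d0.
pose k := Num.max (k0 + 1) 1.
have k1 : 0 < k by rewrite lt_max ltr01 orbT.
have {}Hk : \forall n \near \oo, `|sigma n| <= k * `|n%:R `^ (- alpha)|.
  by apply: Hk; rewrite /k lt_max ltrDl ltr01.
near=> n.
have n0 : 0 < n%:R :> R by rewrite ltr0n; near: n; exact: nbhs_infty_gt.
apply: (le_trans (ler_norm _)).
have /le_trans : `|sigma n| <= k * `|n%:R `^ (- alpha)| by near: n.
apply; rewrite ger0_norm ?powR_ge0// powRN ler_pdivrMr ?powR_gt0// -ler_pdivrMl//.
have kd : 0 <= d^-1 * k by rewrite mulr_ge0 ?invr_ge0// ltW.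
have -> : d^-1 * k = ((d^-1 * k) `^ alpha^-1) `^ alpha.
  by rewrite -powRrM mulVf ?powRr1// gt_eqF.
apply: ge0_ler_powR; rewrite ?nnegrE ?powR_ge0//; first exact: ltW.
by near: n; exact: nbhs_infty_ger.
Unshelve. all: by end_near. Qed.

Lemma near_fine {R : realType} (a : \bar R) (b e : R) : near a b%:E e ->
  exists2 a' : R, a = a'%:E & `|a' - b| <= e.
Proof.
case: a => [a| |] [h1 h2].
- by exists a => //; rewrite ler_distl; move: h1 h2; rewrite -!EFinD !lee_fin; lra.
- by move: h1; rewrite -EFinD leye_eq.
- by move: h2; rewrite addNye leeNy_eq.
Qed.

Section convergence.
Context {R : realType} (dg : nat) (dg_gt0 : (0 < dg)%N)
    {dT : measure_display} {T : measurableType dT} (P : probability T R)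
    (f : seq (feature R) -> R) (D : nat -> {RV P >-> mdiagram R}).
Hypotheses (f_pdf : forall i, has_global_pdf dg (D i) f)
    (D_indep : mutually_independent D).
Variable (M : nat).
Hypotheses
    (A1 : forall s, seq_over (Wdeg R dg) s -> (M < size s)%N -> f s = 0)
    (A3 : exists C : R, 0 < C /\ forall N : nat, (1 <= N <= M)%N ->
       forall s, seq_over (Wdeg R dg) s -> size s = N ->
         f s <= C * coord_norm s ^- (2 * N + 2)).
Variables (Z0 : diagram R).
Hypothesis (Z0_diagram : in_diagram Z0 `<=` Wdeg R dg).
Notation E := (feature R).
Notation WD := (Wdeg R dg).
Local Open Scope ereal_scope.

Let h := on_W dg f.
Let h0 s : 0 <= h s. Proof. exact: (pdf_ge0 (f_pdf 0)). Qed.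
Let mh : measurable_fun setT h. Proof. exact: (measurable_pdf (f_pdf 0)). Qed.
Let mWD := @measurable_Wdeg R dg.

Lemma pairwise_independent i j A B : i != j -> measurable A -> measurable B ->
  P ((D i @^-1` A) `&` (D j @^-1` B)) = P (D i @^-1` A) * P (D j @^-1` B).
Proof.
move=> ij mA mB; pose X k := if k == i then A else B.
have mX k : measurable (X k) by rewrite /X; case: ifP.
have := D_indep [fset i; j]%fset mX.
rewrite big_fsetU1 ?inE//= big_seq_fset1 {2}/X eqxx {2}/X eq_sym (negbTE ij) => <-.
congr (P _); apply/seteqP; split => [w [Aw Bw] k|w H].
  by rewrite /= !inE => /orP[]/eqP ->; rewrite /X ?eqxx// eq_sym (negbTE ij).
split; first by have := H i; rewrite /= !inE eqxx /X eqxx; apply.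
by have := H j; rewrite /= !inE eqxx orbT /X eq_sym (negbTE ij); apply.
Qed.

Lemma identically_distributed i A : measurable A ->
  P (D i @^-1` A) = P (D 0 @^-1` A).
Proof. by move=> mA; rewrite (law_of_global_pdf (f_pdf i) mA) (law_of_global_pdf (f_pdf 0) mA). Qed.

Let F (Z : mdiagram R) : \bar R := bot0 dg Z0 (enum_mset Z).
Let phi (Z : mdiagram R) : R := fine (F Z).

Let F0 Z : 0 <= F Z. Proof. exact: bot0_ge0. Qed.

Let Foo Z : F Z < +oo.
Proof.
rewrite /F /bot0; case: asboolP => // Ws.
by apply: (le_lt_trans (bot_le Z0_diagram Ws)); rewrite ltry.
Qed.

Let phiE Z : (phi Z)%:E = F Z. Proof. by rewrite fineK// ge0_fin_numE. Qed.

Let mF : measurable_fun setT F.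
Proof. by apply: measurable_on_diagrams; [exact: measurable_bot0|exact: bot0_sym]. Qed.

Let mphi : measurable_fun setT phi.
Proof. by apply/measurable_EFinP; rewrite (_ : _ \o _ = F)//; apply/funext => Z; exact: phiE. Qed.

Lemma MAD_expectation : MAD dg Z0 f = \int[P]_w (phi (D 0 w))%:E.
Proof.
rewrite MADE//; last by case: (f_pdf 0).
under [RHS]eq_integral do rewrite phiE.
rewrite (expectation_of_global_pdf (f_pdf 0))//; apply: eq_totint => s _.
by rewrite muleC; congr (_ * _); apply: bot0_sym; rewrite perm_sym perm_eq_seq_mset.
Qed.

Lemma MAD_fin : MAD dg Z0 f \is a fin_num.
Proof.
rewrite ge0_fin_numE; last by rewrite MAD_expectation integral_ge0// => w _; rewrite phiE.
rewrite MADE//; last by case: (f_pdf 0).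
exact: (expected_bottleneck_fin dg_gt0 (f_pdf 0) A1 A3 Z0_diagram).
Qed.

Definition oversized i : set T := [set w | (M < size (enum_mset (D i w)))%N].

Let mover (Z : mdiagram R) : bool := (M < size (enum_mset Z))%N.

Let m_mover : measurable_fun setT mover.
Proof.
apply: (@measurable_on_diagrams R _ _ (fun s => (M < size s)%N)).
  by apply: (measurableT_comp (f := fun n => (M < n)%N) _ measurable_size).
by move=> s t st; rewrite (perm_size st).
Qed.

Lemma measurable_oversized i : measurable (oversized i).
Proof.
rewrite -[X in measurable X]setTI.
exact: (measurableT_comp m_mover (measurable_funPT (D i)) measurableT (Y := [set true])).
Qed.

(** By (A1) the density vanishes on lists longer than M. *)
Lemma oversized0 i : P (oversized i) = 0.
Proof.
have mO := measurable_oversized i.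
pose Phi Z : \bar R := ((mover Z)%:R)%:E.
have mPhi : measurable_fun setT Phi by exact: measurable_bool_indicator.
have Phi0 Z : 0 <= Phi Z by rewrite lee_fin.
have Phioo Z : Phi Z < +oo by exact: ltry.
transitivity (\int[P]_w Phi (D i w)).
  transitivity (\int[P]_w (\1_(oversized i) w)%:E); first by rewrite integral_indic// setIT.
  apply: eq_integral => w _; rewrite /Phi indicE; congr ((nat_of_bool _)%:R%:E).
  by apply/idP/idP => [/set_mem|?]; [|exact/mem_set].
rewrite (expectation_of_global_pdf (f_pdf i) mPhi)//.
rewrite (@eq_totint _ _ _ _ _ _ (fun s => 0 * h s)); first by rewrite totintZ// mul0e.
move=> s Ws; rewrite mul0e /Phi /mover (perm_size (perm_eq_seq_mset s)).
rewrite /h /on_W asboolT//; have [Ms|_] := ltnP M (size s); last by rewrite mule0.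
by rewrite A1// mul0e.
Qed.

Variables (m : R) (nu : nat -> nat -> R).
Hypothesis nu_law : lower_count_law m nu.
Variable sigma : nat -> R.
Hypotheses (sigma_gt0 : forall n, (0 < sigma n)%R)
  (sigma0 : forall d : R, (0 < d)%R -> \forall n \near \oo, (sigma n <= d)%R).

(** A bound that is uniform over the diagrams with at most M features. *)
Lemma kde_close n w (i : nat) : ~ oversized i w ->
  near (kernel_mad dg (sigma n) nu Z0 (D i w)) (phi (D i w))%:E ((spread + 3) * sigma n * M%:R).
Proof.
move=> /negP; rewrite -leqNgt => sM.
have WD' : in_diagram (D i w) `<=` WD by case: (f_pdf i).
have := kernel_mad_near (sigma_gt0 n) nu_law dg_gt0 Z0 WD'; rewrite phiE.
apply: near_le; apply: ler_wpM2l; last by rewrite ler_nat.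
by apply: mulr_ge0; [rewrite addr_ge0// ltW// spread_gt0|exact: ltW].
Qed.

(** Outside of a null event, the estimate is within e / 2 of the empirical mean of
    the distances once sigma_n is small, and the empirical mean is within e / 2
    of its expectation with high probability. *)
Lemma MAD_kde_converges : cvg_in_probability P
    (fun n w => MAD dg Z0 (kde dg nu (sigma n) n (fun i => D i w)))
    (MAD dg Z0 f).
Proof.
move=> e e0.
have Ef : MAD dg Z0 f = (fine (MAD dg Z0 f))%:E by rewrite fineK// MAD_fin.
move: (fine _) Ef => mu Ef.
have XE n w := MAD_kde (sigma_gt0 n) nu_law dg_gt0 Z0 n (fun i => D i w).
pose X n w := MAD dg Z0 (kde dg nu (sigma n) n (fun i => D i w)).
have mX n : measurable_fun setT (X n).
  rewrite (_ : X n = fun w => (n%:R^-1)%:E * \sum_(i < n) kernel_mad dg (sigma n) nu Z0 (D i w)); last first.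
    by apply/funext => w; exact: XE.
  apply: emeasurable_funM => //; apply: emeasurable_sum => i.
  exact: (measurableT_comp (measurable_kernel_mad (sigma_gt0 n) nu_law dg_gt0 Z0)).
have null : P (\bigcup_i oversized i) = 0.
  apply: measure_negligible; first by apply: bigcup_measurable => i _; exact: measurable_oversized.
  apply: negligible_bigcup => i; exists (oversized i); split => //.
  - exact: measurable_oversized.
  - exact: oversized0.
have lln := @weak_law_of_large_numbers _ _ _ _ _ P D
  (fun i A => @identically_distributed i A)
  (fun i j A B => @pairwise_independent i j A B) phi mu mphi.
have {}lln := lln (fun Z => fine_ge0 (F0 Z)).
rewrite -MAD_expectation Ef in lln.
have e2 : (0 < e / 2)%R by rewrite divr_gt0.
have {}lln := lln erefl (e / 2)%R e2.
rewrite Ef; apply: cvg_probability0 => [n|eps eps0].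
  rewrite -[X in measurable X]setTI.
  apply: emeasurable_fun_c_infty => //.
  apply: measurableT_comp => //; apply: emeasurable_funB => //; exact: mX.
pose Bn n := [set w | (e / 2 <= `|n%:R^-1 * \sum_(i < n) phi (D i w) - mu|)%R].
have mBn n : measurable (Bn n).
  rewrite -[X in measurable X]setTI.
  apply: (measurable_fun_ler (measurable_cst _) _ measurableT (Y := [set true])) => //.
  apply: measurableT_comp => //; apply: measurable_funB => //.
  apply: measurable_funM => //; apply: measurable_sum => i; exact: measurableT_comp.
have Bsmall : \forall n \near \oo, P (Bn n) <= eps%:E.
  move/fine_cvgP : lln => [_ /cvgrPdist_le/(_ eps eps0)].
  apply: filterS => n; rewrite sub0r normrN ger0_norm ?fine_ge0// -lee_fin fineK//.
  by rewrite ge0_fin_numE// (le_lt_trans (probability_le1 P (mBn n)))// ltry.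
pose Am : R := ((spread + 3) * M%:R + 1)%R.
have Am0 : (0 < Am)%R.
  by rewrite ltr_wpDl// mulr_ge0// addr_ge0// ltW// spread_gt0.
near=> n.
have n0 : (0 < n%:R :> R)%R by rewrite ltr0n; near: n; exact: nbhs_infty_gt.
have sn : (sigma n <= e / 2 / Am)%R by near: n; apply: sigma0; rewrite divr_gt0.
have eta : ((spread + 3) * sigma n * M%:R <= e / 2)%R.
  have : (Am * sigma n <= e / 2)%R by rewrite -ler_pdivlMl// mulrC.
  by rewrite /Am; have := sigma_gt0 n; lra.
have PB : P (Bn n) <= eps%:E by near: n.
apply: (@le_trans _ _ (P ((\bigcup_i oversized i) `|` Bn n))).
  apply: le_measure; rewrite ?inE.
  - rewrite -[X in measurable X]setTI.
    apply: emeasurable_fun_c_infty => //.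
    by apply: measurableT_comp => //; apply: emeasurable_funB => //; exact: mX.
  - apply: measurableU => //; apply: bigcup_measurable => i _; exact: measurable_oversized.
  move=> w Aw; apply: contrapT => /not_orP[Now NBw]; apply: NBw.
  have cl (i : nat) : exists2 k : R, kernel_mad dg (sigma n) nu Z0 (D i w) = k%:E &
      (`|k - phi (D i w)| <= e / 2)%R.
    have Oi : ~ oversized i w by move=> Oi; apply: Now; exists i.
    have [k kE kl] := near_fine (kde_close n Oi); exists k => //; exact: le_trans kl eta.
  pose k (i : nat) : R := fine (kernel_mad dg (sigma n) nu Z0 (D i w)).
  have kE (i : nat) : kernel_mad dg (sigma n) nu Z0 (D i w) = (k i)%:E.
    by rewrite /k; have [? -> _] := cl i.
  have kphi (i : nat) : (`|k i - phi (D i w)| <= e / 2)%R.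
    by rewrite /k; have [? -> ?] := cl i.
  have Xk : X n w = (n%:R^-1 * \sum_(i < n) k i)%:E.
    by rewrite /X XE EFinM -sumEFin; congr (_ * _); apply: eq_bigr => i _; exact: kE.
  move: Aw; rewrite /Bn /= -/(X n w) Xk -EFinB lee_fin => Aw.
  have avg : (`|n%:R^-1 * \sum_(i < n) k i - n%:R^-1 * \sum_(i < n) phi (D i w)| <= e / 2)%R.
    rewrite -mulrBr -sumrB normrM gtr0_norm ?invr_gt0// ler_pdivrMl//.
    apply: (le_trans (ler_norm_sum _ _ _)).
    apply: (@le_trans _ _ (\sum_(i < n) e / 2)%R); first by apply: ler_sum => i _; exact: kphi.
    by rewrite big_const_ord iter_addr addr0 mulr_natl.
  have := ler_distD (n%:R^-1 * \sum_(i < n) phi (D i w))%R (n%:R^-1 * \sum_(i < n) k i)%R mu.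
  by move: avg Aw; lra.
apply: (@le_trans _ _ (P (\bigcup_i oversized i) + P (Bn n))).
  by apply: measureU2 => //; apply: bigcup_measurable => i _; exact: measurable_oversized.
by rewrite null add0e.
Unshelve. all: by end_near. Qed.
End convergence.

Theorem theorem3 (R : realType) (dg : nat) (dg_gt0 : (0 < dg)%N)
    (dT : measure_display) (T : measurableType dT) (P : probability T R)
    (f : seq (feature R) -> R) (D : nat -> {RV P >-> mdiagram R})
    (f_pdf : forall i, has_global_pdf dg (D i) f)
    (D_indep : mutually_independent D)
    (f_bounded : exists B : R, forall s, seq_over (Wdeg R dg) s -> f s <= B)
    (M : nat) (M_gt0 : (0 < M)%N)
    (A1 : forall s, seq_over (Wdeg R dg) s -> (M < size s)%N -> f s = 0)
    (A2 : forall N : nat, (1 <= N <= M)%N -> exists B : R,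
       forall s, seq_over (Wdeg R dg) s -> size s = N -> f s <= B)
    (A3 : exists C : R, 0 < C /\ forall N : nat, (1 <= N <= M)%N ->
       forall s, seq_over (Wdeg R dg) s -> size s = N ->
         f s <= C * coord_norm s ^- (2 * N + 2))
    (m : R) (m_gt0 : 0 < m) (nu : nat -> nat -> R)
    (nu_law : lower_count_law m nu)
    (alpha : R) (alpha_gt0 : 0 < alpha) (alpha_lt : alpha < alpha_threshold R M)
    (sigma : nat -> R) (sigma_gt0 : forall n, 0 < sigma n)
    (sigma_bigO : sigma =O_\oo (fun n : nat => n%:R `^ (- alpha)))
    (Z0 : diagram R) (Z0_diagram : in_diagram Z0 `<=` Wdeg R dg) :
  cvg_in_probability P
    (fun n w => MAD dg Z0 (kde dg nu (sigma n) n (fun i => D i w)))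
    (MAD dg Z0 f).
Proof.
apply: (MAD_kde_converges dg_gt0 f_pdf D_indep A1 A3 Z0_diagram nu_law sigma_gt0).
exact: bigO_powR_cvg0 alpha_gt0 sigma_bigO.
Qed.
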